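(* For every $n\ge 4$, every simple $n$-vertex quasiplanar graph has at most $6.5n-20$ edges.
   Context: A drawing of a graph on the sphere maps vertices to pairwise distinct points and each edge to a simple Jordan arc joining its endpoints, such that no edge passes through a vertex, any two edges have finitely many common points, every common interior point of two edges is a proper crossing, and no three edges pass through the same crossing. It is simple if any two edges have at most one point in common (in particular no parallel edges, adjacent edges do not cross, and two edges cross at most once). It is quasiplanar if no three edges pairwise cross. A simple quasiplanar graph is a graph admitting a drawing that is simple and quasiplanar. *)

(* Defs.v *)
From mathcomp Require Import all_boot.
From Stdlib Require Import Reals.

Set Implicit Arguments.
Unset Strict Implicit.
Unset Printing Implicit Defensive.

Definition pt3 := (R * R * R)%type.
Definition pt2 := (R * R)%type.

Definition d3 (p q : pt3) : R :=
  let '(x1, y1, z1) := p in let '(x2, y2, z2) := q in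
  sqrt ((x1 - x2) ^ 2 + (y1 - y2) ^ 2 + (z1 - z2) ^ 2)%R.

Definition d2 (p q : pt2) : R :=
  let '(x1, y1) := p in let '(x2, y2) := q in
  sqrt ((x1 - x2) ^ 2 + (y1 - y2) ^ 2)%R.

Definition on_sphere (p : pt3) : Prop :=
  let '(x, y, z) := p in (x ^ 2 + y ^ 2 + z ^ 2 = 1)%R.

Definition in_disk (z : pt2) : Prop :=
  let '(x, y) := z in (x ^ 2 + y ^ 2 < 1)%R.

Definition cont32 (A : pt3 -> Prop) (f : pt3 -> pt2) : Prop :=
  forall p, A p -> forall eps, (0 < eps)%R ->
    exists delta, (0 < delta)%R /\
      forall q, A q -> (d3 p q < delta)%R -> (d2 (f p) (f q) < eps)%R.

Definition cont23 (B : pt2 -> Prop) (g : pt2 -> pt3) : Prop :=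
  forall z, B z -> forall eps, (0 < eps)%R ->
    exists delta, (0 < delta)%R /\
      forall w, B w -> (d2 z w < delta)%R -> (d3 (g z) (g w) < eps)%R.

Definition is_arc (g : R -> pt3) : Prop :=
  (forall t, (0 <= t <= 1)%R -> on_sphere (g t)) /\
  (forall t, (0 <= t <= 1)%R -> forall eps, (0 < eps)%R ->
     exists delta, (0 < delta)%R /\
       forall s, (0 <= s <= 1)%R -> (Rabs (s - t) < delta)%R ->
         (d3 (g s) (g t) < eps)%R) /\
  (forall s t, (0 <= s <= 1)%R -> (0 <= t <= 1)%R -> g s = g t -> s = t).

Definition on_arc (g : R -> pt3) (q : pt3) : Prop :=
  exists s, (0 <= s <= 1)%R /\ g s = q.

(* p is a proper crossing of the arcs g1 and g2: there is an open
   neighbourhood U of p in S^2 and a homeomorphism h of U onto the open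
   unit disk with h p = 0, mapping g1 ∩ U onto the horizontal diameter and
   g2 ∩ U onto the vertical diameter (locally the arcs look like two
   lines crossing). *)
Definition proper_crossing (g1 g2 : R -> pt3) (p : pt3) : Prop :=
  exists (U : pt3 -> Prop) (h : pt3 -> pt2) (k : pt2 -> pt3),
    U p /\
    (forall q, U q -> on_sphere q) /\
    (forall q, U q -> exists r, (0 < r)%R /\
        forall q', on_sphere q' -> (d3 q q' < r)%R -> U q') /\
    (forall q, U q -> in_disk (h q)) /\
    (forall z, in_disk z -> U (k z)) /\
    (forall q, U q -> k (h q) = q) /\
    (forall z, in_disk z -> h (k z) = z) /\
    cont32 U h /\ cont23 in_disk k /\
    h p = (0%R, 0%R) /\
    (forall q, U q -> (on_arc g1 q <-> snd (h q) = 0%R)) /\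
    (forall q, U q -> (on_arc g2 q <-> fst (h q) = 0%R)).

(* A simple graph on the vertex set 'I_n is a symmetric irreflexive
   relation e; each edge {u,v} is represented by the ordered pair (u,v)
   with u < v. *)
Definition is_edge (n : nat) (e : rel 'I_n) (x : 'I_n * 'I_n) : bool :=
  (x.1 < x.2)%N && e x.1 x.2.

Definition num_edges (n : nat) (e : rel 'I_n) : nat :=
  #|[set x : 'I_n * 'I_n | is_edge e x]|.

Definition crosses (g1 g2 : R -> pt3) : Prop :=
  exists t s, (0 < t < 1)%R /\ (0 < s < 1)%R /\ g1 t = g2 s.

Definition is_drawing (n : nat) (e : rel 'I_n)
    (pos : 'I_n -> pt3) (arc : 'I_n * 'I_n -> R -> pt3) : Prop :=
  (forall u, on_sphere (pos u)) /\
  injective pos /\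
  (forall x, is_edge e x ->
     is_arc (arc x) /\ arc x 0%R = pos x.1 /\ arc x 1%R = pos x.2) /\
  (forall x w t, is_edge e x -> (0 < t < 1)%R -> arc x t <> pos w) /\
  (forall x y, is_edge e x -> is_edge e y -> x <> y ->
     exists l : list pt3, forall t s, (0 <= t <= 1)%R -> (0 <= s <= 1)%R ->
       arc x t = arc y s -> List.In (arc x t) l) /\
  (forall x y t s, is_edge e x -> is_edge e y -> x <> y ->
     (0 < t < 1)%R -> (0 < s < 1)%R -> arc x t = arc y s ->
     proper_crossing (arc x) (arc y) (arc x t)) /\
  (forall x y z t s r, is_edge e x -> is_edge e y -> is_edge e z ->
     x <> y -> y <> z -> x <> z ->
     (0 < t < 1)%R -> (0 < s < 1)%R -> (0 < r < 1)%R ->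
     arc x t = arc y s -> arc y s = arc z r -> False).

Definition simple_drawing (n : nat) (e : rel 'I_n)
    (arc : 'I_n * 'I_n -> R -> pt3) : Prop :=
  forall x y t1 s1 t2 s2, is_edge e x -> is_edge e y -> x <> y ->
    (0 <= t1 <= 1)%R -> (0 <= s1 <= 1)%R ->
    (0 <= t2 <= 1)%R -> (0 <= s2 <= 1)%R ->
    arc x t1 = arc y s1 -> arc x t2 = arc y s2 -> arc x t1 = arc x t2.

Definition quasiplanar_drawing (n : nat) (e : rel 'I_n)
    (arc : 'I_n * 'I_n -> R -> pt3) : Prop :=
  forall x y z, is_edge e x -> is_edge e y -> is_edge e z ->
    x <> y -> y <> z -> x <> z ->
    crosses (arc x) (arc y) -> crosses (arc y) (arc z) ->
    crosses (arc x) (arc z) -> False.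

Definition simple_quasiplanar (n : nat) (e : rel 'I_n) : Prop :=
  exists pos arc, is_drawing e pos arc /\ simple_drawing e arc /\
    quasiplanar_drawing e arc.

(* Main.v *)
(* The argument of Ackerman and Tardos. Cut the edges of a drawing at their
   crossings and let al exchange the two darts of a segment and si turn around a
   node; the faces are the cycles of al * si. That the pair (al, si) satisfies
   Euler's inequality is obtained without the Jordan curve theorem: this holds
   for a fine grid on the sphere, and it is preserved when grid darts are deleted
   and connected pieces are contracted, which amounts to multiplying by
   transpositions. In the resulting map two edges may touch instead of cross;
   regluing their four darts at such a node removes it.

   Give a face f with |f| sides and v(f) vertices of the graph the charge
   |f| + v(f) - 4; the total is at most 4n - 8. Quasiplanarity excludes triangles
   of crossings, so only triangles with one vertex fall short of v(f)/5, and they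
   are compensated through chains of quadrilaterals of crossings. So each face
   keeps v(f)/5, and moreover each vertex of degree at least 3 collects 7/5 from
   the faces around it. As the v(f) add up to twice the
   number E of edges, 4n - 8 >= 2E/5 + 7n/5, that is E <= 6.5n - 20. Vertices of
   degree at most 2 are removed by induction. *)
Require Import Defs.
From mathcomp Require Import all_boot.
From Stdlib Require Import Reals.
From mathcomp Require Import all_fingroup zify.
From Stdlib Require Import Lra ClassicalEpsilon.

Set Implicit Arguments.
Unset Strict Implicit.
Unset Printing Implicit Defensive.

(** * Planar pairs of permutations *)

(** Genus enters only as an inequality between numbers of cycles, and each operation on a map keeps
    it because the changes of the two sides can be compared. Hence planarity is verified by an
    actual count only once, for a grid whose faces can be listed. Of the drawing itself only
    incidences pass to the grid: disjoint arcs have positive distance, so on a fine grid their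
    traces are connected sets that meet exactly when the arcs do. Contracting the traces determines
    which darts share a node, but not their cyclic order there; this is why touchings can appear.
    The discharging is done in integers, in units of 1/30: 120 stands for 4, 6 for 1/5, 42 for 7/5.
    The obstacle is to find 42 at each vertex. A vertex that falls short is surrounded almost
    entirely by triangles with no other vertex. The outer sides of consecutive such triangles lie on
    one edge, traversed in one direction. Comparing the edges seen at the two ends of such a run
    then gives parallel edges, adjacent edges that cross, three pairwise crossing edges, or a
    contradictory order of crossings along one edge. *)

Section Classes.
Variable D : finType.
Implicit Types (e : rel D).

Definition comp e x := [set y | connect e x y].
Definition comps e := [set comp e x | x : D].

Lemma eq_comp e x y : connect_sym e -> (comp e x == comp e y) = connect e x y.
Proof.
move=> se; apply/eqP/idP => [/setP/(_ y)|exy].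
  by rewrite !inE connect0.
by apply/setP => z; rewrite !inE (same_connect se exy).
Qed.

Lemma card_comps_link e e' x y :
  connect_sym e -> connect_sym e' ->
  (forall z w, connect e z w -> [\/ connect e' z w,
     connect e' z x /\ connect e' y w | connect e' z y /\ connect e' x w]) ->
  (forall z w, connect e' z w -> connect e z w) ->
  #|comps e'| <= #|comps e| + ~~ connect e' x y.
Proof.
move=> se se' ee' e'e.
have [exy|nxy] /= := boolP (connect e' x y).
  rewrite addn0.
  have E z w : connect e z w = connect e' z w.
    apply/idP/idP => [/ee' [//|[zx yw]|[zy xw]]|]; last exact: e'e.
      exact: connect_trans zx (connect_trans exy yw).
    by rewrite se' in exy; apply: connect_trans zy (connect_trans exy xw).
  suff -> : comps e' = comps e by [].
  by apply: eq_imset => z; apply/setP => w; rewrite !inE E.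
rewrite (cardsD1 (comp e' y)) addnC leq_add ?leq_b1 //.
pose h (C : {set D}) := \bigcup_(z in C) comp e z.
have hE z : h (comp e' z) = comp e z.
  apply/setP => w; apply/bigcupP/idP => [[u]|]; rewrite ?inE.
    by move=> /e'e zu; apply: connect_trans.
  by move=> zw; exists z; rewrite !inE ?connect0.
rewrite -(card_in_imset (f := h)).
  apply/subset_leq_card/subsetP => _ /imsetP[C + ->].
  by rewrite !inE => /andP[_ /imsetP[z _ ->]]; rewrite hE imset_f.
move=> C1 C2 /setD1P[zy /imsetP[z _ E1]] /setD1P[wy /imsetP[w _ E2]].
rewrite {}E1 {}E2 in zy wy *.
rewrite !hE => /eqP; rewrite eq_comp // => /ee' zw; apply/eqP; rewrite eq_comp //.
rewrite !eq_comp // in zy wy.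
case: zw => [//|[_ yw]|[zy' _]]; first by rewrite se' yw in wy.
by rewrite zy' in zy.
Qed.
End Classes.

Section Planar.
Variable D : finType.
Implicit Types (s t : {perm D}) (d x y : D).

Definition link s t : rel D :=
  [rel x y | [|| y == s x, x == s y, y == t x | x == t y]].

Lemma link_sym s t : connect_sym (link s t).
Proof.
apply: sym_connect_sym => x y; rewrite /link /= orbCA.
by congr [|| _, _ | _]; rewrite orbC.
Qed.

Lemma linkl s t x : connect (link s t) x (s x).
Proof. by apply: connect1; rewrite /link /= eqxx. Qed.

Lemma linkr s t x : connect (link s t) x (t x).
Proof. by apply: connect1; rewrite /link /= eqxx !orbT. Qed.

Lemma connect_link_sub s t (r : D -> D -> Prop) :
  (forall x y z, r x y -> r y z -> r x z) -> (forall x, r x x) ->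
  (forall x y, r x y -> r y x) ->
  (forall x, r x (s x)) -> (forall x, r x (t x)) ->
  forall x y, connect (link s t) x y -> r x y.
Proof.
move=> tr rr rs rsx rtx x y /connectP[p + ->] {y}.
elim: p x => [|z p IH] x //= /andP[xz zp].
apply: tr (IH _ zp).
by move: xz; rewrite /link /= => /or4P[] /eqP->; [|apply: rs| |apply: rs].
Qed.

Lemma connect_link_porbit s t x y : y \in porbit s x -> connect (link s t) x y.
Proof.
move=> /porbitP[i ->]; elim: i => [|i IH]; first by rewrite perm1.
by rewrite expgSr permM (connect_trans IH) ?linkl.
Qed.

Definition ncyc s := #|porbits s|.
Definition ncc s t := #|comps (link s t)|.

Lemma ncycV s : ncyc s^-1%g = ncyc s.
Proof. by rewrite /ncyc porbitsV. Qed.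

Lemma ncyc_tperm s x y :
  ncyc (tperm x y * s)%g + (x \notin porbit s y).*2 = ncyc s + (x != y).
Proof. exact: porbits_mul_tperm. Qed.

(* The Euler characteristic inequality V + E + F >= 2 C + |D| for the hypermap
   whose vertices, edges and faces are the cycles of s, t and s * t; fixed
   points of both permutations contribute nothing. *)
Definition planar s t :=
  2 * ncc s t + #|D| <= ncyc s + ncyc t + ncyc (s * t)%g.

Lemma card_comps_eq s t s' t' : connect (link s t) =2 connect (link s' t') ->
  ncc s t = ncc s' t'.
Proof.
move=> E; congr #|pred_of_set _|; apply: eq_imset => x.
by apply/setP => y; rewrite !inE E.
Qed.

Lemma connect_linkE s t s' t' :
  (forall x, connect (link s' t') x (s x)) -> (forall x, connect (link s' t') x (t x)) ->
  (forall x, connect (link s t) x (s' x)) -> (forall x, connect (link s t) x (t' x)) ->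
  connect (link s t) =2 connect (link s' t').
Proof.
move=> h1 h2 h3 h4 x y; apply/idP/idP;
  [apply: (connect_link_sub (r := connect (link s' t'))) => //
  |apply: (connect_link_sub (r := connect (link s t))) => //];
  do ?[by move=> ? ? ?; apply: connect_trans | by move=> ? ?; rewrite link_sym].
Qed.

Lemma planarV s t : planar s t -> planar t^-1%g s^-1%g.
Proof.
rewrite /planar -invMg !ncycV.
suff -> : ncc t^-1%g s^-1%g = ncc s t by rewrite (addnC (ncyc t)).
apply: card_comps_eq; apply: connect_linkE => x.
- by rewrite link_sym -{2}[x](permKV t) linkr.
- by rewrite link_sym -{2}[x](permKV s) linkl.
- by rewrite link_sym -{2}[x](permK s) linkr.
- by rewrite link_sym -{2}[x](permK t) linkl.
Qed.

(** Vertices, edges and faces are the cycles of three permutations with product 1, any two of which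
    generate the same group; so they may be rotated. *)
Lemma planar_rot s t : planar s t -> planar t (s * t)^-1%g.
Proof.
rewrite /planar ncycV.
have -> : ncyc (t * (s * t)^-1)%g = ncyc s.
  by rewrite invMg mulgA mulgV mul1g ncycV.
suff -> : ncc t (s * t)^-1%g = ncc s t by rewrite [_ + ncyc s]addnC addnA.
have tt x : connect (link s t) x (t^-1%g x) by rewrite link_sym -{2}[x](permKV t) linkr.
have ss x : connect (link s t) x (s^-1%g x) by rewrite link_sym -{2}[x](permKV s) linkl.
apply: card_comps_eq; apply: connect_linkE => x.
- exact: linkr.
- by rewrite invMg permM (connect_trans (tt _)) ?ss.
- have a y : connect (link t (s * t)^-1%g) (t^-1%g y) y by rewrite -{2}[y](permKV t) linkl.
  have b y : connect (link t (s * t)^-1%g) y ((s * t)%g y).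
    by rewrite link_sym -{2}[y](permK (s * t)%g) linkr.
  by rewrite -{2}[s](mulgK t) permM link_sym (connect_trans (a _)) // link_sym.
- exact: linkl.
Qed.

(** Splitting a cycle of [s] adds 1 on the right. If [x] and [y] share a cycle of [s * t], that
    cycle splits too, and the gain of 2 pays for one new component. Otherwise two cycles of [s * t]
    merge, the right side is unchanged, and the merged cycle still links [x] to [y], so that no
    component is created. *)
Lemma planar_tperm_l s t x y :
  planar s t -> x \in porbit s y -> planar (tperm x y * s)%g t.
Proof.
have [->|nxy] := eqVneq x y; first by rewrite tperm1 mul1g.
rewrite /planar -mulgA => pst sxy.
have := ncyc_tperm s x y; have := ncyc_tperm (s * t)%g x y.
rewrite sxy nxy /=; set T := tperm x y.
have C0 : connect_sym (link s t) by exact: link_sym.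
have xyC : connect (link s t) x y by rewrite C0 connect_link_porbit.
have TC z : connect (link s t) z (T z).
  by rewrite /T; case: tpermP => [->|->|_ _]; rewrite ?connect0 // link_sym.
have sub z w : connect (link (T * s)%g t) z w -> connect (link s t) z w.
  apply: (connect_link_sub (r := connect (link s t))) => //=; do ?[by move=> ? ? ?; apply: connect_trans
    | by move=> ? ?; rewrite link_sym] => u; last exact: linkr.
  by rewrite permM (connect_trans (TC u)) ?linkl.
(* [R] is the new connectivity with the classes of [x] and [y] joined; it contains the old one, as
   [card_comps_link] requires. *)
set R := fun z w : D => connect (link (T * s)%g t) z w || 
   ((connect (link (T * s)%g t) z x || connect (link (T * s)%g t) z y)
   && (connect (link (T * s)%g t) w x || connect (link (T * s)%g t) w y)).
have supR z w : connect (link s t) z w -> R z w.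
  have S := link_sym (T * s)%g t; have tr := @connect_trans _ (link (T * s)%g t).
  have tr2 a b c : connect (link (T * s)%g t) a b -> 
     connect (link (T * s)%g t) a c = connect (link (T * s)%g t) b c.
    by move=> /(same_connect S) ->.
  apply: (connect_link_sub (r := R)) => {z w} [a b c|a|a b|a|a]; rewrite /R.
  - case/orP=> [ab|/andP[aa bb]]; first by rewrite !(tr2 _ _ _ ab).
    case/orP=> [bc|/andP[_ cc]]; last by rewrite aa cc orbT.
    by rewrite aa -!(tr2 _ _ _ bc) bb orbT.
  - by rewrite connect0.
  - by rewrite S andbC.
  - have e : connect (link (T * s)%g t) (T a) (s a).
      by have := linkl (T * s)%g t (T a); rewrite permM tpermK.
    move: e; rewrite /T; case: tpermP => [->|->|_ _] e; last by rewrite e.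
      by rewrite connect0 [connect _ (s x) y]S e !orbT.
    by rewrite connect0 [connect _ (s y) x]S e !orbT.
  - by rewrite linkr.
have /= := card_comps_link (x := x) (y := y) C0 (link_sym (T * s)%g t) _ sub.
set P := (X in (X -> _) -> _); have p : P.
  move=> z w /supR; rewrite /R ![connect _ w _]link_sym.
  have tr := @connect_trans _ (link (T * s)%g t).
  case/orP=> [|/andP[/orP[a|a] /orP[b|b]]]; first by constructor 1.
  - by constructor 1; apply: tr a b.
  - by constructor 2.
  - by constructor 3.
  - by constructor 1; apply: tr a b.
move=> /(_ p) {p P}.
(* Multiplying by [T] twice gives back [s * t], so [T] cannot separate [x] from [y] both times: they
   share a cycle of [T * (s * t)]. *)
have nC : x \notin porbit (s * t)%g y -> connect (link (T * s)%g t) x y.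
  move=> nst; have st' := ncyc_tperm (T * (s * t))%g x y.
  have st := ncyc_tperm (s * t)%g x y.
  have : x \in porbit (T * (s * t))%g y.
    rewrite -[_ \in _]negbK; apply/negP => n'.
    move: st' st; rewrite mulgA tperm2 mul1g n' nst nxy -/T; lia.
  rewrite mulgA => /porbitP[i ->]; rewrite link_sym.
  elim: i => [|i IH]; first by rewrite perm1.
  by rewrite expgSr permM (connect_trans IH) // permM (connect_trans (linkl _ t _)) ?linkr.
move: pst; rewrite -/T -/(ncc s t) -/(ncc (T * s)%g t).
move: nC; case: (x \in porbit (s * t)%g y) => [_|/(_ isT) ->] /=;
  [case: (connect (link (T * s)%g t) x y) => /=|]; 
  move: (ncyc s) (ncyc t) (ncyc (s * t)%g) (ncyc (T * s)%g) (ncyc (T * (s * t))%g)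
    (ncc s t) (ncc (T * s)%g t); clear; lia.
Qed.

Lemma planar_tperm_r s t x y :
  planar s t -> x \in porbit t y -> planar s (t * tperm x y)%g.
Proof.
move=> /planarV p tx; rewrite -[s]invgK -[(t * _)%g]invgK; apply: planarV.
by rewrite invMg tpermV; apply: planar_tperm_l => //; rewrite porbitV.
Qed.

(** The product does not change. In the rotated pair [((s * t)^-1, s)] this merely splits a cycle of
    the right factor. *)
Lemma planar_shift_l s t x y :
  planar s t -> x \in porbit s y -> planar (s * tperm x y)%g (tperm x y * t)%g.
Proof.
move=> p sx; have := planar_tperm_r (planar_rot (planar_rot p)).
have -> : (t * (s * t)^-1)^-1%g = s by rewrite invMg invgK mulgK.
move=> /(_ _ _ sx)/planar_rot.
suff -> : ((s * t)^-1 * (s * tperm x y))^-1%g = (tperm x y * t)%g by [].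
by rewrite invMg invgK invMg tpermV -mulgA mulKg.
Qed.

Lemma planar_shift_r s t x y :
  planar s t -> x \in porbit t y -> planar (s * tperm x y)%g (tperm x y * t)%g.
Proof.
move=> /planarV p tx.
have := @planar_shift_l _ _ x y p; rewrite porbitV => /(_ tx) /planarV.
by rewrite !invMg !invgK tpermV.
Qed.

(** Removal of a dart without changing the type: [d] becomes a fixed point and its predecessor is
    sent to the old image of [d]. *)
Definition skip d s := (s * tperm d (s d))%g.

Lemma skipE d s x : skip d s x = if x == d then d else if s x == d then s d else s x.
Proof.
rewrite permM; case: eqVneq => [->|xd]; first by rewrite tpermR.
case: eqVneq => [->|sxd]; first by rewrite tpermL.
by rewrite tpermD // eq_sym // (inj_eq perm_inj).
Qed.

Lemma planar_skip_r d s t : planar s t -> planar s (skip d t).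
Proof. by move=> p; apply: planar_tperm_r => //; rewrite porbit_sym -[t d]/(aperm d t) (mem_porbit _ 1). Qed.

Lemma planar_skip_l d s t : planar s t -> planar (skip d s) t.
Proof.
move=> p; have -> : skip d s = (tperm (s^-1%g d) d * s)%g.
  apply/permP => x; rewrite skipE permM; case: tpermP => [->|->|/eqP xd /eqP dx].
  - by rewrite permKV eqxx; case: eqP => // E; rewrite -{2}E permKV.
  - by rewrite permKV eqxx.
  by rewrite (negPf dx); case: eqP => // sx; rewrite -sx permK eqxx in xd.
by apply: planar_tperm_l => //; rewrite -{2}[d](permKV s) -[s _]/(aperm _ s) porbit_sym (mem_porbit _ 1).
Qed.

Lemma porbit_step s x : s x \in porbit s x.
Proof. exact: (mem_porbit s 1). Qed.

Lemma porbit_trans s : transitive (fun x y => y \in porbit s x).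
Proof. by move=> y x z; rewrite -!eq_porbit_mem => /eqP-> /eqP->. Qed.

Lemma porbit_sub s (r : rel D) : (forall x, r x x) ->
  (forall x y z, r x y -> r y z -> r x z) -> (forall x, r x (s x)) ->
  forall x y, y \in porbit s x -> r x y.
Proof.
move=> r0 tr rs x _ /porbitP[i ->]; elim: i => [|i IH]; first by rewrite perm1.
by rewrite expgSr permM; apply: tr IH (rs _).
Qed.

Lemma porbit_skip d s x y : x != d -> y != d ->
  (y \in porbit (skip d s) x) = (y \in porbit s x).
Proof.
move=> xd yd; apply/idP/idP.
  apply: (porbit_sub (r := fun x y => y \in porbit s x)) => {x y xd yd} [x|x y z|x].
  - exact: porbit_id.
  - exact: porbit_trans.
  rewrite skipE; case: eqP => [->|_]; first exact: porbit_id.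
  case: eqP => [sx|_]; last exact: porbit_step.
  by apply: (@porbit_trans _ (s x)); [exact: porbit_step|rewrite sx porbit_step].
pose p z := if z == d then s d else z.
suff : y \in porbit s x -> p y \in porbit (skip d s) (p x).
  by rewrite /p (negPf xd) (negPf yd).
apply: (porbit_sub (r := fun x y => p y \in porbit (skip d s) (p x))).
- by move=> ?; exact: porbit_id.
- by move=> ? ? ?; exact: porbit_trans.
move=> z; rewrite /p; case: (eqVneq z d) => [->|zd].
  by case: (s d == d); exact: porbit_id.
have := porbit_step (skip d s) z; rewrite skipE (negPf zd).
by case: (s z == d).
Qed.

Lemma porbit_fix s x y : s x = x -> (y \in porbit s x) = (y == x).
Proof.
move=> sx; apply/porbitP/eqP => [[i ->]|->]; last by exists 0; rewrite perm1.
by elim: i => [|i IH]; rewrite ?perm1 // expgSr permM IH.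
Qed.

Lemma porbit_merge s d d' x y : d' \notin porbit s d ->
  (y \in porbit (tperm d d' * s)%g x) =
  (y \in porbit s x) || ((x \in porbit s d) || (x \in porbit s d')) &&
     ((y \in porbit s d) || (y \in porbit s d')).
Proof.
move=> nd; set T := tperm d d'.
have ndd : d != d' by apply: contraNneq nd => ->; exact: porbit_id.
have dd : d' \in porbit (T * s)%g d.
  rewrite -[_ \in _]negbK; apply/negP => n'.
  have := ncyc_tperm s d d'; have := ncyc_tperm (T * s)%g d d'.
  rewrite mulgA tperm2 mul1g -/T ![d \in _]porbit_sym n' nd ndd /=; lia.
have ss z : s z \in porbit (T * s)%g z.
  have : s z \in porbit (T * s)%g (T z) by rewrite -{1}[z](tpermK d d') -permM porbit_step.
  apply: porbit_trans; rewrite /T; case: tpermP => [->|->|_ _] //.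
    by rewrite porbit_sym.
  exact: porbit_id.
have sT a b : b \in porbit s a -> b \in porbit (T * s)%g a.
  apply: (porbit_sub (r := fun x y => y \in porbit (T * s)%g x)) => // [?|? ? ?]; [exact: porbit_id|exact: porbit_trans].
apply/idP/idP.
  have S a b : (a \in porbit s b) = (b \in porbit s a) by exact: porbit_sym.
  apply: (porbit_sub (r := fun x y => (y \in porbit s x) || ((x \in porbit s d) || (x \in porbit s d')) &&
     ((y \in porbit s d) || (y \in porbit s d')))) => {x y} [x|x y z|x].
  - by rewrite porbit_id.
  - have tr a b c : b \in porbit s a -> c \in porbit s b -> c \in porbit s a by exact: porbit_trans.
    case/orP=> [xy|/andP[-> yy]].
      have yx := xy; rewrite S in yx.
      case/orP=> [yz|/andP[/orP[]yy ->]]; first by rewrite (tr _ _ _ xy yz).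
        by rewrite (tr _ _ _ yy yx) !orbT.
      by rewrite (tr _ _ _ yy yx) !orbT.
    case/orP=> [yz|/andP[_ ->]]; last by rewrite orbT.
    by case/orP: yy => yy; rewrite (tr _ _ _ yy yz) !orbT.
  - rewrite permM /T; case: tpermP => [->|->|_ _]; rewrite ?porbit_step ?porbit_id ?orbT //.
case/orP=> [|/andP[xx yy]]; first exact: sT.
have tr := @porbit_trans (T * s)%g.
have xd : x \in porbit (T * s)%g d by case/orP: xx => [|xx]; [exact: sT|apply: tr dd (sT _ _ xx)].
have yd : y \in porbit (T * s)%g d by case/orP: yy => [|yy]; [exact: sT|apply: tr dd (sT _ _ yy)].
by apply: tr yd; rewrite porbit_sym.
Qed.
End Planar.

(** * Deletion and contraction of edges *)

Section Minor.
Variable D : finType.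
Variables alpha sigma : {perm D}.
Hypothesis alphaK : forall d, alpha (alpha d) = d.
Hypothesis alpha_neq : forall d, alpha d != d.
Implicit Types (A B K : {set D}) (d x y : D).

(** The classes of this relation are the nodes obtained when the edges of [B] are contracted. *)
Definition contr B : rel D :=
  [rel x y | [|| y == sigma x, x == sigma y | (x \in B) && (y == alpha x)]].

Definition closed_set B := forall d, (alpha d \in B) = (d \in B).

Lemma alpha_eq z d : (alpha z == d) = (z == alpha d).
Proof. by rewrite -{1}[d]alphaK (inj_eq (@perm_inj _ alpha)). Qed.

Lemma closed_set_add A d : closed_set A -> closed_set (d |: (alpha d |: A)).
Proof. by move=> cA z; rewrite !inE cA !alpha_eq alphaK orbCA. Qed.

Lemma contr_sym B : closed_set B -> connect_sym (contr B).
Proof.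
move=> cB; apply: sym_connect_sym => x y; rewrite /contr /= orbCA.
congr [|| _, _ | _]; apply/andP/andP => -[xB /eqP E].
  by rewrite E cB xB alphaK.
by rewrite E cB xB alphaK.
Qed.

Lemma connect_contr0 x y : connect (contr set0) x y = (y \in porbit sigma x).
Proof.
apply/idP/idP => [/connectP[p + ->] {y}|].
  elim: p x => [|z p IH] x /=; first by rewrite porbit_id.
  rewrite /contr /= in_set0 /= orbF => /andP[xz /IH]; apply: porbit_trans.
  by case/orP: xz => /eqP->; [exact: porbit_step|rewrite porbit_sym porbit_step].
apply: porbit_sub => [z|u v w|z]; [exact: connect0|exact: connect_trans|].
by apply: connect1; rewrite /contr /= eqxx.
Qed.

Lemma connect_contr_add B d x y : closed_set B ->
  connect (contr (d |: (alpha d |: B))) x y =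
  connect (contr B) x y || (connect (contr B) d x || connect (contr B) (alpha d) x) &&
    (connect (contr B) d y || connect (contr B) (alpha d) y).
Proof.
move=> cB; set B' := _ |: _.
have cB' : closed_set B' by exact: closed_set_add.
have S := contr_sym cB; 
have sub u v : connect (contr B) u v -> connect (contr B') u v.
  apply: connect_sub => {}u {}v; rewrite /contr /= => h; apply: connect1; rewrite /contr /=.
  case/or3P: h => [->|->|/andP[uB ->]]; rewrite /= ?orbT //.
  by rewrite !inE uB !orbT.
have dd : connect (contr B') d (alpha d).
  by apply: connect1; rewrite /contr /= !inE !eqxx !orbT.
apply/idP/idP; last first.
  have tr' := @connect_trans _ (contr B').
  have dx u : connect (contr B) d u || connect (contr B) (alpha d) u -> connect (contr B') d u.
    by case/orP=> /sub //; apply: tr'.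
  case/orP=> [/sub //|/andP[/dx xx /dx yy]].
  by apply: tr' yy; rewrite (contr_sym cB').
move=> /connectP[p + ->] {y}.
elim: p x => [|z p IH] x /=; first by rewrite connect0.
move=> /andP[xz /IH {IH}]; set y := last z p.
have [xBz|nxBz] := boolP (contr B x z).
  have xz' := connect1 xBz.
  rewrite -!(same_connect S xz') => /orP[-> //|/andP[h ->]].
  by rewrite ![connect _ _ x]S !(same_connect S xz') -![connect _ z _]S h orbT.
have dxz : (x == d) && (z == alpha d) || (x == alpha d) && (z == d).
  move: xz nxBz; rewrite /contr /= !inE.
  case: (z == sigma x) => //=; case: (x == sigma z) => //=.
  case: (x \in B); rewrite ?orbT ?orbF /=; first by case: (z == alpha x).
  by move=> /andP[/orP[] /eqP-> /eqP->] _; rewrite ?alphaK !eqxx ?orbT.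
case/orP: dxz => /andP[/eqP-> /eqP->]; rewrite !connect0 ?orbT /=;
  by case: (connect (contr B) d y); case: (connect (contr B) (alpha d) y); rewrite ?orbT.
Qed.

(** The edges outside [K] are removed one at a time, those of [B] by contraction and the others by
    deletion. An edge of [B] whose two darts already lie at one node has become a loop and is simply
    deleted, since the same transposition would split the node. *)
Lemma planar_minor B K :
  planar alpha sigma -> closed_set B -> closed_set K -> [disjoint B & K] ->
  exists alpha' sigma' : {perm D},
  [/\ planar alpha' sigma',
      {in K, alpha' =1 alpha},
      forall d, d \notin K -> alpha' d = d /\ sigma' d = d &
      {in K &, forall d d', (d' \in porbit sigma' d) = connect (contr B) d d'}].
Proof.
move=> pl cB cK dBK.
(* The induction enlarges [K], which destroys disjointness; with [B :\: K] in its place the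
   statement makes sense for every closed [K]. *)
have -> : B = B :\: K by apply/setP => x; rewrite inE; case: (boolP (x \in K)) => // /(disjointFl dBK)->.
move E : #|~: K| => n; elim/ltn_ind: n K cK E {dBK} => n IH A cA cardA.
have [|/subsetPn[d _ dA]] := boolP (setT \subset A).
  rewrite subTset => /eqP->; exists alpha, sigma; split=> // [x|x y _ _].
    by rewrite inE.
  by rewrite setDT connect_contr0.
have {}IH : exists alpha' sigma' : {perm D},
  [/\ planar alpha' sigma',
      {in d |: (alpha d |: A), alpha' =1 alpha},
      forall u, u \notin d |: (alpha d |: A) -> alpha' u = u /\ sigma' u = u &
      {in d |: (alpha d |: A) &, forall u u', (u' \in porbit sigma' u)
         = connect (contr (B :\: (d |: (alpha d |: A)))) u u'}].
  apply: IH (erefl _).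
    rewrite -cardA; apply/proper_card/properP; split.
      by apply/subsetP => x; rewrite !inE !negb_or => /and3P[].
    by exists d; rewrite !inE ?eqxx.
  exact: closed_set_add.
have [a1 [s1 [p1 a1A a1N s1C]]] := IH.
set A1 := d |: _ in s1C a1N a1A.
have dA1 : d \in A1 by rewrite !inE eqxx.
have adA1 : alpha d \in A1 by rewrite !inE eqxx orbT.
have adA : alpha d \notin A by rewrite cA.
have AA1 x : x \in A -> x \in A1 by rewrite !inE => ->; rewrite !orbT.
have a1d : a1 d = alpha d by rewrite a1A.
have a1ad : a1 (alpha d) = d by rewrite a1A ?alphaK.
have nA x : x \in A -> (x != d) && (x != alpha d).
  by move=> xA; apply/andP; split; [apply: contraNneq dA|apply: contraNneq adA] => <-.
have cB1 : closed_set (B :\: A1).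
  by move=> z; rewrite !inE cA cB !alpha_eq alphaK orbCA.
pose a2 := skip d a1.
(* Contraction moves the transposition of [d] and [alpha d] from the edge permutation to the node
   permutation: it splits the edge into fixed points and merges the two nodes. *)
pose s0 := if (d \in B) && (alpha d \notin porbit s1 d) then (tperm d (alpha d) * s1)%g else s1.
pose s2 := skip (alpha d) (skip d s0).
exists a2, s2; split.
- apply: planar_skip_r; apply: planar_skip_r; rewrite /s0 /a2.
  case: ifP => _; last exact: planar_skip_l.
  rewrite /skip a1d; apply: planar_shift_l => //.
  by rewrite -{1}a1ad porbit_step.
- move=> x xA; have /andP[xd xad] := nA x xA.
  rewrite skipE (negPf xd) a1A ?AA1 //.
  by rewrite alpha_eq (negPf xad).
- move=> x xA; rewrite /a2 /s2 !skipE.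
  have [->|xd] := eqVneq x d.
    by rewrite ![d == alpha d]eq_sym (negPf (alpha_neq d)) /=. 
  have [->|xad] := eqVneq x (alpha d).
    by rewrite a1ad eqxx a1d.
  have xA1 : x \notin A1 by rewrite !inE (negPf xd) (negPf xad).
  have [-> s1x] := a1N _ xA1; rewrite (negPf xd); split=> //.
  have -> : s0 x = x.
    rewrite /s0; case: ifP => // _; rewrite permM tpermD ?s1x // eq_sym //.
  by rewrite (negPf xd) (negPf xad).
move=> x y xA yA.
have /andP[xd xad] := nA x xA; have /andP[yd yad] := nA y yA.
rewrite !porbit_skip // /s0.
have [dB|dB] /= := boolP (d \in B); last first.
  have -> : B :\: A = B :\: A1.
    apply/setP => z; rewrite !inE; case: eqVneq => [->|_]; first by rewrite (negPf dB) !andbF.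
    by case: eqVneq => [->|_] //; rewrite cB (negPf dB) !andbF.
  by rewrite s1C ?AA1.
have -> : B :\: A = d |: (alpha d |: (B :\: A1)).
  apply/setP => z; rewrite !inE.
  case: eqVneq => [->|_] /=; first by rewrite dA dB.
  by case: eqVneq => [->|_] //=; rewrite cA dA cB dB.
rewrite connect_contr_add // -!s1C ?dA1 ?adA1 ?AA1 //.
have [|nd] := boolP (alpha d \in porbit s1 d); last by rewrite porbit_merge.
rewrite -eq_porbit_mem => /eqP ->.
rewrite !orbb; apply/esym/orb_idr => /andP[xd' yd'].
by apply: porbit_trans yd'; rewrite porbit_sym.
Qed.
End Minor.

(** Planarity needs only lower bounds on numbers of cycles, so representatives told apart by a label
    that [s] preserves are enough. *)
Lemma ncyc_lower (D : finType) (X L : finType) (s : {perm D}) (lab : D -> L) (F : X -> D) :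
  (forall d, lab (s d) = lab d) -> injective (lab \o F) -> #|X| <= ncyc s.
Proof.
move=> ls inj.
have lp x y : y \in porbit s x -> lab y = lab x.
  move=> /porbitP[i ->]; elim: i => [|i IH]; first by rewrite perm1.
  by rewrite expgSr permM ls.
rewrite /ncyc -cardsT -(card_imset _ (f := fun x => porbit s (F x))).
  by apply/subset_leq_card/subsetP => _ /imsetP[x _ ->]; apply: imset_f.
by move=> x y E; apply: inj; apply: lp; rewrite -E porbit_id.
Qed.

Lemma ncyc_invol (D : finType) (s : {perm D}) :
  (forall d, s (s d) = d) -> (forall d, s d != d) -> (ncyc s).*2 = #|D|.
Proof.
move=> sK sN.
have pE d : porbit s d = [set d; s d].
  apply/eqP; rewrite eqEsubset; apply/andP; split; last first.
    by apply/subsetP => x; rewrite !inE => /orP[] /eqP->; rewrite ?porbit_id ?porbit_step.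
  apply/subsetP => x; apply: (porbit_sub (r := fun x y => y \in [set x; s x])).
  - by move=> y; rewrite !inE eqxx.
  - move=> u v w; rewrite !inE => /orP[] /eqP-> /orP[] /eqP->; rewrite ?sK ?eqxx ?orbT //.
  - by move=> y; rewrite !inE eqxx orbT.
have pT : partition (porbits s) setT.
  apply/and3P; split.
  - apply/eqP/setP => x; rewrite inE; apply/bigcupP; exists (porbit s x); last exact: porbit_id.
    exact: imset_f.
  - apply/trivIsetP => _ _ /imsetP[x _ ->] /imsetP[y _ ->] nxy.
    rewrite -setI_eq0; apply: contra_neqT nxy => /set0Pn[z]; rewrite inE.
    by rewrite -!eq_porbit_mem => /andP[/eqP<- /eqP<-].
  - apply/imsetP => -[x _ E]; have := porbit_id s x; by rewrite -E inE.
rewrite -cardsT (card_uniform_partition _ pT (n := 2)) ?muln2 // => _ /imsetP[x _ ->].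
by rewrite pE cards2 eq_sym sN.
Qed.

(** * Passing to the darts that are moved *)

Lemma card_imset_ker (T X X' : finType) (Q : T -> X) (Q' : T -> X') :
  (forall x y, (Q x == Q y) = (Q' x == Q' y)) -> #|Q @: T| = #|Q' @: T|.
Proof.
move=> h; pose W := [set (Q x, Q' x) | x : T].
have -> : Q @: T = fst @: W by rewrite -imset_comp; apply: eq_imset.
have -> : Q' @: T = snd @: W by rewrite -imset_comp; apply: eq_imset.
rewrite (card_in_imset (f := fst)) ?(card_in_imset (f := snd)) // => u v /imsetP[x _ ->] /imsetP[y _ ->] /= /eqP E.
  by have := E; rewrite -h => /eqP->; rewrite (eqP E).
by have := E; rewrite h => /eqP->; rewrite (eqP E).
Qed.

Section Restrict.
Variables (D T : finType) (k : T -> D).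
Hypothesis k_inj : injective k.

(** Outside the image of [k] every class is a singleton, so the two numbers of classes differ by the
    number of points outside. *)
Lemma card_restrict (X X' : finType) (P : D -> X) (P' : T -> X') :
  (forall x y, (P (k x) == P (k y)) = (P' x == P' y)) ->
  (forall z w, z \notin codom k -> P z = P w -> z = w) ->
  #|[set P z | z : D]| + #|T| = #|[set P' x | x : T]| + #|D|.
Proof.
move=> h1 h2.
have -> : [set P z | z : D] = [set P (k x) | x : T] :|: [set P z | z in ~: [set k x | x : T]].
  apply/setP => y; rewrite inE; apply/imsetP/orP => [[z _ ->]|[] /imsetP[x xk ->]].
  - have [/imsetP[x _ ->]|zk] := boolP (z \in [set k x | x : T]).
      by left; apply/imsetP; exists x.
    by right; apply/imsetP; exists z; rewrite // inE.
  - by exists (k x).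
  - by exists x.
have nk z : z \in ~: [set k x | x : T] -> z \notin codom k.
  rewrite inE; apply: contraNN => /codomP[x ->]; exact: imset_f.
rewrite cardsU disjoint_setI0 ?cards0 ?subn0; last first.
  rewrite -setI_eq0; apply/eqP/setP => y; rewrite !inE; apply/negbTE/andP => -[].
  move=> /imsetP[x _ ->] /imsetP[z /nk zk /esym/(h2 _ _ zk) E].
  by rewrite E codom_f in zk.
rewrite [#|[set P z | z in _]|]card_in_imset; last first.
  by move=> z w zk _; apply: h2; apply: nk.
have -> : #|[set P (k x) | x : T]| = #|[set P' x | x : T]|.
  exact: card_imset_ker.
have := cardsC [set k x | x : T]; rewrite card_imset //.
by move=> <-; rewrite addnA addnAC.
Qed.

Variables (s t : {perm D}) (s' t' : {perm T}).
Hypothesis s_fix : forall z, z \notin codom k -> s z = z.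
Hypothesis t_fix : forall z, z \notin codom k -> t z = z.
Hypothesis s_k : forall x, s (k x) = k (s' x).
Hypothesis t_k : forall x, t (k x) = k (t' x).

Lemma porbit_restrict (u : {perm D}) (u' : {perm T}) x y :
  (forall x, u (k x) = k (u' x)) -> (k y \in porbit u (k x)) = (y \in porbit u' x).
Proof.
move=> h; have E i : (u ^+ i)%g (k x) = k ((u' ^+ i)%g x).
  by elim: i => [|i IH]; rewrite ?perm1 // !expgSr !permM IH h.
apply/porbitP/porbitP => -[i]; first by rewrite E => /k_inj ->; exists i.
by move=> ->; exists i.
Qed.

Lemma ncyc_restrict (u : {perm D}) (u' : {perm T}) :
  (forall z, z \notin codom k -> u z = z) -> (forall x, u (k x) = k (u' x)) ->
  ncyc u + #|T| = ncyc u' + #|D|.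
Proof.
move=> u0 uk; apply: card_restrict => [x y|z w zk /eqP].
  by rewrite !eq_porbit_mem (porbit_restrict _ _ uk).
by rewrite eq_porbit_mem porbit_sym porbit_fix ?u0 // => /eqP.
Qed.

(** A dart outside the image is fixed by both permutations. It counts 3 on the right, as a cycle of
    each of [s], [t] and [s * t], and 3 on the left, as a component counted twice and as a dart. *)
Lemma planar_restrict : planar s t -> planar s' t'.
Proof.
have Ns := ncyc_restrict s_fix s_k; have Nt := ncyc_restrict t_fix t_k.
have Nst : ncyc (s * t)%g + #|T| = ncyc (s' * t')%g + #|D|.
  apply: ncyc_restrict => [z zk|x]; first by rewrite permM s_fix ?t_fix.
  by rewrite !permM s_k t_k.
have Nc : ncc s t + #|T| = ncc s' t' + #|D|.
  have conn x y : connect (link s' t') x y -> connect (link s t) (k x) (k y).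
    apply: (connect_link_sub (r := fun x y => connect (link s t) (k x) (k y))) => {x y}.
    - by move=> ? ? ?; apply: connect_trans.
    - by [].
    - by move=> ? ?; rewrite link_sym.
    - by move=> x; rewrite -s_k linkl.
    - by move=> x; rewrite -t_k linkr.
  have conn' z w : connect (link s t) z w -> z = w \/
      exists x y, [/\ z = k x, w = k y & connect (link s' t') x y].
    apply: (connect_link_sub (r := fun z w => z = w \/
      exists x y, [/\ z = k x, w = k y & connect (link s' t') x y])) => {z w}.
    - move=> a b c [->//|[x [y [-> -> xy]]]] [<-|[x' [y' [/k_inj<- -> yy]]]].
        by right; exists x, y.
      by right; exists x, y'; split=> //; apply: connect_trans xy yy.
    - by left.
    - move=> a b [->|[x [y [-> -> xy]]]]; first by left.
      by right; exists y, x; rewrite link_sym.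
    - move=> z; have [/codomP[x ->]|zk] := boolP (z \in codom k); last by left; rewrite s_fix.
      by right; exists x, (s' x); rewrite s_k linkl.
    - move=> z; have [/codomP[x ->]|zk] := boolP (z \in codom k); last by left; rewrite t_fix.
      by right; exists x, (t' x); rewrite t_k linkr.
  apply: card_restrict => [x y|z w zk /eqP].
    rewrite !eq_comp; try exact: link_sym.
    apply/idP/idP; last exact: conn.
    by move=> /conn'[/k_inj->//|[x' [y' [/k_inj-> /k_inj->]]]].
  rewrite eq_comp; last exact: link_sym.
  move=> /conn'[//|[x [y [zx _ _]]]].
  by rewrite zx codom_f in zk.
rewrite /planar; move: Ns Nt Nst Nc.
move: (ncyc s) (ncyc t) (ncyc (s * t)%g) (ncc s t) (ncyc s') (ncyc t') (ncyc (s' * t')%g) (ncc s' t').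
clear; lia.
Qed.
End Restrict.

(** * A planar grid on the sphere *)

Notation gvert M := ('I_M.+1 * 'I_M.+1 * bool)%type.
Notation gdart M := (gvert M * (bool * bool))%type.

(* The sphere as a pillow: two (M+1) x (M+1) grids, one for each sheet, whose
   boundary vertices are joined by rungs (a corner carries two parallel rungs).
   A dart is a vertex with a direction (axis, sign); the second sheet is
   oriented the opposite way. *)
Section Grid.
Variable M : nat.

Definition inside (sg : bool) (c : 'I_M.+1) := if sg then c < M else 0 < c.
Definition shift (sg : bool) (c : 'I_M.+1) : 'I_M.+1 :=
  inord (if sg then c.+1 else c.-1).

Lemma shiftE sg c : inside sg c -> shift sg c = (if sg then c.+1 else c.-1) :> nat.
Proof. by rewrite /inside /shift; case: sg => h; rewrite inordK //; move: (ltn_ord c); lia. Qed.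

Lemma shiftK sg c : inside sg c -> shift (~~ sg) (shift sg c) = c.
Proof.
move=> h; apply: val_inj => /=; rewrite shiftE ?shiftE //.
  by move: h; rewrite /inside; case: sg => /=; lia.
by rewrite /inside shiftE //; move: h (ltn_ord c); rewrite /inside; case: sg => /=; lia.
Qed.

Lemma inside_shift sg c : inside sg c -> inside (~~ sg) (shift sg c).
Proof.
move=> h; rewrite /inside shiftE //; move: h (ltn_ord c); rewrite /inside; case: sg => /=; lia.
Qed.

Definition gal (d : gdart M) : gdart M :=
  let: (i, j, s, (ax, sg)) := d in
  if ax then (if inside sg j then (i, shift sg j, s, (ax, ~~ sg)) else (i, j, ~~ s, (ax, sg)))
  else (if inside sg i then (shift sg i, j, s, (ax, ~~ sg)) else (i, j, ~~ s, (ax, sg))).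

Definition gsi (d : gdart M) : gdart M :=
  let: (i, j, s, (ax, sg)) := d in (i, j, s, (~~ ax, sg (+) (ax == s))).

Lemma galK d : gal (gal d) = d.
Proof.
case: d => -[[i j] s] [[] sg] /=; case: ifP => h /=.
- by rewrite inside_shift // shiftK // negbK.
- by rewrite h negbK.
- by rewrite inside_shift // shiftK // negbK.
- by rewrite h negbK.
Qed.

Lemma gal_neq d : gal d != d.
Proof.
by case: d => -[[i j] s] [[] sg] /=; case: ifP => h; rewrite !xpair_eqE;
  case: s; case: sg {h} => //=; rewrite ?andbF.
Qed.

Lemma gsi4 d : gsi (gsi (gsi (gsi d))) = d.
Proof. by case: d => -[[i j] []] [[] []]. Qed.

Lemma gsi_inj : injective gsi.
Proof. by move=> x y /(congr1 (gsi \o gsi \o gsi)) /=; rewrite !gsi4. Qed.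

Definition galp : {perm gdart M} := perm (can_inj galK).
Definition gsip : {perm gdart M} := perm gsi_inj.

Definition gvtx (d : gdart M) : gvert M := d.1.

Lemma gsi_orbit d d' : (d' \in porbit gsip d) = (gvtx d' == gvtx d).
Proof.
apply/idP/eqP => [|].
  move=> /porbitP[k ->]; elim: k => [|k IH]; first by rewrite perm1.
  rewrite expgSr permM -{}IH; move: ((gsip ^+ k)%g d) => -[[[i j] s] [ax sg]].
  by rewrite permE.
have st x : gsi x \in porbit gsip x.
  by rewrite -[gsi x](permE gsi_inj); exact: porbit_step.
have tr x y z : y \in porbit gsip x -> z \in porbit gsip y -> z \in porbit gsip x.
  exact: porbit_trans.
have st2 x : gsi (gsi x) \in porbit gsip x by apply: tr (st _) (st _).
have st3 x : gsi (gsi (gsi x)) \in porbit gsip x by apply: tr (st2 _) (st _).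
case: d d' => v [a b] [v' [a' b']]; rewrite /gvtx /= => ->.
case: v => -[i j] s.
have [->|[->|[->|->]]] : let x := (i, j, s, (a, b)) in let y := (i, j, s, (a', b')) in
   y = x \/ y = gsi x \/ y = gsi (gsi x) \/ y = gsi (gsi (gsi x)); last by [].
- by case: s a b a' b' => [] [] [] [] [] /=; intuition.
- exact: porbit_id.
- exact: st.
- exact: st2.
Qed.

Definition gbound (a b : nat) := [|| a == 0, a == M.+1, b == 0 | b == M.+1].

(** The face beside a dart, as the coordinates of a cell. Cells with a coordinate 0 or [M.+1] lie
    between the two sheets; they are reached from both, and so their last bit is always [true]. *)
Definition glab (d : gdart M) : 'I_M.+2 * 'I_M.+2 * bool :=
  let: (i, j, s, (ax, sg)) := d in
  let a := i + (if s then sg else ax (+) sg) in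
  let b := j + (if s then ax == sg else sg) in
  (inord a, inord b, s || gbound a b).

Lemma glab_eq a a' b b' (e e' : bool) : a = a' -> b = b' -> e = e' ->
  (inord a, inord b, e) = (inord a', inord b', e') :> 'I_M.+2 * 'I_M.+2 * bool.
Proof. by move=> -> -> ->. Qed.

Lemma glab_inv d : glab ((galp * gsip)%g d) = glab d.
Proof.
rewrite permM !permE.
have ltM (i : 'I_M.+1) : i <= M by rewrite -ltnS.
case: d => -[[i j] s] [[] sg] /=; move: (ltM i) (ltM j); case: ifP => h hi hj /=;
 rewrite ?shiftE //; move: h; rewrite /inside;
 case: s; case: sg; rewrite /= ?addn0 ?addn1 ?addbF ?addbT /= /gbound => h;
 apply: glab_eq; lia.
Qed.

(** The number of cells is [(M+2)^2 + M^2 = 2(M+1)^2 + 2], just what Euler's formula asks for. *)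
Definition gcell := ('I_M.+2 * 'I_M.+2 + 'I_M * 'I_M)%type.

Definition gcorner (c : gcell) : gdart M :=
  match c with
  | inl (a, b) => let sg := a == M.+1 :> nat in
      (inord (minn a M), inord (minn b M), true, ((b == M.+1 :> nat) == sg, sg))
  | inr (a, b) => (inord a.+1, inord b.+1, false, (false, false))
  end.

Lemma gcornerE c : glab (gcorner c) =
  match c with inl (a, b) => (a, b, true) | inr (a, b) => (inord a.+1, inord b.+1, false) end.
Proof.
case: c => -[a b] /=.
  have e (c : 'I_M.+2) : (inord (minn c M) : 'I_M.+1) + (c == M.+1 :> nat) = c.
    by rewrite inordK; move: (ltn_ord c); lia.
  have -> (u v : bool) : ((u == v) == v) = u by case: u v => [] [].
  by rewrite !e !inord_val.
move: (ltn_ord a) (ltn_ord b) => la lb; rewrite !addn0 !inordK //; try lia.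
by congr (_, _); rewrite /gbound; lia.
Qed.

Lemma gcorner_inj : injective (glab \o gcorner).
Proof.
move=> x y /=; rewrite !gcornerE.
case: x y => -[a b] [] [a' b'] // [] // => [-> -> //|].
move=> /(congr1 val) /= + /(congr1 val) /=.
rewrite !inordK ?ltnS; try by move: (ltn_ord a) (ltn_ord b) (ltn_ord a') (ltn_ord b'); lia.
by move=> [/val_inj ->] [/val_inj ->].
Qed.

Definition gadj (v w : gvert M) := [exists d, (gvtx d == v) && (gvtx (gal d) == w)].

Lemma gadj_sym v w : gadj v w = gadj w v.
Proof.
by apply/existsP/existsP => -[d /andP[h1 h2]]; exists (gal d); rewrite galK h1 h2.
Qed.

Lemma gadj_i (i i' j : 'I_M.+1) s : i' = i.+1 :> nat -> gadj (i, j, s) (i', j, s).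
Proof.
move=> E; apply/existsP; exists (i, j, s, (false, true)); rewrite /= /gvtx /=.
have h : i < M by rewrite -ltnS -E.
by rewrite h /= eqxx !xpair_eqE !eqxx !andbT; apply/eqP/val_inj; rewrite /= shiftE.
Qed.

Lemma gadj_j (i j j' : 'I_M.+1) s : j' = j.+1 :> nat -> gadj (i, j, s) (i, j', s).
Proof.
move=> E; apply/existsP; exists (i, j, s, (true, true)); rewrite /= /gvtx /=.
have h : j < M by rewrite -ltnS -E.
by rewrite h /= eqxx !xpair_eqE !eqxx !andbT; apply/eqP/val_inj; rewrite /= shiftE.
Qed.

Lemma gadj_s (i j : 'I_M.+1) s : [|| i == 0 :> nat, i == M :> nat, j == 0 :> nat | j == M :> nat] ->
  gadj (i, j, s) (i, j, ~~ s).
Proof.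
move=> h; apply/existsP.
have : [|| ~~ inside false i, ~~ inside true i, ~~ inside false j | ~~ inside true j].
  by rewrite /inside; lia.
case/or4P => h'; [exists (i, j, s, (false, false))|exists (i, j, s, (false, true))
  |exists (i, j, s, (true, false))|exists (i, j, s, (true, true))];
 by rewrite /gal /gvtx (negPf h') /= !eqxx.
Qed.

Lemma grid_connected x y : connect (link galp gsip) x y.
Proof.
have S := link_sym galp gsip.
have tr a b c : connect (link galp gsip) a b -> connect (link galp gsip) b c ->
  connect (link galp gsip) a c by exact: connect_trans.
have vx d d' : gvtx d' = gvtx d -> connect (link galp gsip) d d'.
  move=> /eqP; rewrite -gsi_orbit => /porbitP[k ->].
  elim: k => [|k IH]; first by rewrite perm1.
  by rewrite expgSr permM; apply: (tr _ _ _ IH (linkr _ _ _)).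
have ad d d' : gadj (gvtx d) (gvtx d') -> connect (link galp gsip) d d'.
  move=> /existsP[e /andP[/eqP h1 /eqP h2]].
  apply: (tr _ _ _ (vx d e h1) _); apply: (tr _ _ _ (linkl _ _ _) (vx _ _ _)).
  by rewrite permE h2.
pose z : gdart M := (ord0, ord0, true, (true, true)).
suff H d : connect (link galp gsip) d z by apply: (tr _ _ _ (H x) _); rewrite S.
case: d => -[[i j] s] dd.
have h1 k (i0 : 'I_M.+1) : i0 = k :> nat -> connect (link galp gsip) (i0, j, s, dd) (ord0, j, s, dd).
  elim: k i0 => [|k IH] i0 E; first by rewrite (_ : i0 = ord0) //; apply: val_inj.
  have lk : k < M.+1 by move: (ltn_ord i0); lia.
  apply: (tr _ _ _ _ (IH (Ordinal lk) (erefl _))); rewrite S; apply: ad; exact: gadj_i.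
have h2 k (j0 : 'I_M.+1) : j0 = k :> nat -> connect (link galp gsip) (ord0, j0, s, dd) (ord0, ord0, s, dd).
  elim: k j0 => [|k IH] j0 E; first by rewrite (_ : j0 = ord0) //; apply: val_inj.
  have lk : k < M.+1 by move: (ltn_ord j0); lia.
  apply: (tr _ _ _ _ (IH (Ordinal lk) (erefl _))); rewrite S; apply: ad; exact: gadj_j.
apply: (tr _ _ _ (h1 _ _ (erefl _)) _); apply: (tr _ _ _ (h2 _ _ (erefl _)) _).
case: s {h1 h2}; first exact: vx.
by apply: ad; apply: gadj_s.
Qed.

(** With [N = (M+1)^2] there are [2N] vertices, [4N] edges, [8N] darts, at least [2N + 2] faces and
    one component, and [2 + 8N = 2N + 4N + (2N + 2)]. *)
Lemma planar_grid : planar galp gsip.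
Proof.
have C : ncc galp gsip <= 1.
  have z : gdart M := (ord0, ord0, true, (true, true)).
  rewrite /ncc -(cards1 (comp (link galp gsip) z)); apply/subset_leq_card/subsetP.
  move=> _ /imsetP[x _ ->]; rewrite inE eq_comp ?grid_connected //; exact: link_sym.
have A : (ncyc galp).*2 = #|{: gdart M}|.
  by apply: ncyc_invol => d; rewrite !permE ?galK ?gal_neq.
have V : #|{: gvert M}| <= ncyc gsip.
  apply: (ncyc_lower (lab := gvtx) (F := fun v : gvert M => (v, (true, true)))) => //.
  by move=> d; rewrite permE; case: d => -[[i j] s] [ax sg].
have F := ncyc_lower glab_inv gcorner_inj.
move: C A V F; rewrite /planar !(card_prod, card_sum, card_ord, card_bool).
move: (ncyc galp) (ncyc gsip) (ncyc (galp * gsip)%g) (ncc galp gsip); clear; nia.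
Qed.
End Grid.

(** * Discretization of the sphere *)

Definition pb (P : Prop) : bool := if excluded_middle_informative P then true else false.

Lemma pbP P : reflect P (pb P).
Proof. by rewrite /pb; case: excluded_middle_informative => h; constructor. Qed.

(** * Connectedness and compactness of the unit interval *)

Section UnitInterval.
Local Open Scope R_scope.

(** The supremum of the initial segments on which [P] holds belongs to such a segment, and it can be
    passed unless it is 1. *)
Lemma locally_constant (P : R -> Prop) :
  (forall x, 0 <= x <= 1 -> exists eta, 0 < eta /\
     forall t, 0 <= t <= 1 -> Rabs (t - x) < eta -> (P t <-> P x)) ->
  P 0 -> forall t, 0 <= t <= 1 -> P t.
Proof.
move=> loc P0.
pose E x := 0 <= x <= 1 /\ forall t, 0 <= t <= x -> P t.
have E0 : E 0 by split; [lra|move=> t ht; have -> : t = 0 by lra].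
have [c [cub club]] : { c | is_lub E c }.
  by apply: completeness; [exists 1 => x [] | exists 0]; [lra|].
have c0 : 0 <= c by exact: cub.
have c1 : c <= 1 by apply: club => x [] [].
have [eta [eta0 he]] := loc c (conj c0 c1).
have [x [[x01 Px] xc]] : exists x, E x /\ c - eta < x.
  apply: NNPP => h; suff : c <= c - eta by lra.
  apply: club => x Ex; apply: Rnot_lt_le => xc; apply: h; by exists x.
have xlec : x <= c by apply: cub.
have Pc : P c.
  apply/(he x x01); first by rewrite Rabs_left1; lra.
  by apply: Px; lra.
pose y := Rmin 1 (c + eta / 2).
have y1 : y <= 1 by exact: Rmin_l.
have ye : y <= c + eta / 2 by exact: Rmin_r.
have Ey : E y.
  split; first by split=> //; apply: Rmin_glb; lra.
  move=> t ht; have [tx|xt] := Rle_lt_dec t x; first by apply: Px; lra.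
  by apply/he => //; [lra|apply: Rabs_def1; lra].
have yc := cub _ Ey.
have : y = 1.
  move: yc; rewrite /y /Rmin; case: Rle_dec => //; lra.
by move=> y1' t ht; apply: (proj2 Ey); lra.
Qed.

(** Compactness from connectedness: that a single [d] serves all of [[0, x]] is locally constant in
    [x]. *)
Lemma unit_compact (Q : R -> R -> Prop) :
  (forall d d' s, d' <= d -> Q d s -> Q d' s) ->
  (forall x, 0 <= x <= 1 -> exists d, 0 < d /\
     forall t, 0 <= t <= 1 -> Rabs (t - x) < d -> Q d t) ->
  exists d, 0 < d /\ forall t, 0 <= t <= 1 -> Q d t.
Proof.
move=> anti loc.
pose P x := exists d, 0 < d /\ forall t, 0 <= t <= x -> Q d t.
suff : P 1 by [].
have step x t d : 0 <= x <= 1 -> (forall t, 0 <= t <= 1 -> Rabs (t - x) < d -> Q d t) ->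
    0 < d -> 0 <= t <= 1 -> Rabs (t - x) < d -> P x -> P t.
  move=> x01 hd d0 t01 tx [d1 [d10 h1]]; exists (Rmin d d1); split.
    exact: Rmin_glb_lt.
  move=> s hs; have [sx|xs] := Rle_lt_dec s x.
    by apply: (anti d1); [exact: Rmin_r|apply: h1; lra].
  apply: (anti d); first exact: Rmin_l.
  apply: hd; first lra.
  rewrite Rabs_right; last lra.
  by move: tx; rewrite /Rabs; case: Rcase_abs; lra.
apply: (locally_constant (P := P)); last lra.
  move=> x x01; have [d [d0 hd]] := loc x x01; exists (d / 2); split; first lra.
  move=> t t01 tx; split; last by apply: (step x t d) => //; lra.
  apply: (step t x (d / 2)) => // [s s01 st||]; try lra.
    apply: (anti d); first lra.
    apply: hd => //; have -> : s - x = (s - t) + (t - x) by lra.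
    by apply: Rle_lt_trans (Rabs_triang _ _) _; lra.
  by rewrite Rabs_minus_sym.
have [d [d0 hd]] := loc 0 ltac:(lra); exists d; split=> // t ht.
by apply: hd; [lra|have -> : t = 0 by lra]; rewrite Rminus_diag Rabs_R0.
Qed.
End UnitInterval.

(** * Coordinates on the sphere and the distance of disjoint arcs *)

Section Octahedron.
Local Open Scope R_scope.

(* Coordinates on the pillow: radial projection to the octahedron, whose upper
   and lower halves project to the square |u|, |v| <= 1. *)
Definition nrm1 (p : pt3) : R := let '(x, y, z) := p in Rabs x + Rabs y + Rabs z.
Definition ou (p : pt3) : R := let '(x, y, z) := p in (x + y) / nrm1 p.
Definition ov (p : pt3) : R := let '(x, y, z) := p in (x - y) / nrm1 p.
Definition ow (p : pt3) : R := let '(x, y, z) := p in z / nrm1 p.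

Lemma nrm1_ge1 p : on_sphere p -> 1 <= nrm1 p.
Proof.
case: p => -[x y] z /= h.
have := Rabs_pos x; have := Rabs_pos y; have := Rabs_pos z.
have := pow2_abs x; have := pow2_abs y; have := pow2_abs z.
move: (Rabs x) (Rabs y) (Rabs z) => a b c; nra.
Qed.

(** Since [max(|x+y|, |x-y|) = |x| + |y|], the larger of [|u|] and [|v|] is [1 - |w|]. So [u] and
    [v] determine [w] up to sign, and [w = 0] is the rim of the square. *)
Lemma pillow_eq p : on_sphere p ->
  [/\ Rabs (ou p) + Rabs (ow p) <= 1, Rabs (ov p) + Rabs (ow p) <= 1 &
      Rabs (ou p) + Rabs (ow p) = 1 \/ Rabs (ov p) + Rabs (ow p) = 1].
Proof.
move=> sp; have := nrm1_ge1 sp; case: p {sp} => -[x y] z; rewrite /ou /ov /ow.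
set n := nrm1 _ => n1.
have E a : Rabs (a / n) = Rabs a / n.
  by rewrite /Rdiv Rabs_mult (Rabs_right (/ n)) //; left; apply: Rinv_0_lt_compat; lra.
rewrite !E -!Rdiv_plus_distr.
have -> : 1 = n / n by field; lra.
have i0 : 0 < / n by apply: Rinv_0_lt_compat; lra.
have H : [/\ Rabs (x + y) + Rabs z <= n, Rabs (x - y) + Rabs z <= n &
     Rabs (x + y) + Rabs z = n \/ Rabs (x - y) + Rabs z = n].
  rewrite /n /nrm1 /Rabs; do 5 (case: Rcase_abs => ?); split; lra.
case: H => h1 h2 h3; split.
- by apply: Rmult_le_compat_r => //; lra.
- by apply: Rmult_le_compat_r => //; lra.
by case: h3 => ->; [left|right].
Qed.

(** Equal coordinates make one point a positive multiple of the other, and both have norm 1. *)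
Lemma pillow_inj p q : on_sphere p -> on_sphere q ->
  ou p = ou q -> ov p = ov q -> ow p = ow q -> p = q.
Proof.
move=> sp sq; have := nrm1_ge1 sp; have := nrm1_ge1 sq.
case: p q sp sq => -[x y] z [[x' y'] z']; rewrite /ou /ov /ow.
move: (nrm1 (x, y, z)) (nrm1 (x', y', z')) => n n' /= h h' n1 n1' e1 e2 e3.
have [k [k0 [ex ey ez]]] : exists k, 0 < k /\ [/\ x = k * x', y = k * y' & z = k * z'].
  exists (n / n'); split; first by apply: Rdiv_lt_0_compat; lra.
  have f1 : x + y = n / n' * (x' + y').
    by transitivity (n * ((x + y) / n)); [|rewrite e1]; field; lra.
  have f2 : x - y = n / n' * (x' - y').
    by transitivity (n * ((x - y) / n)); [|rewrite e2]; field; lra.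
  have f3 : z = n / n' * z'.
    by transitivity (n * (z / n)); [|rewrite e3]; field; lra.
  by split=> //; lra.
suff k1 : k = 1 by rewrite ex ey ez k1 !Rmult_1_l.
have : k ^ 2 * (x' ^ 2 + y' ^ 2 + z' ^ 2) = 1 by rewrite -h ex ey ez; ring.
rewrite h'; nra.
Qed.

(** The numerators involve two coordinates and the denominator three, whence the constants 2 and 3,
    and their sum 5 for the quotient. *)
Lemma quot_lip a b n m d : 1 <= n -> 1 <= m -> Rabs b <= m ->
  Rabs (a - b) <= 2 * d -> Rabs (n - m) <= 3 * d -> Rabs (a / n - b / m) <= 5 * d.
Proof.
move=> n1 m1 hb hab hnm.
have -> : a / n - b / m = (a - b) * / n + (b * / m) * ((m - n) * / n) by field; lra.
apply: Rle_trans (Rabs_triang _ _) _.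
have i0 : 0 < / n by apply: Rinv_0_lt_compat; lra.
have i1 : / n <= 1 by rewrite -Rinv_1; apply: Rinv_le_contravar; lra.
have j0 : 0 < / m by apply: Rinv_0_lt_compat; lra.
have bm : Rabs (b * / m) <= 1.
  rewrite Rabs_mult (Rabs_right (/ m)); last lra.
  have -> : 1 = m * / m by field; lra.
  by apply: Rmult_le_compat_r; lra.
have h c e : Rabs c <= e -> Rabs (c * / n) <= e.
  move=> ce; rewrite Rabs_mult (Rabs_right (/ n)); last lra.
  have := Rabs_pos c; nra.
have h1 := h _ _ hab.
have h2 : Rabs ((m - n) * / n) <= 3 * d by apply: h; rewrite Rabs_minus_sym.
rewrite (Rabs_mult (b * / m)).
have := Rmult_le_compat _ _ _ _ (Rabs_pos _) (Rabs_pos _) bm h2; lra.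
Qed.

Lemma d3_coord x y z x' y' z' d : d3 (x, y, z) (x', y', z') < d ->
  [/\ Rabs (x - x') <= d, Rabs (y - y') <= d & Rabs (z - z') <= d].
Proof.
rewrite /d3 => h.
have H a b : a ^ 2 + b >= 0 -> 0 <= b -> sqrt (a ^ 2 + b) < d -> Rabs a <= d.
  move=> _ b0 hs; apply: Rle_trans (Rlt_le _ _ hs).
  rewrite -sqrt_Rsqr_abs; apply: sqrt_le_1_alt; rewrite /Rsqr; lra.
split.
- apply: (H _ ((y - y') ^ 2 + (z - z') ^ 2)); last by rewrite -Rplus_assoc.
    by have := pow2_ge_0 (x - x'); have := pow2_ge_0 (y - y'); have := pow2_ge_0 (z - z'); lra.
  by have := pow2_ge_0 (y - y'); have := pow2_ge_0 (z - z'); lra.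
- apply: (H _ ((x - x') ^ 2 + (z - z') ^ 2)).
  + by have := pow2_ge_0 (x - x'); have := pow2_ge_0 (y - y'); have := pow2_ge_0 (z - z'); lra.
  + by have := pow2_ge_0 (x - x'); have := pow2_ge_0 (z - z'); lra.
  by rewrite -Rplus_assoc [(_ + (x - x') ^ 2)]Rplus_comm.
apply: (H _ ((x - x') ^ 2 + (y - y') ^ 2)).
- by have := pow2_ge_0 (x - x'); have := pow2_ge_0 (y - y'); have := pow2_ge_0 (z - z'); lra.
- by have := pow2_ge_0 (x - x'); have := pow2_ge_0 (y - y'); lra.
by rewrite Rplus_comm.
Qed.

Lemma pillow_lip p q d : on_sphere p -> on_sphere q -> d3 p q < d ->
  [/\ Rabs (ou p - ou q) <= 5 * d, Rabs (ov p - ov q) <= 5 * d & Rabs (ow p - ow q) <= 5 * d].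
Proof.
move=> sp sq; have := nrm1_ge1 sp; have := nrm1_ge1 sq.
case: p q {sp sq} => -[x y] z [[x' y'] z'] n1 n1' /d3_coord[h1 h2 h3].
have hn : Rabs (nrm1 (x, y, z) - nrm1 (x', y', z')) <= 3 * d.
  rewrite /nrm1; have T a b : Rabs (a - b) <= d -> - d <= Rabs a - Rabs b <= d.
    move=> ab; have := Rle_trans _ _ _ (Rabs_triang_inv2 a b) ab.
    by move: (Rabs a - Rabs b) => e; rewrite /Rabs; case: Rcase_abs => ?; lra.
  have := T _ _ h1; have := T _ _ h2; have := T _ _ h3.
  move: (Rabs x) (Rabs y) (Rabs z) (Rabs x') (Rabs y') (Rabs z') => * .
  by apply: Rabs_le; lra.
have d0 : 0 <= d by apply: (Rle_trans _ _ _ (Rabs_pos _) h1).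
split; apply: quot_lip => //; rewrite /nrm1.
- by move: (Rabs_pos z'); rewrite /Rabs; do 4! case: Rcase_abs => ?; lra.
- by move: h1 h2; rewrite /Rabs; do 3! case: Rcase_abs => ?; lra.
- by move: (Rabs_pos z'); rewrite /Rabs; do 4! case: Rcase_abs => ?; lra.
- by move: h1 h2; rewrite /Rabs; do 3! case: Rcase_abs => ?; lra.
- by move: (Rabs_pos x') (Rabs_pos y'); rewrite /Rabs; do 3! case: Rcase_abs => ?; lra.
by lra.
Qed.

(** Distance is measured in the three pillow coordinates because these are what the grid can
    compare. *)
Definition separated (d : R) (p q : pt3) : Prop :=
  [\/ d <= Rabs (ou p - ou q), d <= Rabs (ov p - ov q) | d <= Rabs (ow p - ow q)].

Definition continuous01 (g : R -> pt3) := forall t, 0 <= t <= 1 -> forall eps, 0 < eps ->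
  exists delta, 0 < delta /\
    forall s, 0 <= s <= 1 -> Rabs (s - t) < delta -> d3 (g s) (g t) < eps.

Definition sphere01 (g : R -> pt3) := forall t, 0 <= t <= 1 -> on_sphere (g t).

Lemma separated_le d d' p q : d' <= d -> separated d p q -> separated d' p q.
Proof. by move=> h [a|a|a]; [constructor 1|constructor 2|constructor 3]; lra. Qed.

Lemma separated_near d p q p' q' : on_sphere p -> on_sphere q -> on_sphere p' ->
  on_sphere q' -> d3 p' p < d / 20 -> d3 q' q < d / 20 ->
  separated d p q -> separated (d / 2) p' q'.
Proof.
move=> sp sq sp' sq' /(pillow_lip sp' sp)[a1 a2 a3] /(pillow_lip sq' sq)[b1 b2 b3].
have T a b a' b' : Rabs (a' - a) <= 5 * (d / 20) -> Rabs (b' - b) <= 5 * (d / 20) ->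
    d <= Rabs (a - b) -> d / 2 <= Rabs (a' - b').
  by rewrite /Rabs; do 4! case: Rcase_abs => ?; lra.
by case=> h; [constructor 1|constructor 2|constructor 3]; apply: (T _ _ _ _ _ _ h).
Qed.

(** Compactness in each of the two parameters in turn; at a single pair of distinct points some
    coordinate differs by [pillow_inj]. *)
Lemma disjoint_arcs_separated g h : continuous01 g -> continuous01 h ->
  sphere01 g -> sphere01 h ->
  (forall s t, 0 <= s <= 1 -> 0 <= t <= 1 -> g s <> h t) ->
  exists d, 0 < d /\ forall s t, 0 <= s <= 1 -> 0 <= t <= 1 -> separated d (g s) (h t).
Proof.
move=> cg ch sg sh ne.
suff [d [d0 H]] : exists d, 0 < d /\ forall s, 0 <= s <= 1 ->
    forall t, 0 <= t <= 1 -> separated d (g s) (h t).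
  by exists d; split=> // s t s01 t01; apply: H.
apply: unit_compact => [d d' s dd' H t t01|s0 s01].
  by apply: separated_le dd' (H t t01).
suff [d [d0 H]] : exists d, 0 < d /\ forall t, 0 <= t <= 1 ->
    forall s, 0 <= s <= 1 -> Rabs (s - s0) < d -> separated d (g s) (h t).
  by exists d; split=> // s s1 ss t t1; apply: H.
apply: unit_compact => [d d' t dd' H s s1 ss|t0 t01].
  by apply: (separated_le dd'); apply: H => //; lra.
have [d [d0 H]] : exists d, 0 < d /\ separated d (g s0) (h t0).
  pose p := g s0; pose q := h t0; rewrite -/p -/q.
  have P a b : a <> b -> 0 < Rabs (a - b) by move=> ab; apply: Rabs_pos_lt; lra.
  have [e1|/P n1] := Req_dec (ou p) (ou q); last first.
    by exists (Rabs (ou p - ou q)); split=> //; constructor 1; lra.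
  have [e2|/P n2] := Req_dec (ov p) (ov q); last first.
    by exists (Rabs (ov p - ov q)); split=> //; constructor 2; lra.
  have [e3|/P n3] := Req_dec (ow p) (ow q); last first.
    by exists (Rabs (ow p - ow q)); split=> //; constructor 3; lra.
  by case: (ne s0 t0 s01 t01); apply: pillow_inj; [exact: sg|exact: sh| | |].
have d20 : 0 < d / 20 by lra.
have [a [a0 ha]] := cg s0 s01 _ d20.
have [b [b0 hb]] := ch t0 t01 _ d20.
exists (Rmin (Rmin a b) (d / 2)); split.
  by apply: Rmin_glb_lt; [apply: Rmin_glb_lt|lra].
have m1 := Rmin_l (Rmin a b) (d / 2); have m2 := Rmin_r (Rmin a b) (d / 2).
have m3 := Rmin_l a b; have m4 := Rmin_r a b.
move=> t t1 tt s s1 ss; apply: (separated_le m2).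
apply: (separated_near (p := g s0) (q := h t0)) => //; try (by [apply: sg|apply: sh]).
  by apply: ha => //; lra.
by apply: hb => //; lra.
Qed.
End Octahedron.

Lemma Rabs_le_elim a b : (Rabs a <= b)%R -> (- b <= a <= b)%R.
Proof. by rewrite /Rabs; case: Rcase_abs => ? ?; lra. Qed.

(** * Traces of arcs on the grid *)

Section Discretize.
Variable M : nat.
Hypothesis M0 : (0 < INR M)%R.

Definition gb (g : gvert M) : bool :=
  let '(i, j, s) := g in
  [|| i == 0 :> nat, i == M :> nat, j == 0 :> nat | j == M :> nat].

Definition gscale (c : R) : R := ((c + 1) * INR M / 2)%R.

(** The sheet must fit the sign of [w], except at a rim vertex, which stands for points of both
    sheets; so an arc may cross the equator without a jump. *)
Definition near (g : gvert M) (p : pt3) : Prop :=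
  let '(i, j, s) := g in
  [/\ (Rabs (gscale (ou p) - INR i) <= 1)%R, (Rabs (gscale (ov p) - INR j) <= 1)%R &
      (if s then (0 <= ow p)%R else (ow p < 0)%R) \/ gb g].

Lemma gscale_sub a b : (gscale a - gscale b = INR M * (a - b) / 2)%R.
Proof. by rewrite /gscale; lra. Qed.

(** Both points lie within one step of the vertex and a step has length [2 / M], which gives 4 for
    [u] and [v]. Then [pillow_eq] controls [w]: on one sheet through its absolute value, and at the
    rim because [|w|] itself is at most [2 / M]. *)
Lemma near_close g p q : on_sphere p -> on_sphere q -> near g p -> near g q ->
  [/\ (INR M * Rabs (ou p - ou q) <= 4)%R, (INR M * Rabs (ov p - ov q) <= 4)%R &
      (INR M * Rabs (ow p - ow q) <= 4)%R].
Proof.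
move=> /pillow_eq[p1 p2 p3] /pillow_eq[q1 q2 q3]; case: g => -[i j] s [ui vj sg] [ui' vj' sg'].
have C a b k : (Rabs (gscale a - INR k) <= 1)%R -> (Rabs (gscale b - INR k) <= 1)%R ->
    (INR M * Rabs (a - b) <= 4)%R.
  move=> h1 h2; rewrite -(Rabs_right (INR M)); last lra.
  rewrite -Rabs_mult; have -> : (INR M * (a - b) = 2 * (gscale a - gscale b))%R.
    by rewrite gscale_sub; lra.
  rewrite Rabs_mult (Rabs_right 2); last lra.
  move: h1 h2; rewrite /Rabs; do 3! case: Rcase_abs => ?; lra.
have cu := C _ _ _ ui ui'; have cv := C _ _ _ vj vj'.
split=> //.
have B : gb (i, j, s) -> forall r, (Rabs (gscale (ou r) - INR i) <= 1)%R -> 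
    (Rabs (gscale (ov r) - INR j) <= 1)%R -> (Rabs (ou r) + Rabs (ow r) <= 1)%R ->
    (Rabs (ov r) + Rabs (ow r) <= 1)%R -> (INR M * Rabs (ow r) <= 2)%R.
  move=> bd r a b c d.
  have E0 e k : k = 0 \/ k = M -> (Rabs (gscale e - INR k) <= 1)%R ->
     (Rabs e + Rabs (ow r) <= 1)%R -> (INR M * Rabs (ow r) <= 2)%R.
    move=> hk h1 h2; have := Rmult_le_compat_l _ _ _ (Rlt_le _ _ M0) h2.
    have g1 := Rmult_le_compat_l _ _ _ (Rlt_le _ _ M0) (Rle_abs e).
    have := Rmult_le_compat_l _ _ _ (Rlt_le _ _ M0) (Rle_abs (- e)); rewrite Rabs_Ropp.
    have := Rabs_le_elim h1; rewrite /gscale; case: hk => ->; rewrite ?INR_0 /=; lra.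
  case/or4P: bd => /eqP E.
  - by apply: (E0 (ou r) i); auto.
  - by apply: (E0 (ou r) i); auto.
  - by apply: (E0 (ov r) j); auto.
  by apply: (E0 (ov r) j); auto.
have bb : gb (i, j, s) -> (INR M * Rabs (ow p - ow q) <= 4)%R.
  move=> b; have := B b _ ui vj p1 p2; have := B b _ ui' vj' q1 q2.
  have := Rabs_triang (ow p) (- ow q); rewrite Rabs_Ropp -/(ow p - ow q)%R => h h1 h2.
  have := Rmult_le_compat_l _ _ _ (Rlt_le _ _ M0) h; lra.
case: sg => [sg|/bb //]; case: sg' => [sg'|/bb //].
have -> : Rabs (ow p - ow q) = Rabs (Rabs (ow p) - Rabs (ow q)).
  move: sg sg'; case: s {B bb}; first by move=> a b; rewrite !(Rabs_right (ow _)); lra.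
  move=> a b; rewrite !(Rabs_left (ow _)) //.
  have -> : (- ow p - - ow q = - (ow p - ow q))%R by lra.
  by rewrite Rabs_Ropp.
have K a b : (INR M * Rabs (a - b) <= 4)%R -> (- 4 <= INR M * (Rabs a - Rabs b) <= 4)%R.
  move=> h; have := Rmult_le_compat_l _ _ _ (Rlt_le _ _ M0) (Rabs_triang_inv2 a b).
  move: (Rabs a - Rabs b)%R => c; rewrite {1}/Rabs; case: Rcase_abs => ?; nra.
have G e : (- 4 <= INR M * e <= 4)%R -> (INR M * Rabs e <= 4)%R.
  by rewrite /Rabs; case: Rcase_abs => ? ?; lra.
have hu := K _ _ cu; have hv := K _ _ cv; apply: G.
move: p1 p2 p3 q1 q2 q3 hv hu.
move: (Rabs (ou p)) (Rabs (ov p)) (Rabs (ow p)) (Rabs (ou q)) (Rabs (ov q)) (Rabs (ow q)).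
move=> a b c a' b' c' p1 p2 p3 q1 q2 q3 hv hu.
split; case: p3 => ?; case: q3 => ?; nra.
Qed.

Lemma nearest (m : nat) (U : R) : (0 <= U <= INR m)%R ->
  exists i : 'I_m.+1, (Rabs (U - INR i) <= / 2)%R.
Proof.
elim: m => [|m IH] h.
  exists ord0; have -> : U = 0%R by move: h => /=; lra.
  by rewrite /= Rminus_diag Rabs_R0; lra.
have [Um|mU] := Rle_lt_dec U (INR m).
  have [|i hi] := IH; first lra.
  by exists (widen_ord (leqnSn _) i).
rewrite S_INR in h.
have [Um|Um] := Rle_lt_dec U (INR m + / 2).
  by exists (widen_ord (leqnSn _) ord_max) => /=; apply: Rabs_le; lra.
by exists ord_max => /=; rewrite -/(INR m.+1) S_INR; apply: Rabs_le; lra.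
Qed.

Lemma gscale_bound c : (Rabs c <= 1)%R -> (0 <= gscale c <= INR M)%R.
Proof. by rewrite /gscale /Rabs; case: Rcase_abs => ? ?; nra. Qed.

Lemma near_common p q : on_sphere p -> on_sphere q ->
  (INR M * Rabs (ou p - ou q) <= 1)%R -> (INR M * Rabs (ov p - ov q) <= 1)%R ->
  (INR M * Rabs (ow p - ow q) <= 1)%R -> exists g, near g p /\ near g q.
Proof.
move=> /pillow_eq[p1 p2 p3] /pillow_eq[q1 q2 q3] hu hv hw.
have hup : (Rabs (ou p) <= 1)%R by have := Rabs_pos (ow p); lra.
have hvp : (Rabs (ov p) <= 1)%R by have := Rabs_pos (ow p); lra.
have [i hi] := nearest (gscale_bound hup); have [j hj] := nearest (gscale_bound hvp).
have C a b k : (Rabs (gscale a - INR k) <= / 2)%R -> (INR M * Rabs (a - b) <= 1)%R ->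
    (Rabs (gscale b - INR k) <= 1)%R.
  rewrite -{1}(Rabs_right (INR M)); last lra.
  rewrite -Rabs_mult; have -> : (INR M * (a - b) = 2 * (gscale a - gscale b))%R.
    by rewrite gscale_sub; lra.
  rewrite Rabs_mult (Rabs_right 2); last lra.
  rewrite /Rabs; do 3! case: Rcase_abs => ?; lra.
have hi' := C _ _ _ hi hu; have hj' := C _ _ _ hj hv.
(* Either the points lie on one sheet, or [p] is so close to the equator that a rim vertex, which
   ignores the sheet, serves both. *)
have [[s [hp hq]]|opp] : (exists s : bool, (if s then (0 <= ow p)%R else (ow p < 0)%R) /\
    (if s then (0 <= ow q)%R else (ow q < 0)%R)) \/ (INR M * Rabs (ow p) <= 1)%R.
  move: hw; have [a|a] := Rle_lt_dec 0 (ow p); have [b|b] := Rle_lt_dec 0 (ow q) => hw.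
  - by left; exists true.
  - by right; move: hw; rewrite /Rabs; do 2! case: Rcase_abs => ?; nra.
  - by right; move: hw; rewrite /Rabs; do 2! case: Rcase_abs => ?; nra.
  by left; exists false.
  by exists (i, j, s); split; split=> //; try lra; by left.
have E a : (Rabs a + Rabs (ow p) = 1)%R ->
    exists2 k : 'I_M.+1, (k == 0 :> nat) || (k == M :> nat) & (Rabs (gscale a - INR k) <= / 2)%R.
  move=> h; have ha : (1 - Rabs a = Rabs (ow p))%R by lra.
  have h0 : (0 <= INR M * (1 - Rabs a))%R.
    by rewrite ha; apply: Rmult_le_pos; [lra|exact: Rabs_pos].
  move: opp h0; rewrite -ha /gscale; rewrite /(Rabs a); case: Rcase_abs => ? opp h0.
    by exists ord0; rewrite //=; apply: Rabs_le; lra.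
  by exists ord_max; rewrite /= ?eqxx ?orbT //; apply: Rabs_le; lra.
case: p3 => /E[k hk kk].
  have kk' := C _ _ _ kk hu; exists (k, j, true).
  have b : gb (k, j, true) by move: hk => /= /orP[] ->; rewrite ?orbT.
  by split; split=> //; try lra; right.
have kk' := C _ _ _ kk hv; exists (i, k, true).
have b : gb (i, k, true) by move: hk => /= /orP[] ->; rewrite ?orbT.
by split; split=> //; try lra; right.
Qed.

Definition gconn (S : {set gvert M}) : rel (gvert M) :=
  connect [rel x y : gvert M | [&& x \in S, y \in S & gadj x y]].

Lemma gconn_sym (S : {set gvert M}) : connect_sym [rel x y : gvert M | [&& x \in S, y \in S & gadj x y]].
Proof.
by apply: sym_connect_sym => x y /=; rewrite gadj_sym andbCA.
Qed.

(** Every near vertex is joined to the nearest one [(i0, j0, s0)]: change the sheet, which is needed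
    only at the rim, then take at most one step in each direction. All vertices visited are near
    [p]. *)
Lemma near_gconn (S : {set gvert M}) p g g' : on_sphere p -> (forall g, near g p -> g \in S) ->
  near g p -> near g' p -> gconn S g g'.
Proof.
move=> /pillow_eq[p1 p2 _] nS.
have hup : (Rabs (ou p) <= 1)%R by have := Rabs_pos (ow p); lra.
have hvp : (Rabs (ov p) <= 1)%R by have := Rabs_pos (ow p); lra.
have [i0 hi] := nearest (gscale_bound hup); have [j0 hj] := nearest (gscale_bound hvp).
have [s0 hs] : exists s : bool, if s then (0 <= ow p)%R else (ow p < 0)%R.
  by have [a|a] := Rle_lt_dec 0 (ow p); [exists true|exists false].
suff H h : near h p -> gconn S h (i0, j0, s0).
  move=> /H h1 /H h2; apply: connect_trans h1 _; by rewrite gconn_sym.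
case: h => -[i j] s h.
have st x y : near x p -> near y p -> gadj x y -> gconn S x y.
  by move=> nx ny xy; apply: connect1; rewrite /= !nS.
have near1 a (k k' : 'I_M.+1) : (Rabs (gscale a - INR k) <= 1)%R ->
    (Rabs (gscale a - INR k') <= / 2)%R -> k = k' \/ k' = k.+1 :> nat \/ k = k'.+1 :> nat.
  move=> h1 h2; have [e|n1] := eqVneq (k : nat) k'; first by left; apply: val_inj.
  right; have hk : (INR k < INR k' + 2)%R /\ (INR k' < INR k + 2)%R.
    by move: h1 h2; rewrite /Rabs; do 2! case: Rcase_abs => ?; lra.
  have e2 m : (INR m + 2 = INR (m + 2))%R by rewrite plus_INR.
  case: hk; rewrite !e2 => /INR_lt a1 /INR_lt a2; lia.
have h0 : near (i, j, s0) p by case: h => a b _; split=> //; left.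
have h1 : near (i0, j, s0) p by case: h0 => a b _; split=> //; [lra|left].
have h2 : near (i0, j0, s0) p by split=> //; try lra; left.
have c0 : gconn S (i, j, s) (i, j, s0).
  have [->|ns] := eqVneq s s0; first exact: connect0.
  apply: st => //; have -> : s0 = ~~ s by case: s s0 ns {h hs h0 h1 h2} => [] [].
  apply: gadj_s; case: h => _ _ []; last by [].
  by case: s s0 ns hs {h0 h1 h2} => [] [] // _; lra.
have c1 : gconn S (i, j, s0) (i0, j, s0).
  case: h0 => a _ _; case: (near1 _ _ _ a hi) => [->|[E|E]]; first exact: connect0.
    by apply: st => //; [case: h => *; split=> //; left|apply: gadj_i].
  by rewrite /gconn gconn_sym; apply: st => //; [case: h => *; split=> //; left|apply: gadj_i].
have c2 : gconn S (i0, j, s0) (i0, j0, s0).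
  case: (h1) => _ a _; case: (near1 _ _ _ a hj) => [->|[E|E]]; first exact: connect0.
    by apply: st => //; apply: gadj_j.
  by rewrite /gconn gconn_sym; apply: st => //; apply: gadj_j.
exact: connect_trans c0 (connect_trans c1 c2).
Qed.
End Discretize.

Lemma uniform_bound (T : finType) (Q : R -> T -> Prop) :
  (forall d d' x, (d' <= d)%R -> Q d x -> Q d' x) ->
  (forall x, exists d, (0 < d)%R /\ Q d x) -> exists d, (0 < d)%R /\ forall x, Q d x.
Proof.
move=> anti ex.
suff [d [d0 H]] : exists d, (0 < d)%R /\ forall x, x \in enum T -> Q d x.
  by exists d; split=> // x; apply: H; rewrite mem_enum.
elim: (enum T) => [|x s [d [d0 IH]]]; first by exists 1%R; split=> //; lra.
have [d' [d0' Qx]] := ex x; exists (Rmin d d'); split; first exact: Rmin_glb_lt.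
move=> y; rewrite inE => /orP[/eqP->|/IH].
  by apply: anti Qx; exact: Rmin_r.
by apply: anti; exact: Rmin_l.
Qed.

(** The trace of an arc consists of all vertices near some point of it. Along the arc consecutive
    points share a near vertex, so the trace is connected. *)
Lemma discretize (J : finType) (g : J -> R -> pt3) :
  (forall j, continuous01 (g j)) -> (forall j, sphere01 (g j)) ->
  exists (M : nat) (S : J -> {set gvert M}),
    (forall j x y, x \in S j -> y \in S j -> gconn (S j) x y) /\
    (forall j k, S j :&: S k != set0 <->
       exists s t, [/\ (0 <= s <= 1)%R, (0 <= t <= 1)%R & g j s = g k t]).
Proof.
move=> cg sg.
pose meets j k := exists s t, [/\ (0 <= s <= 1)%R, (0 <= t <= 1)%R & g j s = g k t].
have [d [d0 H]] : exists d, (0 < d)%R /\ forall jk : J * J, ~ meets jk.1 jk.2 ->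
    forall s t, (0 <= s <= 1)%R -> (0 <= t <= 1)%R -> separated d (g jk.1 s) (g jk.2 t).
  apply: uniform_bound => [d d' x dd H nx s t hs ht|[j k]].
    by apply: (separated_le dd); apply: H.
  have [m|m] := classic (meets j k); first by exists 1%R; split; [lra|].
  have [s t hs ht E|d [d0 H]] := disjoint_arcs_separated (cg j) (cg k) (sg j) (sg k).
    by apply: m; exists s, t.
  by exists d.
(* The 4 is the bound of [near_close]: arcs at distance [d] then have no common near vertex. *)
have [M [M0 hM]] : exists M, (0 < INR M)%R /\ (4 < INR M * d)%R.
  have [n hn] := INR_unbounded (4 / d); exists n.+1.
  have p0 := pos_INR n; rewrite S_INR; split; first lra.
  have : (4 / d * d < (INR n + 1) * d)%R by apply: Rmult_lt_compat_r; lra.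
  by have -> : (4 / d * d = 4)%R by field; lra.
pose S j : {set gvert M} := [set x | pb (exists t, (0 <= t <= 1)%R /\ near x (g j t))].
have SP j x : reflect (exists t, (0 <= t <= 1)%R /\ near x (g j t)) (x \in S j).
  by rewrite inE; exact: pbP.
exists M, S; split; last first.
  move=> j k; split=> [/set0Pn[x]|].
    rewrite inE => /andP[/SP[s [hs ns]] /SP[t [ht nt]]].
    apply: NNPP => nm.
    have sp := sg j s hs; have st := sg k t ht.
    have [h1 h2 h3] := near_close M0 sp st ns nt.
    have B a : (d <= a)%R -> (INR M * a <= 4)%R -> False.
      move=> da; have := Rmult_le_compat_l _ _ _ (Rlt_le _ _ M0) da; lra.
    by case: (H (j, k) nm s t hs ht) => /= /B; apply.
  move=> [s [t [hs ht E]]]; have sp := sg j s hs.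
  have [|||x [nx _]] := near_common M0 sp sp; try by rewrite Rminus_diag Rabs_R0; lra.
  apply/set0Pn; exists x; rewrite inE; apply/andP; split; apply/SP; [exists s|exists t] => //.
  by rewrite -E.
move=> j x y /SP[s [hs ns]] /SP[t [ht nt]].
have nS r : (0 <= r <= 1)%R -> forall z, near z (g j r) -> z \in S j.
  by move=> hr z nz; apply/SP; exists r.
have self r : (0 <= r <= 1)%R -> exists z : gvert M, near z (g j r).
  move=> hr; have sp := sg j r hr.
  have [|||z [nz _]] := near_common M0 sp sp; try by rewrite Rminus_diag Rabs_R0; lra.
  by exists z.
have [x0 nx0] : exists x0 : gvert M, near x0 (g j 0%R) by apply: self; lra.
pose P r := forall z : gvert M, near z (g j r) -> gconn (S j) x0 z.
suff H0 : forall r, (0 <= r <= 1)%R -> P r.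
  apply: connect_trans (H0 t ht _ nt); rewrite gconn_sym; exact: H0 ns.
apply: locally_constant => [r hr|z nz]; last first.
  have h01 : (0 <= 0 <= 1)%R by lra.
  exact: (near_gconn M0 (sg j _ h01) (nS _ h01) nx0 nz).
(* The 5 is the Lipschitz constant of [pillow_lip], so that points at this distance satisfy the
   assumptions of [near_common]. *)
have e0 : (0 < / (5 * INR M))%R by apply: Rinv_0_lt_compat; lra.
have [eta [eta0 he]] := cg j r hr _ e0.
exists eta; split=> // u hu ur; have [l1 l2 l3] := pillow_lip (sg j u hu) (sg j r hr) (he u hu ur).
have B a : (a <= 5 * / (5 * INR M))%R -> (INR M * a <= 1)%R.
  move=> h; have := Rmult_le_compat_l _ _ _ (Rlt_le _ _ M0) h.
  by have -> : (INR M * (5 * / (5 * INR M)) = 1)%R by field; lra.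
have [c [cu cr]] := near_common M0 (sg j u hu) (sg j r hr) (B _ l1) (B _ l2) (B _ l3).
split=> hP z nz.
  apply: connect_trans (hP c cu) _; exact: (near_gconn M0 (sg j _ hr) (nS _ hr) cr nz).
apply: connect_trans (hP c cr) _; exact: (near_gconn M0 (sg j _ hu) (nS _ hu) cu nz).
Qed.

(** * Contraction of the grid onto the drawing *)

Lemma gconn_sub M (X Y : {set gvert M}) x y : X \subset Y -> gconn X x y -> gconn Y x y.
Proof.
move=> /subsetP XY; apply: connect_sub => {}x {}y /= /and3P[xX yX xy].
by apply: connect1; rewrite /= !XY.
Qed.

Lemma gconn_contr M (X : {set gvert M}) (B : {set gdart M}) k k' :
  (forall d : gdart M, gvtx d \in X -> gvtx (gal d) \in X -> d \in B) ->
  gconn X (gvtx k) (gvtx k') -> connect (contr (galp M) (gsip M) B) k k'.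
Proof.
move=> XB.
have step d d' : gvtx d' = gvtx d -> connect (contr (galp M) (gsip M) B) d d'.
  move=> /eqP; rewrite -gsi_orbit; apply: porbit_sub => [x|x y z|x].
  - exact: connect0.
  - exact: connect_trans.
  by apply: connect1; rewrite /contr /= eqxx.
case/connectP => p; move E : (gvtx k) => v; elim: p k v E => [|w p IH] k v E /=.
  by move=> _ E'; apply: step; rewrite E' -E.
move=> /andP[/and3P[vX wX /existsP[d /andP[/eqP dv /eqP dw]]] pw] E'.
apply: connect_trans (step k d _) _; first by rewrite dv E.
apply: connect_trans (connect1 _) (IH (gal d) w dw pw E').
by rewrite /contr /= [galp M d]permE eqxx andbT XB ?orbT ?dv ?dw.
Qed.

Section Nerve.
Variables (HD : finType) (al : {perm HD}) (fwd : pred HD) (same : rel HD).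
Hypothesis alK : forall d, al (al d) = d.
Hypothesis fwd_al : forall d, fwd (al d) = ~~ fwd d.
Hypothesis same_refl : forall d, same d d.
Hypothesis same_sym : forall d d', same d d' = same d' d.
Hypothesis same_trans : forall d2 d1 d3, same d1 d2 -> same d2 d3 -> same d1 d3.
Hypothesis same_al : forall d, ~~ same d (al d).

Variables (M : nat) (Near Mid : HD -> {set gvert M}).
Hypothesis near_conn : forall d x y, x \in Near d -> y \in Near d -> gconn (Near d) x y.
Hypothesis mid_conn : forall d x y, x \in Mid d -> y \in Mid d -> gconn (Mid d) x y.
Hypothesis near_near : forall d d', (Near d :&: Near d' != set0) = same d d'.
Hypothesis mid_mid : forall d d', fwd d -> fwd d' -> Mid d :&: Mid d' != set0 -> d = d'.
Hypothesis mid_near : forall d d', fwd d -> Mid d :&: Near d' != set0 -> d' = d \/ d' = al d.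
Hypothesis mid_near_tail : forall d, fwd d -> Mid d :&: Near d != set0.
Hypothesis mid_near_head : forall d, fwd d -> Mid d :&: Near (al d) != set0.

(** The trace of a whole node: the near pieces of all darts leaving it. *)
Let NS d := \bigcup_(d' | same d d') Near d'.

Let memI (X Y : {set gvert M}) g : g \in X -> g \in Y -> X :&: Y != set0.
Proof. by move=> gX gY; apply/set0Pn; exists g; rewrite inE gX. Qed.

Let NS_same g d d' : g \in NS d -> (g \in NS d') = same d d'.
Proof.
move=> /bigcupP[e de ge]; apply/bigcupP/idP => [[e' de' ge']|dd].
  have ee : same e e' by rewrite -near_near; apply: memI ge ge'.
  by apply: same_trans (same_trans de ee) _; rewrite same_sym.
by exists e => //; apply: same_trans de; rewrite same_sym.
Qed.

Let near_NS d : Near d \subset NS d.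
Proof. by apply/subsetP => g gd; apply/bigcupP; exists d. Qed.

Let NS_conn d x y : x \in NS d -> y \in NS d -> gconn (NS d) x y.
Proof.
move=> /bigcupP[e de xe] /bigcupP[e' de' ye'].
have : same e e' by apply: same_trans de'; rewrite same_sym.
rewrite -near_near => /set0Pn[z]; rewrite inE => /andP[ze ze'].
have S d' : same d d' -> Near d' \subset NS d by move=> dd; exact: bigcup_sup.
apply: connect_trans (gconn_sub (S _ de) (near_conn xe ze)) _.
exact: gconn_sub (S _ de') (near_conn ze' ye').
Qed.

Let In d := Mid d :\: NS d.
(** What remains attached to the head of the segment when the tail node is cut off its middle trace.
    It will be absorbed by the head node, and one grid edge between it and the tail node will
    represent the segment. *)
Let Ms d := [set g in In d | [exists b in Mid d :&: Near (al d), gconn (In d) b g]].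

Let Ms_mid d g : g \in Ms d -> g \in Mid d /\ g \notin NS d.
Proof. by rewrite !inE => /andP[/andP[-> ->]]. Qed.

Let al_notin d g : g \in Near (al d) -> g \notin NS d.
Proof.
move=> /(subsetP (near_NS _)) gd; rewrite (NS_same _ gd) same_sym; exact: same_al.
Qed.

(** A path in [Mid d] from head to tail starts in [Ms d] and ends outside. A step that avoids [NS d]
    stays in [Ms d], so the first step out of it enters [NS d]. *)
Let exit_edge d : fwd d -> exists k : gdart M,
  [&& gvtx k \in NS d, gvtx k \in Mid d & gvtx (gal k) \in Ms d].
Proof.
move=> fd.
have /set0Pn[a] := mid_near_tail fd; rewrite inE => /andP[am an].
have /set0Pn[b] := mid_near_head fd; rewrite inE => /andP[bm bn].
have bI : b \in In d by rewrite inE bm andbT; apply: al_notin.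
have bMs : b \in Ms d.
  by rewrite inE bI; apply/existsP; exists b; rewrite !inE bm bn; exact: connect0.
apply/existsP; rewrite -[X in is_true X]negbK; apply/negP => /existsPn nE.
have /connectP[p pp E] := mid_conn bm am.
have : a \in Ms d.
  rewrite E; elim: p b bMs {bm bn bI E} pp => [|w p IH] v vMs //= /andP[/and3P[_ wM vw] pp].
  apply: IH pp.
  have wN : w \notin NS d.
    apply/negP => wN; move: vw; rewrite gadj_sym => /existsP[k /andP[/eqP kw /eqP kv]].
    by have := nE k; rewrite kw kv wN wM vMs.
  have wI : w \in In d by rewrite inE wN wM.
  move: vMs; rewrite inE => /andP[vI /existsP[b' /andP[h bv]]].
  rewrite inE wI; apply/existsP; exists b'; rewrite h /=.
  by apply: connect_trans bv (connect1 _); rewrite /= vI wI vw.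
by case/Ms_mid => _; rewrite (subsetP (near_NS d)).
Qed.

Let k0 d : gdart M :=
  if pick [pred k | [&& gvtx k \in NS d, gvtx k \in Mid d & gvtx (gal k) \in Ms d]] is Some k
  then k else (ord0, ord0, true, (true, true)).

Let k0P d : fwd d -> [/\ gvtx (k0 d) \in NS d, gvtx (k0 d) \in Mid d & gvtx (gal (k0 d)) \in Ms d].
Proof.
move=> /exit_edge[k kP]; rewrite /k0; case: pickP => [k' /and3P[]//|/(_ k)].
by rewrite /= kP.
Qed.

Let kap d := if fwd d then k0 d else gal (k0 (al d)).

Let kap_al d : kap (al d) = gal (kap d).
Proof. by rewrite /kap fwd_al alK; case: (fwd d); rewrite //= galK. Qed.

Let kap_inj : injective kap.
Proof.
have I d d' : fwd d -> fwd d' -> k0 d = k0 d' -> d = d'.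
  move=> fd fd' E; have [_ h _] := k0P fd; have [_ h' _] := k0P fd'.
  by apply: mid_mid => //; apply: memI h _; rewrite E.
have N d d' : fwd d -> fwd d' -> k0 d <> gal (k0 d').
  move=> fd fd' E; have [_ h _] := k0P fd; have [_ _ /Ms_mid[h' _]] := k0P fd'.
  have dd : d = d' by apply: mid_mid => //; apply: memI h _; rewrite E.
  by move: E; rewrite dd => E; have := gal_neq (k0 d'); rewrite -E eqxx.
move=> d d'; rewrite /kap; case: (boolP (fwd d)) => fd; case: (boolP (fwd d')) => fd'.
- exact: I.
- by move=> /N; case=> //; rewrite fwd_al.
- by move=> /esym/N; case=> //; rewrite fwd_al.
move=> /(can_inj (@galK M))/I E.
by rewrite -[d]alK E ?fwd_al ?alK.
Qed.

Let cls d := [set d' | same d d'].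

Let cls_eq d d' : (cls d == cls d') = same d d'.
Proof.
apply/eqP/idP => [/setP/(_ d')|dd]; first by rewrite !inE same_refl.
apply/setP => e; rewrite !inE; apply/idP/idP; apply: same_trans => //.
by rewrite same_sym.
Qed.

(** The darts whose node absorbs the grid vertex [g]. A set of darts needs no representative and is
    empty for vertices absorbed by no node. It is constant along contracted edges, and so keeps
    distinct nodes apart. *)
Let lab g := [set d' | (g \in NS d') || [exists d, [&& fwd d, g \in Ms d & same (al d) d']]].

Let Ms_NS g e d : fwd e -> g \in Ms e -> g \in NS d -> same (al e) d.
Proof.
move=> fe /Ms_mid[gm gn] /bigcupP[d' dd gd'].
have [E|E] : d' = e \/ d' = al e by apply: mid_near => //; apply: memI gm gd'.
  by case/negP: gn; apply/bigcupP; exists d'; rewrite // E.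
by rewrite same_sym -E.
Qed.

Let lab_NS g d : g \in NS d -> lab g = cls d.
Proof.
move=> gd; apply/setP => d'; rewrite !inE (NS_same _ gd).
apply/orb_idr => /existsP[e /and3P[fe ge ed]].
by apply: same_trans ed; rewrite same_sym; apply: Ms_NS ge gd.
Qed.

Let lab_Ms g e : fwd e -> g \in Ms e -> lab g = cls (al e).
Proof.
move=> fe ge; apply/setP => d; rewrite !inE; apply/orP/idP => [[|]|ed].
- exact: Ms_NS ge.
- move=> /existsP[e' /and3P[fe' ge' ed]].
  have -> // : e = e'.
  by apply: mid_mid => //; have [h _] := Ms_mid ge; have [h' _] := Ms_mid ge'; apply: memI h h'.
by right; apply/existsP; exists e; rewrite fe ge.
Qed.

Let B := [set k : gdart M |
  [exists d, (gvtx k \in NS d) && (gvtx (gal k) \in NS d)] ||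
  [exists d, [&& fwd d, gvtx k \in Ms d & gvtx (gal k) \in Ms d]]].

Let lab_B k : k \in B -> lab (gvtx (gal k)) = lab (gvtx k).
Proof.
rewrite inE => /orP[] /existsP[d]; first by move=> /andP[h h']; rewrite !(@lab_NS _ d).
by move=> /and3P[fd h h']; rewrite !(@lab_Ms _ d).
Qed.

Let lab_connect k k' : connect (contr (galp M) (gsip M) B) k k' -> lab (gvtx k) = lab (gvtx k').
Proof.
have V x : gvtx (gsip M x) = gvtx x by rewrite permE; case: x => -[[i j] s] [ax sg].
case/connectP => p; elim: p k => [|w p IH] k /=; first by move=> _ ->.
move=> /andP[+ pw] E; rewrite -(IH w pw E) /contr /= => /or3P[/eqP->|/eqP->|/andP[kB /eqP->]].
- by rewrite V.
- by rewrite V.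
by rewrite [galp M _]permE lab_B.
Qed.

Let lab_kap d : lab (gvtx (kap d)) = cls d.
Proof.
rewrite /kap; case: (boolP (fwd d)) => fd; first by have [h _ _] := k0P fd; apply: lab_NS.
have fd' : fwd (al d) by rewrite fwd_al.
by have [_ _ h] := k0P fd'; rewrite (lab_Ms fd' h) alK.
Qed.

Let kap_connect d k : gvtx k \in NS d -> connect (contr (galp M) (gsip M) B) (kap d) k.
Proof.
have BN k1 k2 : gvtx k1 \in NS d -> gvtx k2 \in NS d ->
    connect (contr (galp M) (gsip M) B) k1 k2.
  move=> h1 h2; apply: gconn_contr (NS_conn h1 h2) => e he he'.
  by rewrite inE; apply/orP; left; apply/existsP; exists d; rewrite he.
move=> kd; rewrite /kap; case: (boolP (fwd d)) => fd.
  by have [h _ _] := k0P fd; apply: BN.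
have fd' : fwd (al d) by rewrite fwd_al.
have [_ _] := k0P fd'; set g := gal _ => h.
have := h; rewrite inE => /andP[gI /existsP[b /andP[]]].
rewrite inE alK => /andP[bm bn] bg.
pose kb : gdart M := (b, (true, true)).
apply: connect_trans (BN kb k _ kd); last exact: (subsetP (near_NS d)).
have bI : b \in In (al d) by rewrite inE bm andbT al_notin ?alK.
have MsC : gconn (Ms (al d)) b (gvtx g).
  case/connectP: bg => p pp E; rewrite E.
  have : b \in Ms (al d).
    by rewrite inE bI; apply/existsP; exists b; rewrite !inE bm alK bn; exact: connect0.
  elim: p b {bm bn kb bI E} pp => [|w p IH] v /=; first by move=> _ _; exact: connect0.
  move=> /andP[/and3P[vI wI vw] pp] vM.
  have wM : w \in Ms (al d).
    move: vM; rewrite inE => /andP[_ /existsP[b' /andP[hb bv]]].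
    rewrite inE wI; apply/existsP; exists b'; rewrite hb /=.
    by apply: connect_trans bv (connect1 _); rewrite /= vI wI vw.
  by apply: connect_trans (connect1 _) (IH _ pp wM); rewrite /= vM wM vw.
apply: gconn_contr (_ : gconn (Ms (al d)) _ _).
  move=> e he he'; rewrite inE; apply/orP; right; apply/existsP; exists (al d).
  by rewrite fd' he.
by rewrite /gconn gconn_sym.
Qed.

(** In the grid the edges [B] inside nodes are contracted, one edge per segment is kept, and all
    others are deleted. Then the map is transported from the image of [kap] to [HD]. *)
Lemma nerve_map : exists si : {perm HD},
  planar al si /\ forall d d', (d' \in porbit si d) = same d d'.
Proof.
pose K := [set kap d | d : HD].
have gK d : galp M (galp M d) = d by rewrite !permE galK.
have gN d : galp M d != d by rewrite permE gal_neq.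
have cB : closed_set (galp M) B.
  move=> d; rewrite !inE permE galK; congr (_ || _); apply: eq_existsb => e; rewrite andbC //.
  by rewrite andbC [(gvtx (gal d) \in _) && _]andbC.
have KP d : kap d \in K by apply: imset_f.
have cK : closed_set (galp M) K.
  move=> d; rewrite permE; apply/imsetP/imsetP => -[e _ E].
    by exists (al e); rewrite // kap_al -E galK.
  by exists (al e); rewrite // kap_al E.
(* A contracted edge has the same label at both ends, whereas the edge kept for a segment joins two
   different nodes. *)
have dBK : [disjoint B & K].
  rewrite disjoint_sym disjoint_subset; apply/subsetP => _ /imsetP[d _ ->].
  rewrite inE; apply/negP => /lab_B; rewrite -kap_al !lab_kap => /eqP.
  by rewrite cls_eq same_sym (negPf (same_al d)).
have [a' [s' [pl aK fixK orb]]] := planar_minor gK gN (planar_grid M) cB cK dBK.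
have s'K d : exists e, s' (kap d) == kap e.
  have [/imsetP[e _ E]|/fixK[_ h]] := boolP (s' (kap d) \in K); first by exists e; apply/eqP.
  by exists d; apply/eqP/(perm_inj (s := s')).
have nK z : z \notin codom kap -> z \notin K.
  by apply: contraNN => /imsetP[d _ ->]; exact: codom_f.
pose f d := xchoose (s'K d).
have fE d : s' (kap d) = kap (f d) by apply/eqP; exact: xchooseP (s'K d).
have f_inj : injective f.
  by move=> d d' E; apply/kap_inj/(perm_inj (s := s')); rewrite !fE E.
exists (perm f_inj); have sk d : s' (kap d) = kap (perm f_inj d) by rewrite permE fE.
split.
  apply: (planar_restrict kap_inj _ _ _ sk pl) => [z /nK/fixK[]//|z /nK/fixK[]//|d].
  by rewrite kap_al aK ?KP ?permE.
move=> d d'; rewrite -(porbit_restrict kap_inj _ _ sk) orb ?KP //.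
apply/idP/idP => [/lab_connect|dd].
  by rewrite !lab_kap => /eqP; rewrite cls_eq.
have [x xd] : exists x, x \in NS d.
  have : same d d by []; rewrite -near_near setIid => /set0Pn[x xd]; exists x.
  exact: (subsetP (near_NS d)).
pose k : gdart M := (x, (true, true)).
apply: connect_trans (kap_connect (k := k) xd) _.
rewrite (contr_sym _ gK) //; apply: kap_connect.
by rewrite (NS_same _ xd).
Qed.
End Nerve.

(** * Removal of touchings *)

(* The darts of a planarized drawing: a dart is a segment of an edge leaving
   one of its two end nodes, which is a vertex (end_at) or the crossing with
   cross_edge; opp is the continuation of the edge across that crossing, rank
   and forth are the position of the node and the direction along the edge. *)
Record darts (D E V : finType) := Darts {
  edge_of : D -> E; end_at : D -> option V; cross_edge : D -> E;
  opp : D -> D; rank : D -> nat; forth : D -> bool;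
  opp_end : forall d, end_at d = None -> end_at (opp d) = None;
  opp_edge : forall d, end_at d = None -> edge_of (opp d) = edge_of d;
  opp_cross : forall d, end_at d = None -> cross_edge (opp d) = cross_edge d;
  opp_rank : forall d, end_at d = None -> rank (opp d) = rank d;
  opp_forth : forall d, end_at d = None -> forth (opp d) = ~~ forth d;
  oppK : forall d, end_at d = None -> opp (opp d) = d;
  cross_neq : forall d, end_at d = None -> cross_edge d != edge_of d;
  cross_unique : forall d d', end_at d = None -> end_at d' = None ->
    edge_of d = edge_of d' -> cross_edge d = cross_edge d' -> d' = d \/ d' = opp d;
  end_unique : forall d d' v, end_at d = Some v -> end_at d' = Some v ->
    edge_of d = edge_of d' -> d = d';
  no_parallel : forall d1 d2 d1' d2' v v', end_at d1 = Some v -> end_at d2 = Some v ->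
    end_at d1' = Some v' -> end_at d2' = Some v' -> edge_of d1 = edge_of d1' ->
    edge_of d2 = edge_of d2' -> edge_of d1 <> edge_of d2 -> v = v';
  adj_no_cross : forall d1 d2 d v, end_at d1 = Some v -> end_at d2 = Some v ->
    end_at d = None -> edge_of d = edge_of d1 -> cross_edge d = edge_of d2 -> False;
  no_triple : forall d d' d'', end_at d = None -> end_at d' = None -> end_at d'' = None ->
    edge_of d' = cross_edge d -> edge_of d'' = edge_of d ->
    cross_edge d'' = cross_edge d' -> False }.

(** [A] is the set of darts still present, while the data [X] stay fixed when touchings are removed.
    [emb_cross] prescribes the four darts at a crossing but not their cyclic order. *)
Record embedded (D E V : finType) (X : darts D E V) (A : {set D}) (al si : {perm D}) : Prop :=
  Embedded {
  emb_planar : planar al si;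
  emb_fix : forall d, d \notin A -> al d = d /\ si d = d;
  emb_al : forall d, d \in A -> [/\ al d \in A, al (al d) = d, edge_of X (al d) = edge_of X d,
    forth X (al d) = ~~ forth X d & forth X d -> rank X d < rank X (al d)];
  emb_si : forall d, d \in A -> si d \in A;
  emb_end : forall d v, end_at X d = Some v -> d \in A;
  emb_vertex : forall d d' v, end_at X d = Some v -> end_at X d' = Some v -> d' \in porbit si d;
  emb_si_end : forall d v, end_at X d = Some v -> end_at X (si d) = Some v;
  emb_cross : forall d, d \in A -> end_at X d = None -> exists d', [/\ end_at X d' = None,
    edge_of X d' = cross_edge X d, cross_edge X d' = edge_of X d &
    porbit si d = [set d; opp X d; d'; opp X d']] }.

Lemma porbit_agree (D : finType) (s s' : {perm D}) d :
  {in porbit s d, s' =1 s} -> porbit s' d = porbit s d.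
Proof.
move=> h; have E i : (s' ^+ i)%g d = (s ^+ i)%g d.
  elim: i => [|i IH]; first by rewrite !perm1.
  by rewrite !expgSr !permM IH h // -/(aperm d (s ^+ i)) mem_porbit.
by apply/setP => y; apply/porbitP/porbitP => -[i ->]; exists i.
Qed.

(** Suppression of a node of degree 2. Moving the transposition of [a] and [a'] from [s] to [al]
    keeps the product, makes both darts fixed points of [s] and splices the two segments; then [a]
    and [a'] are skipped in [al]. *)
Lemma smooth (D : finType) (al s : {perm D}) a a' :
  a != a' -> planar al s -> s a = a' -> s a' = a -> al (al a) = a -> al (al a') = a' ->
  al a != a -> al a != a' -> al a' != a -> al a' != a' ->
  exists al' s' : {perm D}, [/\ planar al' s',
    forall x, s' x = (if (x == a) || (x == a') then x else s x) &
    forall x, al' x = (if (x == a) || (x == a') then x else if x == al a then al a'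
       else if x == al a' then al a else al x)].
Proof.
move=> n0 pl sa sa' ala ala' n1 n2 n3 n4.
have aP : a \in porbit s a' by rewrite -sa' porbit_step.
have p1 := planar_shift_r pl aP.
exists (skip a' (skip a (al * tperm a a')%g)), (tperm a a' * s)%g; split.
- by apply: planar_skip_l; apply: planar_skip_l.
- move=> x; rewrite permM; case: tpermP => [->|->|/eqP/negPf-> /eqP/negPf-> //].
    by rewrite eqxx sa'.
  by rewrite eqxx orbT sa.
have al1 x : (al * tperm a a')%g x = if x == al a then a' else if x == al a' then a else al x.
  rewrite permM; case: tpermP => [E|E|/eqP n5 /eqP n6].
  - have -> : x = al a by apply: (perm_inj (s := al)); rewrite ala.
    by rewrite eqxx.
  - have -> : x = al a' by apply: (perm_inj (s := al)); rewrite ala'.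
    rewrite eqxx (inj_eq perm_inj); case: eqP => // E'; by rewrite E' in n5; rewrite E eqxx in n5.
  by do 2! (case: eqP => [E|_]; first by rewrite E ?ala ?ala' eqxx in n5 n6).
have a_al x : (a == al x) = (x == al a).
  apply/eqP/eqP => [E|->]; last by rewrite ala.
  by apply: (perm_inj (s := al)); rewrite -E ala.
have pp : al a == al a' = false by rewrite (inj_eq perm_inj) (negPf n0).
have a_al' x : (a' == al x) = (x == al a').
  apply/eqP/eqP => [E|->]; last by rewrite ala'.
  by apply: (perm_inj (s := al)); rewrite -E ala'.
have N1 := negPf n1; have N2 := negPf n2; have N3 := negPf n3; have N4 := negPf n4.
have N0 := negPf n0; have N0' : (a' == a) = false by rewrite eq_sym.
move=> x; rewrite !skipE !al1.
have [->|xa] := eqVneq x a.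
  by rewrite ![a == al _]eq_sym N1 N3 N0 /=.
have [->|xa'] := eqVneq x a'; first by rewrite orbT.
have [->|xp] := eqVneq x (al a).
  by rewrite /= N0' ![a == al _]eq_sym N1 N3 !eqxx ?ala ![a' == al _]eq_sym N2 N4 N3.
have [->|xp'] := eqVneq x (al a').
  by rewrite /= eqxx ![a == al _]eq_sym N1 N3 ![a' == al _]eq_sym N2.
have E1 : (al x == a) = false by rewrite eq_sym a_al (negPf xp).
have E2 : (al x == a') = false by rewrite eq_sym a_al' (negPf xp').
by rewrite E1 E2.
Qed.

Section Touch.
Variables (D E V : finType) (X : darts D E V).
Notation edg := (edge_of X).
Notation endv := (end_at X).
Notation opp := (opp X).
Notation rk := (rank X).
Notation fw := (forth X).

(** One clause of [embedded] on its own, since it has to be followed through the intermediate map in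
    which only one of two touching edges has been spliced. *)
Definition good_edges (A : {set D}) (al : {perm D}) :=
  forall d, d \in A -> [/\ al d \in A, al (al d) = d, edg (al d) = edg d,
    fw (al d) = ~~ fw d & fw d -> rk d < rk (al d)].

Lemma opp_neq d : endv d = None -> opp d != d.
Proof.
by move=> dN; apply/eqP => E'; have := opp_forth dN; rewrite E'; case: (fw d).
Qed.

Lemma good_edges_neq A al a : good_edges A al -> a \in A -> opp a \in A -> endv a = None ->
  [/\ al a != a, al a != opp a, al (opp a) != a & al (opp a) != opp a].
Proof.
move=> gA aA oA aN; have [_ ala _ fa ra] := gA a aA; have [_ alo _ fo ro] := gA _ oA.
have n1 : al a != a by apply/eqP => E'; move: fa; rewrite E'; case: (fw a).
have n4 : al (opp a) != opp a by apply/eqP => E'; move: fo; rewrite E'; case: (fw _).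
have n2 : al a != opp a.
  apply/eqP => E'; have E2 : al (opp a) = a by rewrite -E' ala.
  rewrite E' opp_rank // in ra; rewrite E2 opp_rank // opp_forth // in ro.
  by case: (fw a) ra ro => [/(_ isT)|_ /(_ isT)]; rewrite ltnn.
by split=> //; apply/eqP => E'; case/eqP: n2; rewrite -{1}E' alo.
Qed.

(** The ranks of the ends of the spliced segment are compared through the rank of the suppressed
    node, where the edge kept its direction. *)
Lemma good_edges_smooth A (al al' : {perm D}) a : good_edges A al -> a \in A -> opp a \in A ->
  endv a = None ->
  (forall x, al' x = (if (x == a) || (x == opp a) then x else if x == al a then al (opp a)
       else if x == al (opp a) then al a else al x)) ->
  good_edges (A :\: [set a; opp a]) al'.
Proof.
move=> gA aA oA aN al'E d; rewrite !inE negb_or => /andP[/andP[da do'] dA].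
have [n1 n2 n3 n4] := good_edges_neq gA aA oA aN.
have [pA ala ea fa ra] := gA a aA; have [qA alo eo fo ro] := gA _ oA.
have alI := inj_eq (@perm_inj _ al).
have npq : al a != al (opp a) by rewrite alI eq_sym opp_neq.
have X1 := opp_forth aN; have X2 := opp_rank aN; have X3 := opp_edge aN.
rewrite !al'E (negPf da) (negPf do') /=.
have [->|dp] := eqVneq d (al a).
  rewrite (negPf n3) (negPf n4) /= eq_sym (negPf npq) eqxx qA; split=> //.
  - by rewrite eo ea.
  - by rewrite fo fa X1.
  rewrite fa => nf; have [_ _ _ _] := gA _ pA; rewrite ala fa => /(_ nf); rewrite -X2 => h.
  by apply: ltn_trans h (ro _); rewrite X1.
have [->|dq] := eqVneq d (al (opp a)).
  rewrite (negPf n1) (negPf n2) /= eqxx pA; split=> //.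
  - by rewrite eo ea.
  - by rewrite fo fa X1 negbK.
  rewrite fo X1 negbK => f; have [_ _ _ _] := gA _ qA; rewrite alo fo X1 negbK => /(_ f).
  by rewrite X2 => h; apply: ltn_trans h (ra _).
have [h1 h2 h3 h4 h5] := gA d dA.
have a1 : al d != a by apply: contraNneq dp => E'; rewrite -E' h2.
have a2 : al d != opp a by apply: contraNneq dq => E'; rewrite -E' h2.
by rewrite (negPf a1) (negPf a2) /= !alI (negPf da) (negPf do') h1.
Qed.

Lemma touch_orbit A al si a : embedded X A al si -> a \in A -> endv a = None -> si a = opp a ->
  exists b, [/\ b \in A, endv b = None, edg b != edg a &
    [/\ si (opp a) = b, si b = opp b, si (opp b) = a & porbit si a = [set a; opp a; b; opp b]]].
Proof.
move=> em aA aN sa; have [d [dN de dc orb]] := emb_cross em aA aN.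
have ne : edg d != edg a by rewrite de cross_neq.
have oa := opp_neq aN; have od := opp_neq dN.
have e1 : edg (opp a) = edg a by rewrite opp_edge.
have e2 : edg (opp d) = edg d by rewrite opp_edge.
have D1 : d != a by apply: contraNneq ne => ->.
have D2 : d != opp a by apply: contraNneq ne => ->; rewrite e1.
have D3 : opp d != a by apply: contraNneq ne => <-; rewrite e2.
have D4 : opp d != opp a by apply: contraNneq ne => E'; rewrite -e1 -E' e2.
have card4 : #|porbit si a| = 4.
  rewrite orb -!setUA !cardsU1 !inE !negb_or !(eq_sym (opp a)) !(eq_sym a) cards1.
  by rewrite D1 D2 D3 D4 oa (eq_sym d) od.
have U := uniq_traject_porbit si a; have I := iter_porbit si a.
move: U I; rewrite card4 /= !inE !negb_or => U I.
have stp x : x \in porbit si a -> si x \in porbit si a.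
  by move=> xa; apply: porbit_trans xa (porbit_step si x).
have bO : si (si a) \in porbit si a by apply: (stp); apply: (stp); exact: porbit_id.
have cO : si (si (si a)) \in porbit si a by exact: stp.
have bA : si (si a) \in A by do 2! apply: (emb_si em).
move: bO cO; rewrite orb !inE -!orbA.
case/and4P: U => /and3P[u1 u2 u3] /andP[u4 u5] u6 _.
rewrite sa in u2 u3 u4 u5 u6 I bA *.
rewrite ![_ == a]eq_sym (negPf u2) (negPf u3) /= ![_ == opp a]eq_sym (negPf u4) (negPf u5) /=.
case/orP=> /eqP bE; case/orP=> /eqP cE.
- by move: u6; rewrite cE bE eqxx.
- exists d; rewrite -{1}bE; split=> //; split=> //.
  + by rewrite -bE cE bE.
  + by rewrite -cE I.
- exists (opp d); rewrite -{1}bE oppK // opp_end // e2; split=> //; split=> //.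
  + by rewrite -bE cE.
  + by rewrite -cE I.
  by apply/setP => x; rewrite !inE orbAC.
- by move: u6; rewrite cE bE eqxx.
Qed.

(** The cyclic order at the node is [a], [opp a], [b], [opp b]. Splitting it between the two edges
    leaves two nodes of degree 2, and both are suppressed. Four darts disappear and all other nodes
    keep their cyclic order. *)
Lemma remove_touch A al si a : embedded X A al si -> a \in A -> endv a = None ->
  si a = opp a -> exists (A' : {set D}) al' si', #|A'| < #|A| /\ embedded X A' al' si'.
Proof.
move=> em aA aN sa; have [b [bA bN ne [sa' sb sb' orb]]] := touch_orbit em aA aN sa.
have gA : good_edges A al := emb_al em.
have oA : opp a \in A by rewrite -sa (emb_si em).
have obA : opp b \in A by rewrite -sb (emb_si em).
have [n1 n2 n3 n4] := good_edges_neq gA aA oA aN.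
have [m1 m2 m3 m4] := good_edges_neq gA bA obA bN.
have oa := opp_neq aN; have ob := opp_neq bN.
have [pA ala ea _ _] := gA a aA; have [qA alo eo _ _] := gA _ oA.
have [rA alb eb _ _] := gA b bA; have [tA alob eob _ _] := gA _ obA.
have ab x y : edg x = edg a -> edg y = edg b -> (y == x) = false.
  by move=> ex ey; apply/negbTE; apply: contraNneq ne => xy; rewrite -ex -ey xy.
have ab' x y : edg x = edg a -> edg y = edg b -> (x == y) = false.
  by move=> ex ey; rewrite eq_sym ab.
have eoa := opp_edge aN; have eobb := opp_edge bN.
have eao : edg (al (opp a)) = edg a by rewrite eo eoa.
have ebo : edg (al (opp b)) = edg b by rewrite eob eobb.
pose R x (ex : edg x = edg a) := (ab x b ex erefl, ab x (opp b) ex eobb, ab x (al b) ex eb,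
  ab x (al (opp b)) ex ebo, ab' x b ex erefl, ab' x (opp b) ex eobb, ab' x (al b) ex eb,
  ab' x (al (opp b)) ex ebo).
pose N := (R a erefl, R (opp a) eoa, R (al a) ea, R (al (opp a)) eao).
have ao : (a == opp a) = false by rewrite eq_sym (negPf oa).
have bo : (b == opp b) = false by rewrite eq_sym (negPf ob).
have p0 : planar al (si * tperm a b)%g.
  apply: planar_tperm_r (emb_planar em) _.
  by rewrite porbit_sym orb !inE eqxx !orbT.
have s0 x : (si * tperm a b)%g x = if x == a then opp a else if x == opp a then a
    else if x == b then opp b else if x == opp b then b else si x.
  rewrite permM; have [->|xa] := eqVneq x a; first by rewrite sa tpermD ?N ?ao.
  have [->|xa'] := eqVneq x (opp a); first by rewrite sa' tpermR.
  have [->|xb] := eqVneq x b; first by rewrite sb tpermD ?N ?bo.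
  have [->|xb'] := eqVneq x (opp b); first by rewrite sb' tpermL.
  by rewrite tpermD //; [rewrite -[X in X != _]sb'|rewrite -[X in X != _]sa'];
    rewrite (inj_eq perm_inj) eq_sym.
have [|||al1 [s1 [p1 s1E al1E]]] := smooth (a := a) (a' := opp a) _ p0 _ _ ala alo n1 n2 n3 n4.
- by rewrite ao.
- by rewrite s0 eqxx.
- by rewrite s0 (negPf oa) eqxx.
have al1b x : edg x = edg b -> al1 x = al x.
  by move=> ex; rewrite al1E (ab a x) ?(ab (opp a) x) ?(ab (al a) x) ?(ab (al (opp a)) x).
have g1 := good_edges_smooth gA aA oA aN al1E.
have bA1 : b \in A :\: [set a; opp a] by rewrite !inE !N.
have obA1 : opp b \in A :\: [set a; opp a] by rewrite !inE !N.
have [|||||||||al2 [s2 [p2 s2E al2E]]] := smooth (a := b) (a' := opp b) _ p1 _ _ _ _ _ _ _ _.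
- by rewrite bo.
- by rewrite s1E !N /= s0 !N /= eqxx.
- by rewrite s1E !N /= s0 !N /= (negPf ob) eqxx.
- by rewrite !al1b ?eb ?alb.
- by rewrite !al1b ?eob ?eobb ?alob.
- by rewrite al1b.
- by rewrite al1b.
- by rewrite al1b ?eobb.
- by rewrite al1b ?eobb.
have g2 := good_edges_smooth g1 bA1 obA1 bN al2E.
set A2 := _ :\: _ in g2.
have A2E d : (d \in A2) = (d \in A) && (d \notin porbit si a).
  by rewrite /A2 orb !inE !negb_or; case: (d \in A); rewrite ?andbT ?andbF //= -!andbA; do 4! case: (_ == _).
have s2si d : d \notin porbit si a -> s2 d = si d.
  rewrite orb !inE !negb_or -!andbA => /and4P[/negPf d1 /negPf d2 /negPf d3 /negPf d4].
  by rewrite s2E d3 d4 /= s1E d1 d2 /= s0 d1 d2 d3 d4.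
have orb2 d : d \notin porbit si a -> porbit s2 d = porbit si d.
  move=> dn; apply: porbit_agree => x xd; apply: s2si; apply: contraNN dn => xa.
  by apply: porbit_trans xa _; rewrite porbit_sym.
have en d v : endv d = Some v -> d \notin porbit si a.
  move=> dv; rewrite orb !inE -!orbA; apply/negP => /or4P[] /eqP E'; move: dv; rewrite E' ?opp_end ?aN ?bN //.
exists A2, al2, s2; split.
  apply/proper_card/properP; split; first by apply/subsetP => d; rewrite A2E => /andP[].
  by exists a; rewrite // A2E porbit_id andbF.
split=> //.
- move=> d; rewrite A2E negb_and negbK => h.
  have [da|dn] := boolP (d \in porbit si a).
    move: da; rewrite orb !inE -!orbA => /or4P[] /eqP->.
    + by rewrite s2E al2E (al1b b) // (al1b (opp b)) // !N /= s1E al1E !eqxx.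
    + by rewrite s2E al2E (al1b b) // (al1b (opp b)) // !N /= s1E al1E !eqxx orbT.
    + by rewrite s2E al2E !eqxx.
    + by rewrite s2E al2E !eqxx orbT.
  have dA : d \notin A by rewrite (negPf dn) orbF in h.
  have [ad sd] := emb_fix em dA; rewrite s2si // sd; split=> //.
  have nA x : x \in A -> (d == x) = false by move=> xA; apply: contraNF dA => /eqP->.
  by rewrite al2E (al1b b) // (al1b (opp b)) // !nA //= al1E !nA.
- move=> d; rewrite !A2E => /andP[dA dn]; rewrite s2si // (emb_si em) //=.
  apply: contraNN dn => h; apply: porbit_trans h _; rewrite porbit_sym; exact: porbit_step.
- by move=> d v dv; rewrite A2E (emb_end em dv) (en _ _ dv).
- by move=> d d' v dv dv'; rewrite orb2 ?(en _ _ dv) //; apply: emb_vertex em _ _ _ dv dv'.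
- by move=> d v dv; rewrite s2si ?(en _ _ dv) //; apply: (emb_si_end em).
move=> d; rewrite A2E => /andP[dA dn] dN; have [d' h] := emb_cross em dA dN.
by exists d'; rewrite orb2.
Qed.

Lemma remove_touches A al si : embedded X A al si ->
  exists (A' : {set D}) al' si', embedded X A' al' si' /\
    forall d, d \in A' -> endv d = None -> si' (si' d) = opp d.
Proof.
move cA : #|A| => m; elim/ltn_ind: m A al si cA => m IH A al si cA em.
have [/existsP[a /and3P[aA /eqP aN /eqP sa]]|] :=
    boolP [exists a, [&& a \in A, endv a == None & si a == opp a]].
  have [A' [al' [si' [lt em']]]] := remove_touch em aA aN sa.
  by rewrite cA in lt; apply: IH lt _ _ _ (erefl _) em'.
move=> /existsPn nt; exists A, al, si; split=> // d dA dN.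
have notouch x : x \in A -> endv x = None -> si x != opp x.
  by move=> xA xN; have := nt x; rewrite xA xN eqxx.
have [d' [dN' de dc orb]] := emb_cross em dA dN.
have ne : edg d' != edg d by rewrite de cross_neq.
have od := opp_neq dN; 
have sA := emb_si em dA.
have sO : si d \in porbit si d by exact: porbit_step.
have ssO : si (si d) \in porbit si d by apply: porbit_trans sO (porbit_step _ _).
have ns : si d != d.
  apply/eqP => sd; have : d' \in porbit si d by rewrite orb !inE eqxx orbT.
  by rewrite porbit_fix // => /eqP E'; move: ne; rewrite E' eqxx.
have [sdN soN sE] : [/\ endv (si d) = None, opp (si d) \in [set d'; opp d'] & si d \in [set d'; opp d']].
  move: sO; rewrite orb !inE -!orbA (negPf ns) (negPf (notouch d dA dN)) /=.
  by case/orP=> /eqP->; rewrite ?oppK ?opp_end ?eqxx ?orbT.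
have sso := notouch _ sA sdN.
have ssd : si (si d) != si d by rewrite (inj_eq perm_inj).
(* Otherwise the node would consist of [d] and [si d] alone and miss [opp d]. *)
have back : si (si d) != d.
  apply/eqP => sd; have sub y : y \in porbit si d -> y \in [set d; si d].
    move=> yd; suff /implyP : (d \in [set d; si d]) ==> (y \in [set d; si d]).
      by apply; rewrite !inE eqxx.
    apply: (porbit_sub (r := fun x y => (x \in [set d; si d]) ==> (y \in [set d; si d]))) yd.
    - by move=> x; apply/implyP.
    - by move=> x z w /implyP h /implyP h'; apply/implyP => /h.
    by move=> x; apply/implyP; rewrite !inE => /orP[] /eqP->; rewrite ?sd eqxx ?orbT.
  have : opp d \in [set d; si d] by apply: sub; rewrite orb !inE eqxx !orbT.
  by rewrite !inE (negPf od) /= eq_sym (negPf (notouch d dA dN)).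
have d12 : [set d'; opp d'] = [set si d; opp (si d)].
  move: sE; rewrite !inE => /orP[] /eqP E'; rewrite E' ?oppK //; by rewrite setUC.
have : si (si d) \notin [set d'; opp d'].
  by rewrite d12 !inE negb_or ssd.
move: ssO; rewrite orb !inE -!orbA (negPf back) /= => /orP[/eqP //|].
by move=> ->.
Qed.
End Touch.

(** * The planarization of a drawing *)

Section Drawing.
Variables (n : nat) (e : rel 'I_n) (pos : 'I_n -> pt3) (arc : 'I_n * 'I_n -> R -> pt3).
Hypothesis drawing : is_drawing e pos arc.
Hypothesis simple : simple_drawing e arc.
Hypothesis quasi : quasiplanar_drawing e arc.

Let E := {x : 'I_n * 'I_n | is_edge e x}.
Let crv (x : E) := arc (val x).
Implicit Types (x y z : E).

Lemma crv_sphere x : sphere01 (crv x).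
Proof. by case: drawing => _ [_ [h _]]; case: (h _ (valP x)) => -[]. Qed.

Lemma crv_cont x : continuous01 (crv x).
Proof. by case: drawing => _ [_ [h _]]; case: (h _ (valP x)) => -[_ []]. Qed.

Lemma crv_inj x s t : (0 <= s <= 1)%R -> (0 <= t <= 1)%R -> crv x s = crv x t -> s = t.
Proof. by case: drawing => _ [_ [h _]]; case: (h _ (valP x)) => -[_ [_ H]] _; exact: H. Qed.

Lemma crv0 x : crv x 0%R = pos (val x).1.
Proof. by case: drawing => _ [_ [h _]]; case: (h _ (valP x)) => _ []. Qed.

Lemma crv1 x : crv x 1%R = pos (val x).2.
Proof. by case: drawing => _ [_ [h _]]; case: (h _ (valP x)) => _ []. Qed.

Lemma crv_pos x t w : (0 < t < 1)%R -> crv x t <> pos w.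
Proof. by case: drawing => _ [_ [_ [h _]]]; exact: h (valP x). Qed.

Lemma pos_inj : injective pos.
Proof. by case: drawing => _ []. Qed.

Lemma crv_triple x y z t s r : x != y -> y != z -> x != z -> (0 < t < 1)%R ->
  (0 < s < 1)%R -> (0 < r < 1)%R -> crv x t = crv y s -> crv y s = crv z r -> False.
Proof.
case: drawing => _ [_ [_ [_ [_ [_ h]]]]] xy yz xz; apply: h; try exact: valP.
all: by apply/eqP; rewrite (inj_eq val_inj).
Qed.

Lemma crv_end t : (0 <= t <= 1)%R -> ~ (0 < t < 1)%R -> t = 0%R \/ t = 1%R.
Proof. lra. Qed.

Definition cross x y := (x != y) && pb (crosses (crv x) (crv y)).

Lemma cross_sym x y : cross x y = cross y x.
Proof.
rewrite /cross eq_sym; congr (_ && _); apply/pbP/pbP => -[t [s [h1 [h2 h3]]]];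
  by exists s, t.
Qed.

Definition par x y : R :=
  epsilon (inhabits 0%R) (fun t => (0 < t < 1)%R /\ exists s, (0 < s < 1)%R /\ crv x t = crv y s).

Lemma parP x y : cross x y ->
  (0 < par x y < 1)%R /\ exists s, (0 < s < 1)%R /\ crv x (par x y) = crv y s.
Proof.
move=> /andP[_ /pbP[t [s [h1 [h2 h3]]]]].
by apply: (epsilon_spec (inhabits 0%R) (fun t => (0 < t < 1)%R /\ exists s, (0 < s < 1)%R /\ crv x t = crv y s)); exists t; split=> //; exists s.
Qed.

Lemma par_unique x y s t : cross x y -> (0 <= s <= 1)%R -> (0 <= t <= 1)%R ->
  crv x s = crv y t -> s = par x y.
Proof.
move=> xy hs ht st; have [p01 [r [r01 E']]] := parP xy.
have nxy : val x <> val y by case/andP: xy => /eqP xy _ /val_inj.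
apply: (@crv_inj x) => //; first by split; lra.
by apply: (simple (valP x) (valP y) nxy) st E' => //; split; lra.
Qed.

Lemma crv_par x y : cross x y -> crv x (par x y) = crv y (par y x).
Proof.
move=> xy; have [p01 [r [r01 E']]] := parP xy; rewrite E'; congr (crv y _).
by apply: (@par_unique y x r (par x y)); rewrite 1?cross_sym //; lra.
Qed.

Lemma par_inj x y z : cross x y -> cross x z -> par x y = par x z -> y = z.
Proof.
move=> xy xz E'; apply/eqP; rewrite -[_ == _]negbK; apply/negP => yz.
have [p01 [r [r01 E1]]] := parP xy; have [q01 [r' [r01' E2]]] := parP xz.
apply: (@crv_triple x y z (par x y) r r') => //; try by [case/andP: xy|case/andP: xz].
by rewrite -E1 E' E2.
Qed.

Let leP x : rel E := fun y z => pb (par x y <= par x z)%R.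

Definition crs x := sort (leP x) [seq y <- enum {: E} | cross x y].

Lemma mem_crs x y : (y \in crs x) = cross x y.
Proof. by rewrite mem_sort mem_filter mem_enum andbT. Qed.

Lemma uniq_crs x : uniq (crs x).
Proof. by rewrite sort_uniq filter_uniq ?enum_uniq. Qed.

Lemma size_crs x : size (crs x) <= #|{: E}|.
Proof. by rewrite size_sort size_filter cardE count_size. Qed.

(** Node 0 is the start of the edge, node [(size (crs x)).+1] its end, and the nodes between are the
    crossings in their order along the edge. *)
Definition tp x (k : nat) : R :=
  if k == 0 then 0%R else if k == (size (crs x)).+1 then 1%R else par x (nth x (crs x) k.-1).

Lemma tp0 x : tp x 0 = 0%R. Proof. by []. Qed.

Lemma tp1 x : tp x (size (crs x)).+1 = 1%R.
Proof. by rewrite /tp /= eqxx. Qed.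

Lemma tp_cross x k : 0 < k -> k <= size (crs x) ->
  cross x (nth x (crs x) k.-1) /\ tp x k = par x (nth x (crs x) k.-1).
Proof.
move=> k0 km; split; first by rewrite -mem_crs mem_nth // prednK.
by rewrite /tp -[k == 0]negbK -lt0n k0 /= ltn_eqF.
Qed.

Lemma tp_index x y : cross x y -> let k := (index y (crs x)).+1 in
  [/\ k <= size (crs x), tp x k = par x y & nth x (crs x) k.-1 = y].
Proof.
rewrite -mem_crs => yx k; have km : k <= size (crs x) by rewrite /k index_mem.
have E' : nth x (crs x) k.-1 = y by rewrite nth_index.
by have [_ ->] := tp_cross (isT : 0 < k) km; rewrite E'.
Qed.

(** Sorting gives only the weak inequality; strictness holds because three edges never meet at one
    crossing. *)
Lemma tp_mono x k l : k < l -> l <= (size (crs x)).+1 -> (tp x k < tp x l)%R.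
Proof.
move=> kl lm; have inn j : 0 < j -> j <= size (crs x) -> (0 < tp x j < 1)%R.
  by move=> j0 jm; have [/parP[h _] ->] := tp_cross j0 jm.
have [k0|k0] := posnP k; have [lE|nl] := eqVneq l (size (crs x)).+1.
- rewrite k0 lE tp0 tp1; lra.
- have lm' : l <= size (crs x) by rewrite -ltnS ltn_neqAle nl.
  by rewrite k0 tp0; have := inn l (leq_ltn_trans (leq0n k) kl) lm'; lra.
- have km : k <= size (crs x) by rewrite -ltnS -lE.
  by rewrite lE tp1; have := inn k k0 km; lra.
have lm' : l <= size (crs x) by rewrite -ltnS ltn_neqAle nl.
have [xk Ek] := tp_cross k0 (ltnW (leq_trans kl lm')).
have [xl El] := tp_cross (leq_ltn_trans (leq0n _) kl) lm'.
have l0 : 0 < l by apply: leq_ltn_trans kl.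
have k1 : k.-1 < size (crs x) by rewrite prednK // ltnW // (leq_trans kl).
have l1 : l.-1 < size (crs x) by rewrite prednK.
have le : leP x (nth x (crs x) k.-1) (nth x (crs x) l.-1).
  have tr : transitive (leP x) by move=> a b c /pbP h /pbP h'; apply/pbP; lra.
  have rf : reflexive (leP x) by move=> a; apply/pbP; lra.
  have st : sorted (leP x) (crs x).
    apply: sort_sorted => a b; apply/orP.
    by have [h|h] := Rle_lt_dec (par x a) (par x b); [left|right]; apply/pbP; lra.
  by apply: (sorted_leq_nth tr rf x st); rewrite ?inE // -!subn1 leq_sub2r // ltnW.
move/pbP: le; rewrite Ek El => le.
suff : par x (nth x (crs x) k.-1) <> par x (nth x (crs x) l.-1) by lra.
move=> /(par_inj xk xl)/eqP; rewrite nth_uniq ?uniq_crs // => /eqP.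
by move: kl k0; clear; lia.
Qed.

Lemma tp_01 x k : k <= (size (crs x)).+1 -> (0 <= tp x k <= 1)%R.
Proof.
move=> km; split.
  have [->|k0] := posnP k; first by rewrite tp0; lra.
  by have := tp_mono k0 km; rewrite tp0; lra.
have [->|k0] := eqVneq k (size (crs x)).+1; first by rewrite tp1; lra.
have km' : k < (size (crs x)).+1 by rewrite ltn_neqAle k0.
by have := tp_mono km' (leqnn _); rewrite tp1; lra.
Qed.

Lemma tp_le x k l : k <= l -> l <= (size (crs x)).+1 -> (tp x k <= tp x l)%R.
Proof.
by rewrite leq_eqVlt => /orP[/eqP->|kl lm]; [lra|left; exact: tp_mono].
Qed.

Lemma meet_tp x y s t : x != y -> (0 <= s <= 1)%R -> (0 <= t <= 1)%R ->
  crv x s = crv y t -> exists2 k, k <= (size (crs x)).+1 & s = tp x k.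
Proof.
move=> xy hs ht st.
have [hs'|/(crv_end hs)[->|->]] := classic (0 < s < 1)%R; last first.
- by exists (size (crs x)).+1; rewrite ?tp1.
- by exists 0.
have [ht'|/(crv_end ht)[E'|E']] := classic (0 < t < 1)%R; last first.
- by move: st; rewrite E' crv1 => /(crv_pos hs').
- by move: st; rewrite E' crv0 => /(crv_pos hs').
have xyc : cross x y by rewrite /cross xy; apply/pbP; exists s, t.
have [km Ek _] := tp_index xyc; exists (index y (crs x)).+1; first exact: leqW.
by rewrite Ek; apply: par_unique st.
Qed.

(** Segment [i] of an edge runs from node [i] to node [i.+1]; the bit tells whether the dart leaves
    its far end, whence the position [ix d + bk d] of its node. The ordinal is bounded by the number
    of all edges only to make the type finite. *)
Definition hdart := {d : E * 'I_(#|{: E}|.+1) * bool | d.1.2 <= size (crs d.1.1)}.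
Implicit Types (d : hdart).

Definition eo d : E := (val d).1.1.
Definition ix d : nat := (val d).1.2.
Definition bk d : bool := (val d).2.
Definition ps d : nat := ix d + bk d.

Lemma ix_le d : ix d <= size (crs (eo d)).
Proof. exact: (valP d). Qed.

Lemma ps_le d : ps d <= (size (crs (eo d))).+1.
Proof. by rewrite /ps; have := ix_le d; case: (bk d); lia. Qed.

Lemma hdart_eq d d' : eo d = eo d' -> ix d = ix d' -> bk d = bk d' -> d = d'.
Proof.
move=> h1 h2 h3; apply: val_inj; move: h1 h2 h3; rewrite /eo /ix /bk.
by case: (val d) (val d') => -[x i] b [[x' i'] b'] /= -> /val_inj -> ->.
Qed.

Lemma hdart_ex x i b : i <= size (crs x) -> exists d, [/\ eo d = x, ix d = i & bk d = b].
Proof.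
move=> im; have iN : i < #|{: E}|.+1 by rewrite ltnS (leq_trans im) ?size_crs.
have h : (x, Ordinal iN, b).1.2 <= size (crs (x, Ordinal iN, b).1.1) by [].
by exists (exist _ (x, Ordinal iN, b) h).
Qed.

Definition hal d : hdart := exist _ (eo d, (val d).1.2, ~~ bk d) (valP d).

Lemma halK d : hal (hal d) = d.
Proof. by apply: hdart_eq => //=; rewrite /bk /= negbK. Qed.

Definition halp : {perm hdart} := perm (can_inj halK).

Definition hpt d := crv (eo d) (tp (eo d) (ps d)).
Definition same d d' := pb (hpt d = hpt d').

Let lo d := tp (eo d) (ix d).
Let hi d := tp (eo d) (ix d).+1.

Lemma lohi d : (lo d < hi d)%R.
Proof. by apply: tp_mono => //; rewrite ltnS ix_le. Qed.

Lemma lo_ge0 d : (0 <= lo d)%R.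
Proof. by have [] := @tp_01 (eo d) (ix d) (leqW (ix_le d)). Qed.

Lemma hi_le1 d : (hi d <= 1)%R.
Proof. by have [] := @tp_01 (eo d) (ix d).+1 (ix_le d). Qed.

(** Segments are cut into thirds: [(d, true)] is the third next to the node of [d] and [(d, false)]
    the middle third. Neighbouring thirds share an end point, so the middle piece meets both outer
    ones. *)
Let plo (j : hdart * bool) : R := let '(d, nr) := j in
  if nr then (if bk d then (lo d + 2 * hi d) / 3 else lo d)%R else ((2 * lo d + hi d) / 3)%R.
Let phi (j : hdart * bool) : R := let '(d, nr) := j in
  if nr then (if bk d then hi d else (2 * lo d + hi d) / 3)%R else ((lo d + 2 * hi d) / 3)%R.
Let piece (j : hdart * bool) (t : R) := crv (eo j.1) (plo j + t * (phi j - plo j))%R.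

Lemma plo_bounds j : (lo j.1 <= plo j < phi j)%R /\ (phi j <= hi j.1)%R.
Proof.
by case: j => d []; have L := lohi d; rewrite /=; [case: (bk d)|]; lra.
Qed.

Lemma piece_par j t : (0 <= t <= 1)%R ->
  (plo j <= plo j + t * (phi j - plo j) <= phi j)%R /\ (0 <= plo j + t * (phi j - plo j) <= 1)%R.
Proof.
move=> ht; have [h1 h2] := plo_bounds j.
have D0 : (0 < phi j - plo j)%R by lra.
have tD : (0 <= t * (phi j - plo j) <= phi j - plo j)%R.
  by move: (phi j - plo j)%R D0 => D D0; nra.
have := lo_ge0 j.1; have := hi_le1 j.1; lra.
Qed.

Lemma piece_cont j : continuous01 (piece j).
Proof.
move=> t ht eps e0; have [_ h01] := piece_par j ht.
have [dl [d0 H]] := crv_cont (eo j.1) h01 e0.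
exists dl; split=> // s hs st; apply: H; first by case: (piece_par j hs).
have [h1 h2] := plo_bounds j; have := lo_ge0 j.1; have := hi_le1 j.1 => b0 b1.
have -> : (plo j + s * (phi j - plo j) - (plo j + t * (phi j - plo j)) = (s - t) * (phi j - plo j))%R by lra.
have D1 : (0 < phi j - plo j <= 1)%R by lra.
rewrite Rabs_mult (Rabs_right (phi j - plo j)); last lra.
by move: (phi j - plo j)%R D1 (Rabs_pos (s - t)) st => D D1; move: (Rabs (s - t)) => a; nra.
Qed.

Lemma piece_sphere j : sphere01 (piece j).
Proof. by move=> t ht; apply: crv_sphere; case: (piece_par j ht). Qed.

Lemma piece_meet j k :
  (exists s t, [/\ (0 <= s <= 1)%R, (0 <= t <= 1)%R & piece j s = piece k t]) <->
  (exists s t, [/\ (plo j <= s <= phi j)%R, (plo k <= t <= phi k)%R & crv (eo j.1) s = crv (eo k.1) t]).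
Proof.
split=> [[s [t [hs ht E']]]|[s [t [hs ht E']]]].
  exists (plo j + s * (phi j - plo j))%R, (plo k + t * (phi k - plo k))%R.
  by split; [case: (piece_par j hs)|case: (piece_par k ht)|].
have I i (r : R) : (plo i <= r <= phi i)%R -> exists2 r', (0 <= r' <= 1)%R &
    (plo i + r' * (phi i - plo i))%R = r.
  move=> hr; have [h1 h2] := plo_bounds i.
  exists ((r - plo i) / (phi i - plo i))%R; last by field; lra.
  split; first by apply: Rmult_le_pos; [lra|left; apply: Rinv_0_lt_compat; lra].
  apply: (Rmult_le_reg_r (phi i - plo i)); first lra.
  have -> : ((r - plo i) / (phi i - plo i) * (phi i - plo i) = r - plo i)%R by field; lra.
  lra.
have [s' hs' Es] := I j s hs; have [t' ht' Et] := I k t ht.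
by exists s', t'; split=> //; rewrite /piece Es Et.
Qed.

Lemma par01 j s : (plo j <= s <= phi j)%R -> (0 <= s <= 1)%R.
Proof.
move=> hs; have [h1 h2] := plo_bounds j; have := lo_ge0 j.1; have := hi_le1 j.1; lra.
Qed.

Lemma tp_between d k : k <= (size (crs (eo d))).+1 -> (lo d <= tp (eo d) k <= hi d)%R ->
  k = ix d \/ k = (ix d).+1.
Proof.
move=> km [h1 h2]; have [kl|] := ltnP k (ix d).
  by have := tp_mono kl (leqW (ix_le d)); rewrite -/(lo d); lra.
move=> ge; have [kl|] := ltnP (ix d).+1 k; last by move: ge; lia.
by have := tp_mono kl km; rewrite -/(hi d); lra.
Qed.

Lemma mid_tp d s k : (plo (d, false) <= s <= phi (d, false))%R ->
  k <= (size (crs (eo d))).+1 -> s <> tp (eo d) k.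
Proof.
move=> hs km E'; have L := lohi d; move: hs; rewrite /= => hs.
have [kE|kE] : k = ix d \/ k = (ix d).+1 by apply: tp_between => //; lra.
  by move: E'; rewrite kE -/(lo d); lra.
by move: E'; rewrite kE -/(hi d); lra.
Qed.

Lemma near_tp d s k : (plo (d, true) <= s <= phi (d, true))%R ->
  k <= (size (crs (eo d))).+1 -> s = tp (eo d) k -> k = ps d.
Proof.
move=> hs km E'; have L := lohi d.
have [[b1 _] b2] : (lo d <= plo (d, true) < phi (d, true))%R /\ (phi (d, true) <= hi d)%R.
  exact: plo_bounds (d, true).
have : k = ix d \/ k = (ix d).+1 by apply: tp_between => //; rewrite -E'; lra.
rewrite /ps; move: hs => /=; case: (bk d) => hs; case=> kE.
- by move: E'; rewrite kE -/(lo d); lra.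
- by rewrite addn1.
- by rewrite addn0.
by move: E'; rewrite kE -/(hi d); lra.
Qed.

Lemma same_edge_ix d d' s : eo d = eo d' -> (lo d < s < hi d)%R -> (lo d' <= s <= hi d')%R ->
  ix d = ix d'.
Proof.
move=> eE; have im' := ix_le d'; move: im'; rewrite /lo /hi -eE => im' h h'.
have [l|l] := ltnP (ix d) (ix d').
  by have := tp_le l (leqW im'); lra.
have [l'|l'] := ltnP (ix d') (ix d); last by apply/eqP; rewrite eqn_leq l l'.
by have := tp_le l' (leqW (ix_le d)); lra.
Qed.

(** On one edge the near pieces of a node reach only a third of the way to the neighbouring nodes,
    so those of different nodes are disjoint. *)
Lemma near_near_ps d d' s : eo d = eo d' -> (plo (d, true) <= s <= phi (d, true))%R ->
  (plo (d', true) <= s <= phi (d', true))%R -> ps d = ps d'.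
Proof.
have W a a' : eo a = eo a' -> (plo (a, true) <= s <= phi (a, true))%R ->
  (plo (a', true) <= s <= phi (a', true))%R -> ps a <= ps a'.
  move=> eE h h'; rewrite leqNgt; apply/negP => lt.
  have pm := ps_le a; 
  have up : (s <= tp (eo a) (ps a') + (tp (eo a) (ps a').+1 - tp (eo a) (ps a')) / 3)%R.
    have T : (tp (eo a) (ps a') < tp (eo a) (ps a').+1)%R.
      by apply: tp_mono => //; apply: leq_trans lt pm.
    move: h' T; rewrite /= /lo /hi /ps -eE; case: (bk a'); rewrite ?addn1 ?addn0; lra.
  have dn : (tp (eo a) (ps a) - (tp (eo a) (ps a) - tp (eo a) (ps a).-1) / 3 <= s)%R.
    have p0 : 0 < ps a by apply: leq_ltn_trans (leq0n _) lt.
    have T : (tp (eo a) (ps a).-1 < tp (eo a) (ps a))%R by apply: tp_mono => //; rewrite prednK.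
    by move: h T; rewrite /= /lo /hi /ps; case: (bk a); rewrite ?addn1 ?addn0 /=; lra.
  have h1 : (tp (eo a) (ps a').+1 <= tp (eo a) (ps a))%R by apply: tp_le.
  have h2 : (tp (eo a) (ps a') <= tp (eo a) (ps a).-1)%R.
    by apply: tp_le; [case: (ps a) lt|case: (ps a) pm => //= q /leqW].
  have h3 : (tp (eo a) (ps a') < tp (eo a) (ps a))%R by apply: tp_mono.
  lra.
move=> eE h h'; apply/eqP; rewrite eqn_leq !W //; exact/esym.
Qed.

Lemma hpt_near d : exists2 s, (plo (d, true) <= s <= phi (d, true))%R & crv (eo d) s = hpt d.
Proof.
exists (tp (eo d) (ps d)) => //; have := lohi d; rewrite /= /ps /lo /hi.
by case: (bk d); rewrite ?addn1 ?addn0; lra.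
Qed.

Lemma near_meet d d' : (exists s t, [/\ (0 <= s <= 1)%R, (0 <= t <= 1)%R &
    piece (d, true) s = piece (d', true) t]) <-> hpt d = hpt d'.
Proof.
rewrite piece_meet; split=> [[s [t [hs ht /= E']]]|E']; last first.
  have [s hs Es] := hpt_near d; have [t ht Et] := hpt_near d'.
  by exists s, t; rewrite Es Et.
have s01 := par01 hs; have t01 := par01 ht.
have [eE|ne] := eqVneq (eo d) (eo d').
  have st : s = t by move: E'; rewrite -eE => /(crv_inj s01 t01).
  have pE : ps d = ps d' by apply: near_near_ps eE hs _; rewrite st.
  by rewrite /hpt -eE pE.
have [k km Ek] := meet_tp ne s01 t01 E'.
have [|l lm El] := @meet_tp (eo d') (eo d) t s _ t01 s01 (esym E'); first by rewrite eq_sym.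
by rewrite /hpt -(near_tp hs km Ek) -(near_tp ht lm El) -Ek -El.
Qed.

Lemma mid_open d s : (plo (d, false) <= s <= phi (d, false))%R -> (lo d < s < hi d)%R.
Proof. by move=> /= h; have := lohi d; lra. Qed.

Lemma mid_meet d (j : hdart * bool) : (exists s t, [/\ (0 <= s <= 1)%R, (0 <= t <= 1)%R &
    piece (d, false) s = piece j t]) -> eo d = eo j.1 /\ ix d = ix j.1.
Proof.
rewrite piece_meet => -[s [t [hs ht E']]].
have s01 := par01 hs; have t01 := par01 ht.
have [eE|ne] := eqVneq (eo d) (eo j.1); last first.
  by have [k km /(mid_tp hs km)] := meet_tp ne s01 t01 E'.
split=> //; have st : s = t by move: E'; rewrite -eE => /(crv_inj s01 t01).
apply: (same_edge_ix eE (mid_open hs)); rewrite st.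
have [b1 b2] := plo_bounds j; rewrite /lo /hi in b1 b2 *; lra.
Qed.

Lemma mid_meet_near d d' : eo d' = eo d -> ix d' = ix d ->
  exists s t, [/\ (0 <= s <= 1)%R, (0 <= t <= 1)%R & piece (d, false) s = piece (d', true) t].
Proof.
move=> eE iE; apply/piece_meet; rewrite /=.
have L := lohi d; have loE : lo d' = lo d by rewrite /lo eE iE.
have hiE : hi d' = hi d by rewrite /hi eE iE.
exists (if bk d' then (lo d + 2 * hi d) / 3 else (2 * lo d + hi d) / 3)%R.
exists (if bk d' then (lo d + 2 * hi d) / 3 else (2 * lo d + hi d) / 3)%R.
by rewrite loE hiE eE; case: (bk d'); split=> //; lra.
Qed.

Lemma same_al d : ~~ same d (hal d).
Proof.
apply/pbP => /crv_inj E'; move: (E' (tp_01 (ps_le d)) (tp_01 (ps_le (hal d)))).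
have hp : ps (hal d) = ix d + ~~ bk d by [].
have L := lohi d; rewrite hp (_ : eo (hal d) = eo d) // /ps.
by move: L; rewrite /lo /hi; case: (bk d); rewrite ?addn1 ?addn0 /=; lra.
Qed.

Lemma planarization : exists si : {perm hdart},
  planar halp si /\ forall d d', (d' \in porbit si d) = same d d'.
Proof.
have [M [S [conn meet]]] := discretize piece_cont piece_sphere.
have M2 j k : S j :&: S k != set0 -> exists s t, [/\ (0 <= s <= 1)%R, (0 <= t <= 1)%R & piece j s = piece k t].
  by move/meet.
apply: (@nerve_map _ halp (fun d => ~~ bk d) same _ _ _ _ _ _ M
  (fun d => S (d, true)) (fun d => S (d, false))).
- by move=> d; rewrite !permE halK.
- by move=> d; rewrite permE /bk.
- by move=> d; apply/pbP.
- by move=> d d'; apply/pbP/pbP.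
- by move=> d2 d1 d3 /pbP h /pbP h'; apply/pbP; rewrite h.
- by move=> d; rewrite permE same_al.
- by move=> d; exact: conn.
- by move=> d; exact: conn.
- by move=> d d'; apply/idP/pbP => [/meet/near_meet|/near_meet h]; last exact/meet.
- move=> d d' /negbTE bd /negbTE bd' /M2/mid_meet[h1 h2]; apply: hdart_eq => //.
  by rewrite bd bd'.
- move=> d d' /negbTE bd /M2/mid_meet[h1 h2] /=; case: (boolP (bk d')) => b'.
    by right; apply: hdart_eq; rewrite permE // /bk /= -/(bk d) bd.
  by left; apply: hdart_eq => //; rewrite bd (negbTE b').
- by move=> d _; apply/meet; apply: mid_meet_near.
by move=> d _; apply/meet; apply: mid_meet_near; rewrite permE.
Qed.

Definition vt d : option 'I_n :=
  if ps d == 0 then Some (val (eo d)).1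
  else if ps d == (size (crs (eo d))).+1 then Some (val (eo d)).2 else None.
Definition xe d : E := nth (eo d) (crs (eo d)) (ps d).-1.
(** The edge continues only at crossings; at an end of the edge the search fails, and the default
    [d] carries no meaning. *)
Definition ho d : hdart :=
  odflt d [pick d' | [&& eo d' == eo d, ps d' == ps d & bk d' == ~~ bk d]].

Lemma vtN d : vt d = None -> 0 < ps d /\ ps d <= size (crs (eo d)).
Proof.
rewrite /vt; case: (posnP (ps d)) => [-> //|p0].
by case: eqVneq => // ne _; split=> //; rewrite -ltnS ltn_neqAle ne ps_le.
Qed.

Lemma vt_cross d : vt d = None -> cross (eo d) (xe d) /\ tp (eo d) (ps d) = par (eo d) (xe d).
Proof. by move=> /vtN[p0 pm]; exact: tp_cross. Qed.

Lemma vt_same d d' : eo d = eo d' -> ps d = ps d' -> vt d = vt d'.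
Proof. by rewrite /vt => -> ->. Qed.

Lemma hdart_ps d d' : eo d = eo d' -> ps d = ps d' -> bk d = bk d' -> d = d'.
Proof.
move=> h1 h2 h3; apply: hdart_eq => //.
by apply/eqP; rewrite -(eqn_add2r (bk d)) -/(ps d) h2 /ps h3.
Qed.

Lemma hdart_two d d' : eo d = eo d' -> ps d = ps d' -> bk d != bk d' -> forall d'',
  eo d'' = eo d -> ps d'' = ps d -> d'' = d \/ d'' = d'.
Proof.
move=> h1 h2 h3 d'' k1 k2; have [hb|hb] := eqVneq (bk d'') (bk d).
  by left; apply: hdart_ps.
right; apply: hdart_ps; rewrite ?k1 ?k2 //.
by move: hb h3; case: (bk d''); case: (bk d); case: (bk d').
Qed.

Lemma hoP d : vt d = None -> [/\ eo (ho d) = eo d, ps (ho d) = ps d & bk (ho d) = ~~ bk d].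
Proof.
move=> /vtN[p0 pm]; rewrite /ho; case: pickP => [d' /and3P[/eqP h1 /eqP h2 /eqP h3] //|].
have im : (ps d - ~~ bk d) <= size (crs (eo d)) by apply: leq_trans (leq_subr _ _) pm.
have [d' [h1 h2 h3]] := hdart_ex (~~ bk d) im.
move/(_ d'); rewrite /ps h1 h2 h3 !eqxx andbT /= subnK ?eqxx //.
by rewrite -/(ps d); case: (bk d).
Qed.

Lemma ho_vt d : vt d = None -> vt (ho d) = None.
Proof. by move=> dN; have [h1 h2 _] := hoP dN; rewrite (@vt_same (ho d) d). Qed.

Lemma hoK d : vt d = None -> ho (ho d) = d.
Proof.
move=> dN; have [h1 h2 h3] := hoP dN; have [k1 k2 k3] := hoP (ho_vt dN).
by apply: hdart_ps; rewrite ?k1 ?k2 ?k3 ?h1 ?h2 ?h3 ?negbK.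
Qed.

Lemma ho_xe d : vt d = None -> xe (ho d) = xe d.
Proof. by move=> dN; have [h1 h2 _] := hoP dN; rewrite /xe h1 h2. Qed.

Lemma ho_two d d' : vt d = None -> eo d' = eo d -> ps d' = ps d -> d' = d \/ d' = ho d.
Proof.
move=> dN h1 h2; have [k1 k2 k3] := hoP dN; apply: (@hdart_two d (ho d)) => //.
by rewrite k3; case: (bk d).
Qed.

Lemma xe_neq d : vt d = None -> xe d != eo d.
Proof. by move=> /vt_cross[/andP[h _] _]; rewrite eq_sym. Qed.

Lemma xe_unique d d' : vt d = None -> vt d' = None -> eo d = eo d' -> xe d = xe d' ->
  d' = d \/ d' = ho d.
Proof.
move=> dN dN' h1 h2; apply: ho_two => //.
have [p0 pm] := vtN dN; have [p0' pm'] := vtN dN'.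
rewrite -h1 in pm'; move/eqP: h2; rewrite /xe -h1.
by rewrite nth_uniq ?uniq_crs ?prednK // => /eqP h; rewrite -(prednK p0) h prednK.
Qed.

Lemma edge_lt x : (val x).1 < (val x).2.
Proof. by have := valP x => /andP[]. Qed.

Lemma vt_some d v : vt d = Some v -> (ps d = 0 /\ v = (val (eo d)).1) \/
  (ps d = (size (crs (eo d))).+1 /\ v = (val (eo d)).2).
Proof.
rewrite /vt; case: eqP => [-> [<-]|_]; first by left.
by case: eqP => [-> [<-]|_ //]; right.
Qed.

Lemma vt_in d v : vt d = Some v -> v = (val (eo d)).1 \/ v = (val (eo d)).2.
Proof. by move=> /vt_some[[_ ->]|[_ ->]]; [left|right]. Qed.

Lemma vt_unique d d' v : vt d = Some v -> vt d' = Some v -> eo d = eo d' -> d = d'.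
Proof.
move=> /vt_some h /vt_some h' eE; have := edge_lt (eo d); rewrite -eE in h'.
have B a : (ps a = 0 -> bk a = false) /\ (ps a = (size (crs (eo a))).+1 -> bk a = true).
  rewrite /ps; case: (bk a); rewrite ?addn1 ?addn0; split=> // H.
  by have := ix_le a; rewrite H ltnn.
case: h h' => [[p ->]|[p ->]] [[p' vE]|[p' vE]]; rewrite ?vE ?ltnn // => _.
- by apply: hdart_ps; rewrite ?p ?p' // (B d).1 // (B d').1.
- by apply: hdart_ps; rewrite ?p ?p' // (B d).2 // (B d').2 // -eE.
Qed.

Lemma vt_no_parallel d1 d2 d1' d2' v v' : vt d1 = Some v -> vt d2 = Some v ->
  vt d1' = Some v' -> vt d2' = Some v' -> eo d1 = eo d1' -> eo d2 = eo d2' ->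
  eo d1 <> eo d2 -> v = v'.
Proof.
move=> /vt_in h1 /vt_in h2 /vt_in h1' /vt_in h2' e1 e2 ne; rewrite -{}e1 in h1'; rewrite -{}e2 in h2'.
have l1 := edge_lt (eo d1); have l2 := edge_lt (eo d2).
apply/eqP; rewrite -[_ == _]negbK; apply/negP => vv; apply: ne; apply: val_inj.
move: h1 h2 h1' h2' l1 l2 vv; case: (val (eo d1)) (val (eo d2)) => [a b] [a' b'] /=.
move=> [] H1 [] H2 [] H3 [] H4 l1 l2 vv; rewrite H1 in H2 vv; rewrite H3 in H4 vv;
  first [by rewrite eqxx in vv | by rewrite H2 H4 | by rewrite H2 H4 eqxx in vv
    | by move: l1; rewrite H2 H4 ltnNge ltnW].
Qed.

Lemma hpt_vt d v : vt d = Some v -> hpt d = pos v.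
Proof.
by rewrite /hpt => /vt_some[[-> ->]|[-> ->]]; rewrite ?tp0 ?tp1 ?crv0 ?crv1.
Qed.

Lemma tp_open d : vt d = None -> (0 < tp (eo d) (ps d) < 1)%R.
Proof. by move=> /vt_cross[/parP[h _] ->]. Qed.

Lemma vt_adj d1 d2 d v : vt d1 = Some v -> vt d2 = Some v -> vt d = None ->
  eo d = eo d1 -> xe d = eo d2 -> False.
Proof.
move=> h1 h2 dN e1 e2; have [xc Et] := vt_cross dN; rewrite e2 in xc Et.
have p1 := hpt_vt h1; have p2 := hpt_vt h2; rewrite /hpt in p1 p2.
have b1 := tp_01 (ps_le d1); have b2 := tp_01 (ps_le d2); rewrite -e1 in p1 b1.
have ne : val (eo d) <> val (eo d2) by case/andP: xc => /eqP ne _ /val_inj.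
have c := crv_par xc; have [pp _] := parP xc.
have [qq _] : (0 < par (eo d2) (eo d) < 1)%R /\ True.
  by split=> //; rewrite cross_sym in xc; case: (parP xc).
apply: (crv_pos (x := eo d) pp (w := v)); rewrite -p1.
have L (t : R) : (0 < t < 1)%R -> (0 <= t <= 1)%R by lra.
exact: (simple (valP (eo d)) (valP (eo d2)) ne (L _ pp) (L _ qq) b1 b2 c (etrans p1 (esym p2))).
Qed.

Lemma vt_triple d d' d'' : vt d = None -> vt d' = None -> vt d'' = None ->
  eo d' = xe d -> eo d'' = eo d -> xe d'' = xe d' -> False.
Proof.
move=> /vt_cross[c _] /vt_cross[c' _] /vt_cross[c'' _] e1 e2 e3.
rewrite e2 e3 in c''; rewrite e1 in c'.
have N x y : x != y -> val x <> val y by move=> /eqP h /val_inj.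
move: c c' c'' => /andP[/N n1 /pbP h1] /andP[/N n2 /pbP h2] /andP[/N n3 /pbP h3].
exact: quasi (valP (eo d)) (valP (xe d)) (valP (xe d')) n1 n2 n3 h1 h2 h3.
Qed.

Definition drawing_darts : darts hdart E 'I_n.
Proof.
apply: (@Darts _ _ _ eo vt xe ho ps (fun d => ~~ bk d)).
- exact: ho_vt.
- by move=> d /hoP[].
- exact: ho_xe.
- by move=> d /hoP[].
- by move=> d /hoP[_ _ ->].
- exact: hoK.
- exact: xe_neq.
- exact: xe_unique.
- exact: vt_unique.
- exact: vt_no_parallel.
- exact: vt_adj.
- exact: vt_triple.
Defined.

Lemma cross_dart x y : cross x y -> exists d, [/\ vt d = None, eo d = x & xe d = y].
Proof.
move=> xy; have [km Ek nE] := tp_index xy.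
have [d [h1 h2 h3]] := hdart_ex false km.
have pE : ps d = (index y (crs x)).+1 by rewrite /ps h2 h3 addn0.
exists d; split=> //; last by rewrite /xe h1 pE.
by rewrite /vt h1 pE /= ltn_eqF.
Qed.

Lemma end_dart x : exists d d', [/\ vt d = Some (val x).1, eo d = x, vt d' = Some (val x).2 & eo d' = x].
Proof.
have [d [h1 h2 h3]] := hdart_ex false (leq0n (size (crs x))).
have [d' [k1 k2 k3]] := hdart_ex true (leqnn (size (crs x))).
exists d, d'; rewrite /vt /ps h1 h2 h3 k1 k2 k3 /= addn1 eqxx.
by split.
Qed.

(** The darts at a node are those with the same point. At a crossing, a dart of an edge other than
    the two crossing ones would make three edges meet in a point. *)
Lemma drawing_embedded : exists al si : {perm hdart}, embedded drawing_darts setT al si.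
Proof.
have [si [pl orb]] := planarization; exists halp, si.
have sP d d' : reflect (hpt d = hpt d') (d' \in porbit si d) by rewrite orb; exact: pbP.
split=> //=.
- by move=> d; rewrite inE.
- move=> d _; rewrite !permE halK inE; split=> //.
  rewrite /ps [ix (hal d)]/(ix d) [bk (hal d)]/(~~ bk d) => /negbTE->.
  by rewrite addn0 addn1.
- by move=> d _; rewrite inE.
- by move=> d v _; rewrite inE.
- by move=> d d' v h h'; apply/sP; rewrite (hpt_vt h) (hpt_vt h').
- move=> d v h; have /sP := porbit_step si d; rewrite (hpt_vt h).
  case vE : (vt (si d)) => [w|]; first by rewrite (hpt_vt vE) => /pos_inj->.
  by move=> /esym/(crv_pos (tp_open vE)).
move=> d _ dN; have [xc Et] := vt_cross dN.
have [d' [dN' e1 e2]] := cross_dart (etrans (cross_sym _ _) xc); exists d'; split=> //.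
have [h1 h2 _] := hoP dN; have [k1 k2 _] := hoP dN'.
have Et' : tp (eo d') (ps d') = par (xe d) (eo d) by have [_ ->] := vt_cross dN'; rewrite e1 e2.
have hd : hpt d = hpt d' by rewrite /hpt Et Et' e1; exact: crv_par.
apply/setP => z; rewrite !inE -!orbA; apply/sP/or4P; last first.
  case=> /eqP-> //; first by rewrite /hpt h1 h2.
  by rewrite hd /hpt k1 k2.
have on a : vt a = None -> hpt a = hpt z -> eo z = eo a -> z = a \/ z = ho a.
  move=> aN hz ez; apply: ho_two => //.
  have := hz; rewrite /hpt ez => /crv_inj H.
  have := H (tp_01 (ps_le a)); rewrite -ez => /(_ (tp_01 (ps_le z))) {}H.
  have pz := ps_le z; have pa := ps_le a; rewrite -ez in pa.
  apply/eqP; rewrite eqn_leq (leqNgt (ps z)) (leqNgt (ps a)); apply/andP; split; apply/negP => lt.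
    by have := tp_mono lt pz; rewrite H; lra.
  by have := tp_mono lt pa; rewrite H; lra.
move=> hz; have [ez|nez] := eqVneq (eo z) (eo d).
  by case: (on d dN hz ez) => ->; [constructor 1|constructor 2].
have [ez'|nez'] := eqVneq (eo z) (eo d').
  by case: (on d' dN' _ ez') => [|->|->]; [rewrite -hd|constructor 3|constructor 4].
have to := tp_open dN; have to' := tp_open dN'.
have zN : vt z = None.
  case vE : (vt z) => [w|] //; move: hz; rewrite (hpt_vt vE) => /(crv_pos to) [].
exfalso; have hdz : hpt d' = hpt z by rewrite -hd.
apply: (@crv_triple (eo d) (eo d') (eo z)) to to' (tp_open zN) hd hdz.
- by rewrite e1; case/andP: xc.
- by rewrite eq_sym.
by rewrite eq_sym.
Qed.
End Drawing.

(** * Discharging *)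

(* A planarized drawing all of whose crossings are proper, so that si \o si is
   the continuation of an edge across a crossing, and whose vertices have
   degree at least 3. *)
Record proper_map (D E V : finType) (al si : {perm D}) (edg : D -> E)
    (endv : D -> option V) (xed : D -> E) (rk : D -> nat) (fw : D -> bool) : Prop :=
  ProperMap {
  pm_planar : planar al si;
  pm_alK : forall d, al (al d) = d;
  pm_al_edg : forall d, edg (al d) = edg d;
  pm_al_fw : forall d, fw (al d) = ~~ fw d;
  pm_al_rk : forall d, fw d -> rk d < rk (al d);
  pm_si_end : forall d, endv (si d) = endv d;
  pm_vertex : forall d d' v, endv d = Some v -> endv d' = Some v -> d' \in porbit si d;
  pm_deg : forall d v, endv d = Some v -> si d != d /\ si (si d) != d;
  pm_si_edg : forall d, endv d = None -> edg (si d) = xed d;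
  pm_si_xed : forall d, endv d = None -> xed (si d) = edg d;
  pm_si_rk : forall d, endv d = None -> rk (si (si d)) = rk d;
  pm_si_fw : forall d, endv d = None -> fw (si (si d)) = ~~ fw d;
  pm_si4 : forall d, endv d = None -> si (si (si (si d))) = d;
  pm_xed_neq : forall d, endv d = None -> xed d <> edg d;
  pm_cross_unique : forall d d', endv d = None -> endv d' = None ->
    edg d = edg d' -> xed d = xed d' -> d' = d \/ d' = si (si d);
  pm_end_unique : forall d d' v, endv d = Some v -> endv d' = Some v -> edg d = edg d' -> d = d';
  pm_no_parallel : forall d1 d2 d1' d2' v v', endv d1 = Some v -> endv d2 = Some v ->
    endv d1' = Some v' -> endv d2' = Some v' -> edg d1 = edg d1' -> edg d2 = edg d2' ->
    edg d1 <> edg d2 -> v = v';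
  pm_adj_no_cross : forall d1 d2 d v, endv d1 = Some v -> endv d2 = Some v ->
    endv d = None -> edg d = edg d1 -> xed d = edg d2 -> False;
  pm_no_triple : forall d d' d'', endv d = None -> endv d' = None -> endv d'' = None ->
    edg d' = xed d -> edg d'' = edg d -> xed d'' = xed d' -> False }.

Section Charge.
Variables (D E V : finType) (al si : {perm D}) (edg : D -> E)
  (endv : D -> option V) (xed : D -> E) (rk : D -> nat) (fw : D -> bool).
Hypothesis pm : proper_map al si edg endv xed rk fw.

Let alK := pm_alK pm.
Let al_edg := pm_al_edg pm.
Let si_end := pm_si_end pm.

Definition rl d : bool := endv d.
(** [phi d] follows [d] to its head and turns there, so that the cycles of [phi] are the faces. The
    corner of a face belonging to [y] lies at the tail of [y], between [y] and [si^-1 y]. *)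
Definition phi := (al * si)%g.

Lemma phiE d : phi d = si (al d). Proof. by rewrite permM. Qed.

Lemma rlP d : reflect (exists v, endv d = Some v) (rl d).
Proof. by rewrite /rl; case: (endv d) => [v|] /=; constructor; [exists v|case]. Qed.

Lemma rlN d : ~~ rl d -> endv d = None.
Proof. by rewrite /rl; case: (endv d). Qed.

Lemma rl_si d : rl (si d) = rl d. Proof. by rewrite /rl si_end. Qed.

Lemma siV_end d : endv (si^-1%g d) = endv d.
Proof. by rewrite -{2}[d](permKV si) si_end. Qed.

Lemma rl_phi d : rl (phi d) = rl (al d). Proof. by rewrite phiE rl_si. Qed.

Lemma end_phi d : endv (phi d) = endv (al d). Proof. by rewrite phiE si_end. Qed.

Lemma al_neq d : al d <> d.
Proof. by move=> E'; have := pm_al_fw pm d; rewrite E'; case: (fw d). Qed.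

Lemma al_rk_neq d : rk (al d) <> rk d.
Proof.
move=> E'; case f : (fw d); first by have := pm_al_rk pm f; rewrite E' ltnn.
by have := @pm_al_rk _ _ _ _ _ _ _ _ _ _ pm (al d); rewrite (pm_al_fw pm) f alK E' ltnn => /(_ isT).
Qed.

Lemma al_end d v : endv d = Some v -> endv (al d) <> Some v.
Proof. by move=> h h'; apply: (@al_neq d); apply: (pm_end_unique pm h' h); exact: al_edg. Qed.

Lemma phi_cross d : ~~ rl (phi d) -> edg (phi d) = xed (al d) /\ xed (phi d) = edg d.
Proof.
rewrite rl_phi => /rlN h; rewrite phiE (pm_si_edg pm) // (pm_si_xed pm) //.
Qed.

Lemma siV_cross d : ~~ rl d -> edg (si^-1%g d) = xed d /\ xed (si^-1%g d) = edg d.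
Proof.
move=> /rlN h; have h' : endv (si^-1%g d) = None by rewrite siV_end.
by rewrite -{2 4}[d](permKV si) (pm_si_edg pm h') (pm_si_xed pm h').
Qed.

Definition crossing e f := exists d, [/\ endv d = None, edg d = e & xed d = f].
Definition incident e v := exists d, endv d = Some v /\ edg d = e.

Lemma crossing_sym e f : crossing e f -> crossing f e.
Proof.
move=> [d [h1 h2 h3]]; exists (si d).
by rewrite si_end (pm_si_edg pm) // (pm_si_xed pm) //.
Qed.

Lemma crossing_dart d : ~~ rl d -> crossing (edg d) (xed d).
Proof. by move=> /rlN h; exists d. Qed.

Lemma crossing_neq e f : crossing e f -> e <> f.
Proof. by move=> [d [h <- <-]] E'; apply: (pm_xed_neq pm h). Qed.

Lemma crossing_adj e f v : incident e v -> incident f v -> crossing e f -> False.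
Proof.
move=> [d1 [h1 <-]] [d2 [h2 <-]] [d [h3 h4 h5]].
exact: (pm_adj_no_cross pm h1 h2 h3 h4 h5).
Qed.

Lemma crossing_triple e f g : crossing e f -> crossing f g -> crossing e g -> False.
Proof.
move=> [d [h1 e1 f1]] [d' [h2 e2 f2]] [d'' [h3 e3 f3]].
by apply: (pm_no_triple pm h1 h2 h3); rewrite ?e2 ?f1 ?e3 ?e1 ?f2 ?f3.
Qed.

Lemma parallel e f v w : incident e v -> incident e w -> incident f v -> incident f w ->
  e <> f -> v = w.
Proof.
move=> [d1 [h1 e1]] [d2 [h2 e2]] [d3 [h3 e3]] [d4 [h4 e4]] ne.
by apply: (pm_no_parallel pm h1 h3 h2 h4); rewrite ?e1 ?e2 ?e3 ?e4.
Qed.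

Lemma incident_dart d v : endv d = Some v -> incident (edg d) v.
Proof. by move=> h; exists d. Qed.

Lemma cross_rk d d' : ~~ rl d -> ~~ rl d' -> edg d = edg d' -> xed d = xed d' -> rk d' = rk d.
Proof.
move=> /rlN h /rlN h' e1 e2.
by case: (pm_cross_unique pm h h' e1 e2) => -> //; exact: (pm_si_rk pm h).
Qed.

Lemma phi1 d : phi d <> d.
Proof.
move=> E'; have [/rlP[v vd]|nd] := boolP (rl d).
  by apply: (al_end vd); rewrite -end_phi E'.
have [h1 h2] : edg (phi d) = xed (al d) /\ xed (phi d) = edg d by apply: phi_cross; rewrite E'.
by rewrite E' in h2; exact: (pm_xed_neq pm (rlN nd)) h2.
Qed.

(** According to its number of vertices, a face with two sides yields parallel edges (or a vertex of
    degree 1), adjacent edges that cross, or two crossings of the same two edges. *)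
Lemma phi2 d : phi (phi d) <> d.
Proof.
have mixed x : rl x -> ~~ rl (phi x) -> phi (phi x) <> x.
  move=> /rlP[v vx] nx E'; have [h1 h2] := phi_cross nx.
  have vd : endv (al (phi x)) = Some v by rewrite -end_phi E'.
  apply: (crossing_adj (v := v) (e := edg (phi x)) (f := edg x)).
  - by rewrite -al_edg; exact: incident_dart.
  - exact: incident_dart.
  by rewrite -h2; exact: crossing_dart.
move=> E'; have [rd|nd] := boolP (rl d); have [rp|np] := boolP (rl (phi d)).
- have [v vd] := rlP _ rd; have [w wd] := rlP _ rp.
  have wd' : endv (al d) = Some w by rewrite -end_phi.
  have vd' : endv (al (phi d)) = Some v by rewrite -end_phi E'.
  have [ee|ne] := eqVneq (edg d) (edg (phi d)).
    have : al d = phi d by apply: (pm_end_unique pm wd' wd); rewrite al_edg.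
    by rewrite phiE => h; have [/eqP []] := pm_deg pm wd'; rewrite -h.
  apply: (al_end vd); rewrite wd'; congr Some; symmetry.
  apply: (@parallel (edg d) (edg (phi d))); last by apply/eqP.
  + exact: incident_dart.
  + by rewrite -al_edg; exact: incident_dart.
  + by rewrite -[edg (phi d)]al_edg; exact: incident_dart.
  + exact: incident_dart.
- exact: mixed E'.
- by apply: (mixed (phi d)) => //; rewrite E'.
have [h1 h2] := phi_cross np.
have [k1 k2] : edg (phi (phi d)) = xed (al (phi d)) /\ xed (phi (phi d)) = edg (phi d).
  by apply: phi_cross; rewrite E'.
have na : ~~ rl (al d) by rewrite -rl_phi.
apply: (@al_rk_neq d); apply: (cross_rk nd na); first by rewrite al_edg.
by rewrite -h1 -k2 E'.
Qed.

Definition fv d := \sum_(y in porbit phi d) rl y.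
Definition fx d := \sum_(y in porbit phi d) ~~ rl y.
(** On a face that has crossings this is the number of maximal runs of consecutive vertices. *)
Definition fz d := \sum_(y in porbit phi d) (rl y && ~~ rl (phi y)).

Lemma face_sum (g : D -> nat) d :
  \sum_(y in porbit phi d) g y = \sum_(y <- traject phi d #|porbit phi d|) g y.
Proof.
rewrite -big_enum /=; apply: perm_big; apply: uniq_perm.
- exact: enum_uniq.
- exact: uniq_traject_porbit.
by move=> y; rewrite mem_enum porbit_traject.
Qed.

Lemma face_size d : #|porbit phi d| = fv d + fx d.
Proof.
rewrite /fv /fx -big_split /= -sum1_card; apply: eq_bigr => y _.
by case: (rl y).
Qed.

Lemma face_closed d (S : pred D) : S d -> (forall y, y \in porbit phi d -> S y -> S (phi y)) ->
  forall y, y \in porbit phi d -> S y.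
Proof.
move=> Sd cl _ /porbitP[i ->]; elim: i => [|i IH]; first by rewrite perm1.
by rewrite expgSr permM; apply: cl => //; exact: mem_porbit.
Qed.

Lemma face_shift (g : D -> nat) d :
  \sum_(y in porbit phi d) g (phi y) = \sum_(y in porbit phi d) g y.
Proof.
rewrite [RHS](reindex_inj (@perm_inj _ phi)); apply: eq_bigl => y.
apply/idP/idP => h; first by apply: porbit_trans h (porbit_step _ _).
by apply: porbit_trans h _; rewrite porbit_sym porbit_step.
Qed.

Lemma fzE d : fz d = \sum_(y in porbit phi d) (~~ rl y && rl (phi y)).
Proof.
have := face_shift rl d; rewrite -/(fv d).
have -> : \sum_(y in porbit phi d) rl (phi y) =
    \sum_(y in porbit phi d) (~~ rl y && rl (phi y)) + \sum_(y in porbit phi d) (rl y && rl (phi y)).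
  by rewrite -big_split; apply: eq_bigr => y _; case: (rl y); case: (rl _).
have -> : fv d = fz d + \sum_(y in porbit phi d) (rl y && rl (phi y)).
  by rewrite /fz -big_split; apply: eq_bigr => y _; case: (rl y); case: (rl _).
by move/addIn.
Qed.

Lemma fz_le_fx d : fz d <= fx d.
Proof. by rewrite fzE; apply: leq_sum => y _; case: (rl y); case: (rl _). Qed.

Lemma fz_le_fv d : fz d <= fv d.
Proof. by apply: leq_sum => y _; case: (rl y); case: (rl _). Qed.

Lemma face_eq d d' : d' \in porbit phi d -> porbit phi d' = porbit phi d.
Proof. by rewrite -eq_porbit_mem => /eqP. Qed.

Lemma face_iter n d : #|porbit phi d| = n -> iter n phi d = d.
Proof. by move=> <-; exact: iter_porbit. Qed.

Lemma fz_gt0 d : 0 < fv d -> 0 < fx d -> 0 < fz d.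
Proof.
rewrite !lt0n => /eqP v0 /eqP x0; apply/eqP => /eqP; rewrite sum_nat_eq0 => /forall_inP z0.
have clo y : y \in porbit phi d -> rl y -> rl (phi y).
  by move=> yd ry; have := z0 y yd; rewrite ry; case: (rl (phi y)).
case: v0; apply/eqP; rewrite sum_nat_eq0; apply/forall_inP => y yd.
rewrite eqb0; apply/negP => ry; case: x0; apply/eqP; rewrite sum_nat_eq0.
apply/forall_inP => y' yd'; rewrite eqb0 negbK.
apply: (face_closed (d := y) ry); rewrite (face_eq yd) // => u; exact: clo.
Qed.

Lemma face_size_gt2 d : 2 < fv d + fx d.
Proof.
rewrite -face_size; have p0 : 0 < #|porbit phi d| by rewrite lt0n card_porbit_neq0.
case E' : #|porbit phi d| p0 => [|[|[|n]]] // _.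
  by have := face_iter E' => /= /phi1.
by have := face_iter E' => /= /phi2.
Qed.

(** The three sides would belong to pairwise crossing edges. *)
Lemma face_no_0triangle d : fv d = 0 -> fx d <> 3.
Proof.
move=> v0 x3; have N : #|porbit phi d| = 3 by rewrite face_size v0 x3.
have nr y : y \in porbit phi d -> ~~ rl y.
  by move=> yd; move/eqP: v0; rewrite sum_nat_eq0 => /forall_inP/(_ y yd); rewrite eqb0.
have p1 : phi d \in porbit phi d by exact: porbit_step.
have p2 : phi (phi d) \in porbit phi d by apply: porbit_trans p1 (porbit_step _ _).
have [_ h1] := phi_cross (nr _ p1); have [_ h2] := phi_cross (nr _ p2).
have h3 : xed d = edg (phi (phi d)).
  have E' := face_iter N; rewrite /= in E'; rewrite -{1}E'.
  by have [_ ->] := @phi_cross (phi (phi d)) ltac:(by rewrite E' nr ?porbit_id).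
apply: (@crossing_triple (edg (phi d)) (edg d) (edg (phi (phi d)))).
- by rewrite -h1; apply: crossing_dart; exact: nr.
- by rewrite -h3; apply: crossing_dart; apply: nr; exact: porbit_id.
by apply: crossing_sym; rewrite -h2; apply: crossing_dart; exact: nr.
Qed.

(** * Triangles with one vertex and the chains that pay for them *)

Definition tri1 r := [&& rl r, fv r == 1 & fx r == 2].
Definition quad0 d := (fv d == 0) && (fx d == 4).

Lemma fv_face d d' : d' \in porbit phi d -> fv d' = fv d.
Proof. by move=> h; rewrite /fv (face_eq h). Qed.

Lemma fx_face d d' : d' \in porbit phi d -> fx d' = fx d.
Proof. by move=> h; rewrite /fx (face_eq h). Qed.

Lemma fz_face d d' : d' \in porbit phi d -> fz d' = fz d.
Proof. by move=> h; rewrite /fz (face_eq h). Qed.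

Lemma fv_unroll n d : #|porbit phi d| = n -> fv d = \sum_(y <- traject phi d n) rl y.
Proof. by move=> <-; exact: face_sum. Qed.

Lemma phiV d : phi^-1%g d = al (si^-1%g d).
Proof. by apply: (perm_inj (s := phi)); rewrite permKV phiE alK permKV. Qed.

Lemma phi_last n d : iter n.+1 phi d = d -> iter n phi d = al (si^-1%g d).
Proof. by rewrite iterS -phiV => E'; rewrite -[in RHS]E' permK. Qed.

(* The side of a 1-triangle facing its vertex is a segment of an edge that
   crosses the two edges at that vertex. *)
Lemma tri1P r : tri1 r -> let a := si^-1%g r in
  [/\ phi (phi r) = al a, ~~ rl (phi r) & ~~ rl (phi (phi r))].
Proof.
move=> /and3P[rr /eqP v1 /eqP x2]; have N : #|porbit phi r| = 3 by rewrite face_size v1 x2.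
have := fv_unroll N; rewrite /= !big_cons big_nil v1 rr => h.
split; first exact: (phi_last (n := 2) (face_iter N)).
  by move: h; case: (rl (phi r)).
by move: h; case: (rl (phi (phi r))) => //; rewrite !addnS.
Qed.

Lemma quad0P d : quad0 d -> [/\ ~~ rl d, ~~ rl (phi d), ~~ rl (phi (phi d)),
  ~~ rl (phi (phi (phi d))) & phi (phi (phi d)) = al (si^-1%g d)].
Proof.
move=> /andP[/eqP v0 /eqP x4]; have N : #|porbit phi d| = 4 by rewrite face_size v0 x4.
have nr y : y \in porbit phi d -> ~~ rl y.
  by move=> yd; move/eqP: v0; rewrite sum_nat_eq0 => /forall_inP/(_ y yd); rewrite eqb0.
have st y : y \in porbit phi d -> phi y \in porbit phi d.
  by move=> h; apply: porbit_trans h (porbit_step _ _).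
have d0 := porbit_id phi d.
by split; [exact: nr|exact: nr (st _ d0)|exact: nr (st _ (st _ d0))
  |exact: nr (st _ (st _ (st _ d0)))|exact: (phi_last (n := 3) (face_iter N))].
Qed.

(* A 1-triangle is paid for by the first face that is not a quadrilateral of
   crossings when one leaves the triangle opposite to its vertex and passes
   through opposite sides of such quadrilaterals. *)
Definition across d := al (phi (phi d)).

Lemma across_inj : injective across.
Proof. by move=> x y /perm_inj/perm_inj/perm_inj. Qed.

Definition starts := [set al (phi r) | r in [set r | tri1 r]].
Definition chain : {set D} :=
  [set d | [exists s in starts, connect [rel x y | quad0 x && (y == across x)] s d]].
Definition paying := chain :\: [set d | quad0 d].

(** The invariant of a chain: the segment [d] spans the wedge between the two edges that bound the
    corner [r]. *)
Definition between d := exists r, [/\ rl r, ~~ rl d, ~~ rl (al d),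
  xed d = edg (si^-1%g r) & xed (al d) = edg r].

Lemma chain_between d : d \in chain -> between d.
Proof.
rewrite inE => /exists_inP[s /imsetP[r]]; rewrite inE => tr -> {s} /connectP[p].
have : between (al (phi r)).
  have /= [e1 n1 n2] := tri1P tr; have /and3P[rr _ _] := tr.
  have na : ~~ rl (al (phi r)) by rewrite -rl_phi.
  exists r; split=> //.
  - by rewrite alK.
  - by have [_] := phi_cross n2; have [h _] := phi_cross n2; rewrite -h e1 al_edg.
  by rewrite alK; case: (phi_cross n1).
elim: p (al (phi r)) => [|y p IH] d0 bd /=; first by move=> _ ->.
move=> /andP[/andP[q /eqP yE] py] E'; apply: IH py E'; rewrite {}yE.
have [n0 n1 n2 n3 e3] := quad0P q.
case: bd => r' [rr nd nad x1 x2]; exists r'.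
have n3' : ~~ rl (al (phi (phi d0))) by rewrite -rl_phi.
rewrite /across alK; split=> //.
  have [<- _] := phi_cross n3; rewrite e3 al_edg -x1.
  by have [] := siV_cross n0.
by have [_ ->] := phi_cross n2; have [-> _] := phi_cross n1.
Qed.

Lemma paying_cross d : d \in paying -> ~~ rl d && ~~ rl (phi d).
Proof.
by rewrite inE => /andP[_ /chain_between[r [_ nd na _ _]]]; rewrite nd rl_phi.
Qed.

Lemma paying_quad0 d : d \in paying -> ~~ quad0 d.
Proof. by rewrite !inE => /andP[]. Qed.

(** If a chain ended in such a triangle, the two edges at its vertex would be the two edges of the
    wedge where the chain started. At different vertices these are parallel; at the same vertex [si]
    exchanges their darts, contradicting degree at least 3. *)
Lemma paying_tri1 d : d \in paying -> ~~ ((fv d == 1) && (fx d == 2)).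
Proof.
move=> dP; apply/negP => /andP[/eqP v1 /eqP x2].
have /andP[nd np] := paying_cross dP.
move: dP; rewrite inE => /andP[_ /chain_between[r [rr _ nad x1 x3]]].
have N : #|porbit phi d| = 3 by rewrite face_size v1 x2.
have := fv_unroll N; rewrite /= !big_cons big_nil v1 (negPf nd) (negPf np) => h.
have rt : rl (phi (phi d)) by move: h; case: (rl _).
set t := phi (phi d) in rt h.
have E' : phi t = d by exact: (face_iter N).
have tP : t \in porbit phi d.
  by apply: porbit_trans (porbit_step _ _) (porbit_step _ _).
have tt : tri1 t by rewrite /tri1 rt (fv_face tP) (fx_face tP) v1 x2.
have /= [f1 m1 m2] := tri1P tt; rewrite E' in f1 m1 m2.
have m0 : ~~ rl (phi t) by rewrite E'.
have g1 : edg t = edg (si^-1%g r) by rewrite -x1; have [_ <-] := phi_cross m0; rewrite E'.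
have g2 : edg (si^-1%g t) = edg r.
  by rewrite -x3; have [<- _] := phi_cross m2; rewrite f1 al_edg.
have [v vr] := rlP _ rr; have [w wt] := rlP _ rt.
have va : endv (si^-1%g r) = Some v by rewrite siV_end.
have wb : endv (si^-1%g t) = Some w by rewrite siV_end.
have ne : edg r <> edg (si^-1%g r).
  move=> ee; have h' := pm_end_unique pm vr va ee.
  by have [/eqP []] := pm_deg pm vr; rewrite {1}h' permKV.
have vw : v = w.
  apply: (@parallel (edg r) (edg (si^-1%g r))) => //.
  - exact: incident_dart.
  - by rewrite -g2; exact: incident_dart.
  - exact: incident_dart.
  - by rewrite -g1; exact: incident_dart.
subst w; have h1 := pm_end_unique pm wt va g1; have h2 := pm_end_unique pm wb vr g2.
have [_ /eqP []] := pm_deg pm wt; rewrite {1}h1 permKV -h2 permKV //.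
Qed.

(** [chain] consists of [starts] and of the image under [across] of its members in quadrilaterals.
    These parts are disjoint and [across] is injective, so there are as many exits as starts: no two
    chains share an exit and none runs forever. *)
Lemma card_paying : #|paying| = #|[set r | tri1 r]|.
Proof.
have sE : #|starts| = #|[set r | tri1 r]|.
  by rewrite card_imset // => x y /perm_inj/perm_inj.
pose Q := [set d | quad0 d].
have cE : chain = starts :|: across @: (chain :&: Q).
  apply/setP => d; apply/idP/setUP => [|[sd|/imsetP[y]]].
  - rewrite inE => /exists_inP[s sS /connectP[p]]; elim/last_ind: p d => [|p y _] d.
      by move=> _ -> ; left.
    rewrite rcons_path last_rcons => /andP[ps /andP[/= q /eqP ->]] ->.
    right; apply: imset_f; rewrite !inE q andbT; apply/exists_inP; exists s => //.
    by apply/connectP; exists p.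
  - by rewrite inE; apply/exists_inP; exists d; rewrite ?connect0.
  rewrite !inE => /andP[/exists_inP[s sS sy] q] ->; apply/exists_inP; exists s => //.
  by apply: connect_trans sy (connect1 _); rewrite /= q eqxx.
have dis : starts :&: across @: (chain :&: Q) = set0.
  apply/setP => d; rewrite !inE; apply/negbTE/andP => -[/imsetP[r]].
  rewrite inE => /and3P[rr _ _] -> /imsetP[y]; rewrite !inE => /andP[_ /quad0P[_ n1 _ _ _]].
  by move=> /perm_inj/perm_inj E'; rewrite E' (negPf n1) in rr.
have := cardsID Q chain; rewrite -/paying {2}cE cardsU dis cards0 subn0 sE.
rewrite (card_imset _ across_inj); lia.
Qed.

(** * Charges of the faces *)

Definition gaps r := ~~ rl (phi r) + ~~ rl (phi^-1%g r).

(* In thirtieths: what the face of the corner r gives to the vertex of r, on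
   top of the 6 units due to every corner. *)
Definition share_const v x z :=
  if v == 1 then (if x <= 2 then 0 else 24 * x - 60)
  else if v == 2 then 12 * x + 3 * z - 6
  else if v == 3 then (if z == 1 then 24 else 14 + 10 * z + 8 * (x - z))
  else 24.
Definition share_gap v x z :=
  if v <= 2 then 0
  else if v == 3 then (if z == 1 then 12 * (x - 1) else 0)
  else 15.
Definition share r :=
  share_const (fv r) (fx r) (fz r) + share_gap (fv r) (fx r) (fz r) * gaps r.

Lemma sum_gaps d : \sum_(y in porbit phi d) rl y * gaps y = (fz d).*2.
Proof.
have -> : \sum_(y in porbit phi d) rl y * gaps y = fz d +
    \sum_(y in porbit phi d) (rl y && ~~ rl (phi^-1%g y)).
  rewrite /fz -big_split; apply: eq_bigr => y _ /=; rewrite /gaps.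
  by case: (rl y); rewrite ?mul1n ?mul0n.
rewrite -(face_shift (fun y => (rl y && ~~ rl (phi^-1%g y)) : nat)) -addnn.
congr (_ + _); rewrite fzE; apply: eq_bigr => y _.
by rewrite permK andbC.
Qed.

Lemma sum_share d : \sum_(y in porbit phi d) (if rl y then share y else 0) =
  fv d * share_const (fv d) (fx d) (fz d) + share_gap (fv d) (fx d) (fz d) * (fz d).*2.
Proof.
rewrite -sum_gaps big_distrr /= /(fv d) big_distrl /= -big_split; apply: eq_bigr => y yd /=.
rewrite /share (fv_face yd) (fx_face yd) (fz_face yd).
by case: (rl y); rewrite ?mul1n ?mul0n ?muln0.
Qed.

Lemma sum_tri1 d : \sum_(y in porbit phi d) tri1 y = (fv d == 1) && (fx d == 2) :> nat.
Proof.
have -> : \sum_(y in porbit phi d) tri1 y =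
    \sum_(y in porbit phi d) rl y * ((fv d == 1) && (fx d == 2)).
  apply: eq_bigr => y yd; rewrite /tri1 (fv_face yd) (fx_face yd).
  by case: (rl y); rewrite ?mul1n ?mul0n.
rewrite -big_distrl /= -/(fv d); case: (eqVneq (fv d) 1) => [->|_]; first by rewrite mul1n.
by rewrite muln0.
Qed.

Lemma sum_paying d : \sum_(y in porbit phi d) (y \in paying) + fz d <= fx d /\
  (fv d = 1 /\ fx d = 2 \/ fv d = 0 /\ fx d = 4 ->
   \sum_(y in porbit phi d) (y \in paying) = 0).
Proof.
split.
  rewrite fzE /fx -big_split; apply: leq_sum => y yd /=.
  have [/paying_cross/andP[-> /negPf->]|_] := boolP (y \in paying); first by [].
  by case: (rl y); case: (rl (phi y)).
move=> h; apply: big1 => y yd; apply/eqP; rewrite eqb0; apply/negP => yp.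
case: h => -[v0 x0].
  by have := paying_tri1 yp; rewrite (fv_face yd) (fx_face yd) v0 x0.
by have := paying_quad0 yp; rewrite /quad0 (fv_face yd) (fx_face yd) v0 x0.
Qed.

Definition gain y := (if rl y then 60 else 30) + 6 * tri1 y.
Definition cost y := 6 * (y \in paying) + (if rl y then 6 + share y else 0).

(** At most [x - z] sides pay. When all of these do, there is equality for [v = 2], [v = 3], and
    [v = 1] with [x >= 3]: the shares are exactly what is left. For [v >= 4] the remainder is at
    least [30 * (v - 4) + 24 * (x - z)]. A triangle with one vertex receives the 6 units it passes
    on, and a face without vertices pays only if [x >= 5], when [30 * x - 120 >= 6 * x]. *)
Lemma face_charge d :
  120 + \sum_(y in porbit phi d) cost y <= \sum_(y in porbit phi d) gain y.
Proof.
have -> : \sum_(y in porbit phi d) cost y =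
    6 * \sum_(y in porbit phi d) (y \in paying) + 6 * fv d +
    \sum_(y in porbit phi d) (if rl y then share y else 0).
  rewrite big_distrr /= /(fv d) big_distrr /= -!big_split; apply: eq_bigr => y _ /=.
  by rewrite /cost; case: (rl y); rewrite ?muln1 ?muln0 ?addn0 // addnA.
have -> : \sum_(y in porbit phi d) gain y = 60 * fv d + 30 * fx d +
    6 * \sum_(y in porbit phi d) tri1 y.
  rewrite [6 * _]big_distrr /= /fv /fx !big_distrr /= -!big_split; apply: eq_bigr => y _ /=.
  by rewrite /gain; case: (rl y).
rewrite sum_share sum_tri1.
have [pz p0] := sum_paying d; have := face_size_gt2 d; have := @face_no_0triangle d.
have := @fz_gt0 d; have := fz_le_fv d; move: pz p0.
move: (\sum_(y in _) _) (fv d) (fx d) (fz d) => p v x z.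
rewrite /share_const /share_gap.
case: v => [|[|[|[|v]]]] /=; last first.
- by move=> *; nia.
- by case: (eqVneq z 1) => [->|z1] *; nia.
- by move=> *; nia.
- case: (eqVneq x 2) => [->|x2] /= pz p0 zv z0 _ xs; first by rewrite p0; [lia|left].
  by have -> : x <= 2 = false by [lia]; lia.
case: (eqVneq x 4) => [->|x4] /= pz p0 *; first by rewrite p0; [lia|right].
lia.
Qed.

Lemma face_count (g : pred D) d s : uniq s -> {in s, forall y, (y \in porbit phi d) && g y} ->
  size s <= \sum_(y in porbit phi d) g y.
Proof.
move=> us hs; rewrite -(card_uniqP us).
have -> : \sum_(y in porbit phi d) g y = #|[set y in porbit phi d | g y]|.
  rewrite -sum1_card [LHS](bigID g) /= [X in _ + X]big1 => [|y /andP[_ /negPf->]] //.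
  rewrite addn0; apply: eq_big => [y|y /andP[_ ->]] //; first by rewrite inE.
by apply/subset_leq_card/subsetP => y /hs; rewrite inE.
Qed.

Lemma phi_face d : phi d \in porbit phi d.
Proof. exact: porbit_step. Qed.

Lemma phiV_face d : phi^-1%g d \in porbit phi d.
Proof. by rewrite -porbitV porbit_step. Qed.

Lemma uniq_face3 d : uniq [:: d; phi d; phi^-1%g d].
Proof.
rewrite /= !inE negb_or andbT; apply/andP; split; first (apply/andP; split); apply/eqP => E'.
- exact: (@phi1 d).
- by apply: (@phi1 d); rewrite [in LHS]E' permKV.
by apply: (@phi2 d); rewrite E' permKV.
Qed.

(** A vertex with crossings on both sides is a run by itself, so any other vertex of the face starts
    another run. *)
Lemma fz_ge2 r : rl r -> ~~ rl (phi r) -> ~~ rl (phi^-1%g r) -> 1 < fv r -> 1 < fz r.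
Proof.
move=> rr cr ca v2; rewrite ltnNge; apply/negP => z1.
have [y [yr ry ny]] : exists y, [/\ y \in porbit phi r, rl y & y != r].
  suff /exists_inP[y yr /andP[ry ny]] : [exists y in porbit phi r, rl y && (y != r)] by exists y.
  rewrite -[X in is_true X]negbK; apply/negP => /exists_inPn h.
  move: v2; rewrite /fv (bigD1 r) ?porbit_id //= big1 ?rr // => y /andP[yr ny].
  by have := h y yr; rewrite ny andbT => /negPf->.
have : rl r && (r != r); last by rewrite eqxx andbF.
apply: (@face_closed y (fun u => rl u && (u != r))); first by rewrite ry.
  rewrite (face_eq yr) => u ur /andP[ru nu]; apply/andP; split.
    rewrite -[X in is_true X]negbK; apply/negP => cu.
    have := @face_count (fun y => rl y && ~~ rl (phi y)) r [:: r; u].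
    rewrite /= inE eq_sym nu => /(_ isT) H; have : 1 < fz r by
      apply: H => v; rewrite !inE => /orP[] /eqP->; rewrite ?porbit_id ?rr ?cr ?ur ?ru ?cu.
    by rewrite ltnNge z1.
  by apply/eqP => E'; move: ca; rewrite -E' permK ru.
by rewrite (face_eq yr) porbit_id.
Qed.

(** * Corners at a vertex *)

Definition nextc r := ~~ rl (phi r).
(** When [nextc r] holds, this is the first edge to cross the edge of [r], seen from its vertex. *)
Definition ce r := edg (phi r).

Lemma rl_siV r : rl (si^-1%g r) = rl r.
Proof. by rewrite /rl siV_end. Qed.

Lemma phiV_nextc r : ~~ rl (phi^-1%g r) = nextc (si^-1%g r).
Proof. by rewrite /nextc rl_phi phiV. Qed.

Lemma gapsE r : gaps r = nextc r + nextc (si^-1%g r).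
Proof. by rewrite /gaps phiV_nextc. Qed.

Lemma si_edg_neq x : rl x -> edg (si x) <> edg x /\ edg (si (si x)) <> edg x.
Proof.
move=> /rlP[v vx]; have [d1 d2] := pm_deg pm vx.
have v1 : endv (si x) = Some v by rewrite si_end.
have v2 : endv (si (si x)) = Some v by rewrite si_end.
by split=> E'; [move/eqP: d1; apply|move/eqP: d2; apply]; apply: (pm_end_unique pm) E'; eassumption.
Qed.

Lemma incident_head d w : endv (phi d) = Some w -> incident (edg d) w.
Proof. by rewrite end_phi -al_edg; exact: incident_dart. Qed.

Lemma xed_next a : nextc a -> xed (al a) = ce a.
Proof. by move=> /phi_cross[<-]. Qed.

Lemma incident2 x v w : endv x = Some v -> endv (phi x) = Some w -> v <> w.
Proof. by move=> h; rewrite end_phi => h' E'; subst w; apply: (al_end h). Qed.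

(** The side opposite to the vertex lies on one edge, which is the first to cross both edges of the
    corner. Hence consecutive triangles follow a single edge in a single direction. *)
Lemma tri1_run r : tri1 r -> let a := si^-1%g r in
  [/\ ce a = ce r, fw (phi a) = fw (phi r) & rk (phi a) = rk (al (phi r))].
Proof.
move=> tr a; have [e2 n1 n2] := tri1P tr.
have E' : phi a = si (si (al (phi r))) by rewrite -[in RHS]phiE e2 -phiE.
have na : endv (al (phi r)) = None by apply: rlN; rewrite -rl_phi.
rewrite /ce E' (pm_si_fw pm) // (pm_si_rk pm) // (pm_al_fw pm) negbK; split=> //.
by rewrite (pm_si_edg pm) ?si_end // (pm_si_xed pm) // al_edg.
Qed.

(** The two sides not at the vertex lie on the first crossing edges of the corner, and these cross
    at the opposite corner. Ranks and directions are recorded in order to locate that crossing along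
    the edge. *)
Lemma quad1P r : rl r -> nextc (si^-1%g r) -> fv r = 1 -> fx r = 3 -> let a := si^-1%g r in
  [/\ ~~ rl (phi (phi r)), edg (phi (phi r)) = ce a, xed (phi (phi r)) = ce r &
   [/\ rk (phi a) = rk (al (phi (phi r))), fw (phi a) = fw (phi (phi r)),
       ~~ rl (al (phi r)), edg (al (phi r)) = ce r & xed (al (phi r)) = ce a]].
Proof.
move=> rr ca v1 x3 a; have N : #|porbit phi r| = 4 by rewrite face_size v1 x3.
have := fv_unroll N; rewrite /= !big_cons big_nil v1 rr => h.
have e3 := phi_last (n := 3) (face_iter N); rewrite /= -/a in e3.
have n2 : ~~ rl (phi (phi r)) by case: (rl (phi (phi r))) h; case: (rl (phi r)).
have n3 : ~~ rl (phi (phi (phi r))).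
  by case: (rl (phi (phi (phi r)))) h; case: (rl (phi (phi r))); case: (rl (phi r)).
have [k1 k2] := phi_cross n2; have [k3 k4] := phi_cross n3.
have k5 : edg (phi (phi r)) = ce a by rewrite -k4 e3 xed_next.
have nn : endv (al (phi (phi r))) = None by apply: rlN; rewrite -rl_phi.
have E' : phi a = si (si (al (phi (phi r)))) by rewrite -[in RHS]phiE e3 -phiE.
split=> //; rewrite E' (pm_si_fw pm) // (pm_si_rk pm) // (pm_al_fw pm) negbK.
by split; rewrite // -?rl_phi // -?k1 // al_edg.
Qed.

(** If the two first crossing edges were one edge, the side opposite to the vertex would join two
    crossings of its own edge with it. *)
Lemma pent1P r : rl r -> nextc (si^-1%g r) -> fv r = 1 -> fx r = 4 -> ce r <> ce (si^-1%g r).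
Proof.
move=> rr ca v1 x4; set a := si^-1%g r in ca *.
have N : #|porbit phi r| = 5 by rewrite face_size v1 x4.
have := fv_unroll N; rewrite /= !big_cons big_nil v1 rr => h.
have e4 := phi_last (n := 4) (face_iter N); rewrite /= -/a in e4.
have [n1 n2 n3 n4] : [/\ ~~ rl (phi r), ~~ rl (phi (phi r)), ~~ rl (phi (phi (phi r))) &
    ~~ rl (phi (phi (phi (phi r))))].
  by move: h; do 4! case: (rl _).
have [k1 k2] := phi_cross n2; have [k3 k4] := phi_cross n3; have [k5 k6] := phi_cross n4.
move=> ee; apply: (@al_rk_neq (phi (phi r))); apply: cross_rk => //.
  by rewrite -rl_phi.
by rewrite k2 -k3 -k6 e4 xed_next.
Qed.

Lemma face22P r : rl r -> nextc r -> nextc (si^-1%g r) -> fv r = 2 -> fx r = 2 ->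
  exists w, [/\ incident (ce r) w, incident (ce (si^-1%g r)) w & ce r <> ce (si^-1%g r)].
Proof.
move=> rr cr ca v2 x2; set a := si^-1%g r in ca *.
have N : #|porbit phi r| = 4 by rewrite face_size v2 x2.
have := fv_unroll N; rewrite /= !big_cons big_nil v2 rr (negPf cr) => h.
have e3 := phi_last (n := 3) (face_iter N); rewrite /= -/a in e3.
have n3 : ~~ rl (phi (phi (phi r))) by rewrite e3 -rl_phi.
have r2 : rl (phi (phi r)) by move: h; rewrite (negPf n3); case: (rl _).
have [k3 k4] := phi_cross n3; have [w wE] := rlP _ r2.
have ea : ce a = edg (phi (phi r)) by rewrite -k4 e3 xed_next.
exists w; rewrite ea; split; [exact: incident_head|exact: incident_dart|].
have ra : rl (al (phi r)) by rewrite -rl_phi.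
by have [] := si_edg_neq ra; rewrite -phiE al_edg => /nesym.
Qed.

(** If the two first crossing edges were one edge, it would end at the other vertex of the face and
    be crossed by another edge ending there. *)
Lemma face23P r : rl r -> nextc r -> nextc (si^-1%g r) -> fv r = 2 -> fx r = 3 ->
  ce r <> ce (si^-1%g r).
Proof.
move=> rr cr ca v2 x3; set a := si^-1%g r in ca *.
have N : #|porbit phi r| = 5 by rewrite face_size v2 x3.
have := fv_unroll N; rewrite /= !big_cons big_nil v2 rr (negPf cr) => h.
have e4 := phi_last (n := 4) (face_iter N); rewrite /= -/a in e4.
have n4 : ~~ rl (phi (phi (phi (phi r)))) by rewrite e4 -rl_phi.
have [k5 k6] := phi_cross n4.
have ea : ce a = edg (phi (phi (phi r))) by rewrite -k6 e4 xed_next.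
move=> ee; have [/rlP[w wE]|n2] := boolP (rl (phi (phi r))).
  have n3 : ~~ rl (phi (phi (phi r))).
    by move: h; rewrite (negPf n4) {1}/rl wE; case: (rl _).
  have [k3 k4] := phi_cross n3.
  apply: (@crossing_adj (ce a) (edg (phi (phi r))) w).
  - by rewrite -ee; exact: incident_head.
  - exact: incident_dart.
  by rewrite -k4 ea; exact: crossing_dart.
have r3 : rl (phi (phi (phi r))) by move: h; rewrite (negPf n4) (negPf n2); case: (rl _).
have [w wE] := rlP _ r3; have [k3 k4] := phi_cross n2.
apply: (@crossing_adj (edg (phi (phi r))) (ce r) w).
- exact: incident_head.
- by rewrite ee ea; exact: incident_dart.
by rewrite -[ce r]k4; exact: crossing_dart.
Qed.

(** If the two first crossing edges were one edge, it would be parallel to the side that joins the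
    other two vertices. *)
Lemma face32P r : rl r -> nextc r -> nextc (si^-1%g r) -> fv r = 3 -> fx r = 2 ->
  ce r <> ce (si^-1%g r).
Proof.
move=> rr cr ca v3 x2; set a := si^-1%g r in ca *.
have N : #|porbit phi r| = 5 by rewrite face_size v3 x2.
have := fv_unroll N; rewrite /= !big_cons big_nil v3 rr (negPf cr) => h.
have e4 := phi_last (n := 4) (face_iter N); rewrite /= -/a in e4.
have n4 : ~~ rl (phi (phi (phi (phi r)))) by rewrite e4 -rl_phi.
have [k5 k6] := phi_cross n4.
have ea : ce a = edg (phi (phi (phi r))) by rewrite -k6 e4 xed_next.
have [r2 r3] : rl (phi (phi r)) /\ rl (phi (phi (phi r))).
  by move: h; rewrite (negPf n4); do 2! case: (rl _).
have [w wE] := rlP _ r2; have [z zE] := rlP _ r3.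
move=> ee; apply: (incident2 wE zE); apply: (@parallel (ce a) (edg (phi (phi r)))).
- by rewrite -ee; exact: incident_head.
- by rewrite ea; exact: incident_dart.
- exact: incident_dart.
- exact: incident_head.
have ra : rl (al (phi r)) by rewrite -rl_phi.
by have [] := si_edg_neq ra; rewrite -phiE al_edg -ee => /nesym.
Qed.

Lemma fv_gt0 r : rl r -> 0 < fv r.
Proof.
move=> rr; apply: (@face_count rl r [:: r]) => // y; rewrite inE => /eqP->.
by rewrite porbit_id.
Qed.

Lemma fv_gt1 r y : rl r -> rl y -> y \in porbit phi r -> y != r -> 1 < fv r.
Proof.
move=> rr ry yr ne; apply: (@face_count rl r [:: r; y]); first by rewrite /= inE eq_sym ne.
by move=> u; rewrite !inE => /orP[] /eqP->; rewrite ?porbit_id ?rr ?yr ?ry.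
Qed.

Lemma fx_gt0 r y : ~~ rl y -> y \in porbit phi r -> 0 < fx r.
Proof.
move=> ny yr; apply: (@face_count (fun y => ~~ rl y) r [:: y]) => // u.
by rewrite inE => /eqP->; rewrite yr ny.
Qed.

Lemma corner00 r : rl r -> ~~ nextc r -> ~~ nextc (si^-1%g r) ->
  14 <= share r /\ (24 <= share r \/ [/\ phi (phi (phi r)) = r, rl (phi r) & rl (phi (phi r))]).
Proof.
move=> rr cr ca; have ca' := ca; rewrite -phiV_nextc negbK in ca'.
rewrite /nextc negbK in cr.
have v3 : 2 < fv r.
  apply: (@face_count rl r [:: r; phi r; phi^-1%g r]); first exact: uniq_face3.
  by move=> y; rewrite !inE => /or3P[] /eqP->; rewrite ?porbit_id ?phi_face ?phiV_face ?rr ?cr ?ca'.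
have := @fz_gt0 r; move: v3; rewrite /share gapsE (negPf ca) /nextc cr /= muln0 addn0 /share_const.
case vE : (fv r) => [|[|[|[|v]]]] //= _; last by split; [|left].
have [->|z1] := eqVneq (fz r) 1; first by split; [|left].
move=> zx; split; first by lia.
have [z0|zp] := posnP (fz r); last by left; lia.
have x0 : fx r = 0 by move: zx; rewrite z0; case: (fx r) => // x /(_ isT isT).
right; have N : #|porbit phi r| = 3 by rewrite face_size vE x0.
have E' := face_iter N; rewrite /= in E'; split=> //.
have -> : phi (phi r) = phi^-1%g r by rewrite -[in RHS]E' permK.
by [].
Qed.

(** The smaller the guaranteed share, the more is recorded about the face. Around a vertex, shares
    that sum to less than 42 are then refuted by what is recorded. *)
Lemma corner11 r : rl r -> nextc r -> nextc (si^-1%g r) -> ~~ tri1 r ->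
  [\/ [/\ 12 <= share r, fv r = 1 & fx r = 3],
      24 <= share r /\ (exists w, [/\ incident (ce r) w, incident (ce (si^-1%g r)) w &
        ce r <> ce (si^-1%g r)]),
      34 <= share r /\ ce r <> ce (si^-1%g r) | 42 <= share r].
Proof.
move=> rr cr ca nt; have v0 := fv_gt0 rr.
have cp := ca; rewrite -phiV_nextc in cp.
have x2 : 1 < fx r.
  apply: (@face_count (fun y => ~~ rl y) r [:: phi r; phi^-1%g r]).
    by have := uniq_face3 r; rewrite /= => /andP[].
  by move=> y; rewrite !inE => /orP[] /eqP->; rewrite ?phi_face ?phiV_face ?cp ?cr.
have z2 := fz_ge2 rr cr cp.
have nt' : fv r = 1 -> fx r <> 2 by move=> v1 xE; move: nt; rewrite /tri1 rr v1 xE.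
have K41 := @pent1P r rr ca; have K22 := @face22P r rr cr ca.
have K23 := @face23P r rr cr ca; have K32 := @face32P r rr cr ca.
have zx := fz_le_fx r.
move: v0 x2 z2 nt' K41 K22 K23 K32 zx.
rewrite /share gapsE cr ca /share_const /share_gap.
move: (fv r) (fx r) (fz r) => v x z.
case: v => [|[|[|[|v]]]] //= _; rewrite ?mul0n ?addn0; last by move=> *; constructor 4.
- case: x => [|[|[|[|[|x]]]]] // _ _ nt' K41 _ _ _ _.
  + by case: nt'.
  + by constructor 1.
  + by constructor 3; split=> //; exact: K41.
  by constructor 4; have -> : (x.+4 < 2) = false by []; lia.
- case: x => [|[|[|[|x]]]] // _ /(_ isT) z2 _ _ K22 K23 _ zx.
  + by constructor 2; split; [lia|exact: K22].
  + by constructor 3; split; [lia|exact: K23].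
  by constructor 4; lia.
move=> x2 /(_ isT) z2 _ _ _ _ K32 zx; rewrite (gtn_eqF z2) /= addn0.
case: x x2 zx K32 => [|[|[|x]]] // _ zx K32.
  by constructor 3; split; [lia|exact: K32].
by constructor 4; lia.
Qed.

Lemma corner01 r : rl r -> nextc r != nextc (si^-1%g r) ->
  [\/ [/\ 9 <= share r, fv r = 2 & fx r = 1], [/\ 21 <= share r, fv r = 2 & fx r = 2],
      [/\ 24 <= share r, fv r = 3 & fx r = 1] | 33 <= share r].
Proof.
move=> rr cc; have cp := phiV_nextc r.
have := uniq_face3 r; rewrite /= !inE negb_or => /and3P[/andP[f1 f2] f3 _].
have v2 : 1 < fv r.
  have [cr|cr] := boolP (nextc r).
    apply: (@fv_gt1 r (phi^-1%g r)); rewrite ?phiV_face // 1?eq_sym //.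
    by rewrite -[rl _]negbK cp; move: cc; rewrite cr; case: (nextc _).
  by apply: (@fv_gt1 r (phi r)); rewrite ?phi_face // 1?eq_sym //; rewrite /nextc negbK in cr.
have x1 : 0 < fx r.
  have [cr|cr] := boolP (nextc r); first exact: fx_gt0 cr (phi_face r).
  apply: (@fx_gt0 r (phi^-1%g r)); last exact: phiV_face.
  by rewrite cp; move: cc; rewrite (negPf cr); case: (nextc _).
have := fz_gt0 (ltnW v2) x1; have := fz_le_fx r; move: v2 x1.
rewrite /share gapsE (_ : nextc r + nextc (si^-1%g r) = 1); last first.
  by move: cc; case: (nextc r); case: (nextc _).
rewrite /share_const /share_gap.
move: (fv r) (fx r) (fz r) => v x z.
case: v => [|[|[|[|v]]]] //= _; rewrite ?mul0n ?addn0; last by move=> *; constructor 4.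
- case: x => [|[|[|x]]] // _ zx z0.
  + by constructor 1; split=> //; lia.
  + by constructor 2; split=> //; lia.
  by constructor 4; lia.
move=> x1 zx z0; have [_|z1] := eqVneq z 1.
  case: x x1 zx => [|[|x]] // _ zx; first by constructor 3.
  by constructor 4; lia.
by constructor 4; lia.
Qed.

(* The next two lemmas describe a corner between the uncrossed edge of q, which
   ends at w, and the crossed edge of t: first q = r, then t = r. *)
Lemma corner_out r w : rl r -> ~~ nextc r -> nextc (si^-1%g r) ->
  endv (al r) = Some w -> let t := si^-1%g r in
  [\/ [/\ 9 <= share r, incident (ce t) w & edg (si (al r)) = ce t],
      21 <= share r /\ (exists h, incident h w /\ crossing h (ce t)),
      24 <= share r /\ ~ incident (ce t) w | 33 <= share r].
Proof.
move=> rr cr ca wE t; have wP : endv (phi r) = Some w by rewrite end_phi.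
have rp : rl (phi r) by rewrite /nextc negbK in cr.
have eq_face n : fv r + fx r = n.+1 -> iter n phi r = al t.
  by rewrite -face_size => N; apply: phi_last; exact: face_iter.
have nt : ~~ rl (al t) by rewrite -rl_phi.
case: (corner01 rr); rewrite ?(negPf cr) ?ca //; last by constructor 4.
- move=> [h v2 x1]; have e2 := eq_face 2 ltac:(by rewrite v2 x1); rewrite /= in e2.
  have n2 : ~~ rl (phi (phi r)) by rewrite e2.
  have [k1 k2] := phi_cross n2.
  have et : ce t = edg (phi r) by rewrite -k2 e2 xed_next.
  constructor 1; split=> //; first by rewrite et; exact: incident_dart.
  by rewrite et -phiE.
- move=> [h v2 x2]; have N : #|porbit phi r| = 4 by rewrite face_size v2 x2.
  have := fv_unroll N; rewrite /= !big_cons big_nil v2 rr rp => hs.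
  have e3 := eq_face 3 ltac:(by rewrite v2 x2); rewrite /= in e3.
  have n3 : ~~ rl (phi (phi (phi r))) by rewrite e3.
  have n2 : ~~ rl (phi (phi r)) by move: hs; case: (rl (phi (phi r))); case: (rl _).
  have [k1 k2] := phi_cross n2; have [k3 k4] := phi_cross n3.
  have et : ce t = edg (phi (phi r)) by rewrite -k4 e3 xed_next.
  constructor 2; split=> //; exists (edg (phi r)); split; first exact: incident_dart.
  by rewrite et -k2; apply: crossing_sym; exact: crossing_dart.
move=> [h v3 x1]; have N : #|porbit phi r| = 4 by rewrite face_size v3 x1.
have := fv_unroll N; rewrite /= !big_cons big_nil v3 rr rp => hs.
have e3 := eq_face 3 ltac:(by rewrite v3 x1); rewrite /= in e3.
have n3 : ~~ rl (phi (phi (phi r))) by rewrite e3.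
have r2 : rl (phi (phi r)) by move: hs; rewrite (negPf n3); case: (rl _).
have [k3 k4] := phi_cross n3; have [z zE] := rlP _ r2.
have et : ce t = edg (phi (phi r)) by rewrite -k4 e3 xed_next.
constructor 3; split=> // iw; apply: (incident2 wP zE).
apply: (@parallel (ce t) (edg (phi r))) => //.
- by rewrite et; exact: incident_dart.
- exact: incident_dart.
- exact: incident_head.
have ra : rl (al (phi r)) by rewrite -rl_phi.
by have [] := si_edg_neq ra; rewrite -phiE al_edg et.
Qed.

Lemma corner_in r w : rl r -> nextc r -> ~~ nextc (si^-1%g r) ->
  let q := si^-1%g r in endv (al q) = Some w ->
  [\/ [/\ 9 <= share r, incident (ce r) w & edg (si^-1%g (al q)) = ce r],
      21 <= share r /\ (exists h, incident h w /\ crossing h (ce r)),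
      24 <= share r /\ ~ incident (ce r) w | 33 <= share r].
Proof.
move=> rr cr ca q wE.
have rq : rl (al q) by rewrite /rl wE.
have eq_face n : fv r + fx r = n.+1 -> iter n phi r = al q.
  by rewrite -face_size => N; apply: phi_last; exact: face_iter.
case: (corner01 rr); rewrite ?(negPf ca) ?cr //; last by constructor 4.
- move=> [h v2 x1]; have e2 := eq_face 2 ltac:(by rewrite v2 x1); rewrite /= in e2.
  constructor 1; split=> //; first by apply: incident_head; rewrite e2.
  by rewrite -e2 phiE permK al_edg.
- move=> [h v2 x2]; have N : #|porbit phi r| = 4 by rewrite face_size v2 x2.
  have e3 := eq_face 3 ltac:(by rewrite v2 x2); rewrite /= in e3.
  have := fv_unroll N; rewrite /= !big_cons big_nil v2 rr (negPf cr) e3 rq => hs.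
  have n2 : ~~ rl (phi (phi r)) by move: hs; case: (rl (phi (phi r))).
  have [k1 k2] := phi_cross n2.
  constructor 2; split=> //; exists (edg (phi (phi r))).
  split; first by apply: incident_head; rewrite e3.
  by rewrite -[ce r]k2; exact: crossing_dart.
move=> [h v3 x1]; have N : #|porbit phi r| = 4 by rewrite face_size v3 x1.
have e3 := eq_face 3 ltac:(by rewrite v3 x1); rewrite /= in e3.
have := fv_unroll N; rewrite /= !big_cons big_nil v3 rr (negPf cr) e3 rq => hs.
have r2 : rl (phi (phi r)) by move: hs; case: (rl (phi (phi r))).
have [z zE] := rlP _ r2.
have wE' : endv (phi (phi (phi r))) = Some w by rewrite e3.
constructor 3; split=> // iw; apply: (incident2 zE wE').
apply: (@parallel (ce r) (edg (phi (phi r)))) => //.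
- exact: incident_head.
- exact: incident_dart.
- exact: incident_head.
have ra : rl (al (phi r)) by rewrite -rl_phi.
by have [] := si_edg_neq ra; rewrite -phiE al_edg => /nesym.
Qed.

(** An uncrossed edge bounds two corners and is credited 7 in each, so three of them already make
    42. *)
Lemma corner_ge7 y : rl y -> 7 * (~~ nextc y + ~~ nextc (si^-1%g y)) <= share y.
Proof.
move=> ry; have [cy|cy] := boolP (nextc y); have [ca|ca] := boolP (nextc (si^-1%g y)) => //.
- have cc : nextc y != nextc (si^-1%g y) by rewrite cy (negPf ca).
  by case: (corner01 ry cc) => [[h _ _]|[h _ _]|[h _ _]|h]; lia.
- have cc : nextc y != nextc (si^-1%g y) by rewrite (negPf cy) ca.
  by case: (corner01 ry cc) => [[h _ _]|[h _ _]|[h _ _]|h]; lia.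
by have [] := corner00 ry cy ca.
Qed.

Lemma quad_crossing r : rl r -> nextc (si^-1%g r) -> fv r = 1 -> fx r = 3 ->
  crossing (ce (si^-1%g r)) (ce r).
Proof.
move=> rr ca v1 x3; have [n k1 k2 _] := quad1P rr ca v1 x3.
by rewrite -k1 -k2; exact: crossing_dart.
Qed.

(** * Collecting 42 around a vertex *)

Section Vertex.
Variable r0 : D.
Hypothesis real0 : rl r0.
Let dt k := iter k si r0.
Let dg := #|porbit si r0|.

Let rl_dt k : rl (dt k).
Proof. by elim: k => //= k IH; rewrite rl_si. Qed.

Let dt_dg : dt dg = r0.
Proof. exact: iter_porbit. Qed.

Let dg_gt2 : 2 < dg.
Proof.
have [v vE] := rlP _ real0; have [d1 d2] := pm_deg pm vE.
have p0 : 0 < dg by rewrite lt0n card_porbit_neq0.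
have := dt_dg; move: p0; case: dg => [|[|[|n]]] //= _ /eqP E'.
  by rewrite /dt /= (negPf d1) in E'.
by rewrite /dt /= (negPf d2) in E'.
Qed.

Let siV_dt k : si^-1%g (dt k.+1) = dt k.
Proof. by rewrite /dt /= permK. Qed.

Let siV_dt0 : si^-1%g r0 = dt dg.-1.
Proof. by rewrite -siV_dt prednK ?dt_dg //; case: dg dg_gt2. Qed.

Let dt_inj i j : i < dg -> j < dg -> dt i = dt j -> i = j.
Proof.
move=> ih jh E'; have U := uniq_traject_porbit si r0.
apply/eqP; rewrite -(nth_uniq r0 _ _ U) ?size_traject //.
by rewrite !nth_traject //; apply/eqP.
Qed.

Let sum_dt (g : D -> nat) : \sum_(y in porbit si r0) g y = \sum_(k <- iota 0 dg) g (dt k).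
Proof.
have -> : \sum_(k <- iota 0 dg) g (dt k) = \sum_(y <- traject si r0 dg) g y.
  rewrite -[traject si r0 dg](mkseq_nth r0) size_traject big_map.
  apply: eq_big_seq => k; rewrite mem_iota => /andP[_ kd].
  by rewrite nth_traject.
rewrite -big_enum /=; apply: perm_big; apply: uniq_perm.
- exact: enum_uniq.
- exact: uniq_traject_porbit.
by move=> y; rewrite mem_enum porbit_traject.
Qed.

Let sum_ge (L : seq nat) m : uniq L -> all (fun k => k < dg) L ->
  m <= \sum_(k <- L) share (dt k) -> m <= \sum_(y in porbit si r0) share y.
Proof.
move=> uL /allP aL h; apply: leq_trans h _; rewrite sum_dt.
have pL : perm_eq L [seq i <- iota 0 dg | i \in L].
  apply: uniq_perm => //; first by rewrite filter_uniq ?iota_uniq.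
  move=> k; rewrite mem_filter mem_iota add0n /=.
  by case: (boolP (k \in L)) => [/aL|].
by rewrite (perm_big _ pL) big_filter [leqRHS](bigID (mem L)) /= leq_addr.
Qed.

(** [tri1_run] iterated: the first crossing edge is the same all along, and the rank on it moves by
    at least one per triangle, always in the same direction. *)
Let run i j : i <= j -> (forall k, i < k -> k <= j -> tri1 (dt k)) ->
  [/\ ce (dt i) = ce (dt j), fw (phi (dt i)) = fw (phi (dt j)) &
     if fw (phi (dt i)) then rk (phi (dt j)) + (j - i) <= rk (phi (dt i))
     else rk (phi (dt i)) + (j - i) <= rk (phi (dt j))].
Proof.
elim: j => [|j IH]; first by rewrite leqn0 => /eqP->; rewrite subnn addn0; case: ifP.
rewrite leq_eqVlt => /orP[/eqP-> _|ij h]; first by rewrite subnn addn0; case: ifP.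
have [k|e1 e2 e3] := IH ij; first by move=> ik kj; apply: h => //; exact: leqW.
have := tri1_run (h j.+1 ij (leqnn _)); rewrite siV_dt => -[f1 f2 f3].
rewrite e1 f1 e2 f2; split=> //; move: e3; rewrite e2 f2 subSn // addnS.
case f : (fw (phi (dt j.+1))).
  by have := pm_al_rk pm f; rewrite -f3 => h1 h2; apply: leq_trans h2; rewrite ltn_add2r.
have f' : fw (al (phi (dt j.+1))) by rewrite (pm_al_fw pm) f.
by have := pm_al_rk pm f'; rewrite alK -f3 addnS => h1 h2; exact: (leq_ltn_trans h2 h1).
Qed.

Lemma vertex_uncrossed3 : 2 < \sum_(y in porbit si r0) ~~ nextc y ->
  42 <= \sum_(y in porbit si r0) share y.
Proof.
set u := (X in 2 < X) => u3.
have le : \sum_(y in porbit si r0) 7 * (~~ nextc y + ~~ nextc (si^-1%g y)) <=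
    \sum_(y in porbit si r0) share y.
  apply: leq_sum => y yr; apply: corner_ge7.
  by move: yr; rewrite porbit_traject => /trajectP[k _ ->]; exact: rl_dt.
apply: leq_trans le; rewrite -big_distrr /= big_split /=.
have -> : \sum_(y in porbit si r0) ~~ nextc (si^-1%g y) = u.
  rewrite [LHS](reindex_inj (@perm_inj _ si)); apply: eq_big => y; last by rewrite permK.
  apply/idP/idP => h; last by apply: porbit_trans h (porbit_step _ _).
  by apply: porbit_trans h _; rewrite porbit_sym porbit_step.
lia.
Qed.

(** Corners other than 1-triangles give at least 12 each, and between two consecutive ones the first
    crossing edge does not change. So the edges seen on the two sides of these corners fit together
    cyclically. *)
Lemma vertex_all_crossed : (forall k, nextc (dt k)) -> ~~ tri1 r0 ->
  42 <= \sum_(y in porbit si r0) share y.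
Proof.
move=> cr nt0; pose L := [seq k <- iota 1 dg.-1 | ~~ tri1 (dt k)].
have d0 : 0 < dg by apply: ltn_trans dg_gt2.
have LP k : (k \in L) = [&& 0 < k, k < dg & ~~ tri1 (dt k)].
  by rewrite mem_filter mem_iota add1n prednK // andbC -andbA.
have notL k : 0 < k -> k < dg -> k \notin L -> tri1 (dt k).
  by move=> k0 kd; rewrite LP k0 kd negbK.
have sL : sorted ltn L.
  by apply: sorted_filter; [exact: ltn_trans|exact: iota_ltn_sorted].
have C k : ~~ tri1 (dt k) -> nextc (si^-1%g (dt k)) -> _ := fun t a => corner11 (rl_dt k) (cr k) a t.
have a0 : nextc (si^-1%g (dt 0)) by rewrite -[dt 0]/r0 siV_dt0.
have aS k : nextc (si^-1%g (dt k.+1)) by rewrite siV_dt.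
have ge12 k : k \in 0 :: L -> 12 <= share (dt k).
  rewrite inE LP => /orP[/eqP->|/and3P[k0 _ nt]].
    by case: (C 0 nt0 a0) => [[h _ _]|[h _]|[h _]|h]; exact: leq_trans h.
  by case: k k0 nt => // k _ nt; case: (C _ nt (aS k)) => [[h _ _]|[h _]|[h _]|h]; exact: leq_trans h.
have last_run i : i < dg -> (forall k, i < k -> k < dg -> k \notin L) ->
    ce (dt i) = ce (si^-1%g r0).
  move=> id' h; rewrite siV_dt0; have [|k ik kd|-> //] := @run i dg.-1; first by rewrite -ltnS prednK.
  have kd' : k < dg by rewrite -[dg]prednK.
  by apply: notL (h _ ik kd') => //; apply: leq_ltn_trans ik.
have mid_run i j : i < j -> j < dg -> (forall k, i < k -> k < j -> k \notin L) ->
    ce (dt i) = ce (si^-1%g (dt j)).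
  case: j => // j ij jd h; rewrite siV_dt; have [//|k ik kj|-> //] := @run i j.
  by apply: notL (h _ ik _) => //; [apply: leq_ltn_trans ik|apply: leq_ltn_trans kj (ltnW jd)].
(* By the number of corners that are not 1-triangles, [r0] included: one, two, three, or at least
   four, when [4 * 12 >= 42]. *)
case E' : L sL notL last_run mid_run ge12 => [|i [|j [|k L']]] sL notL last_run mid_run ge12.
- have e := last_run 0 d0 (fun _ _ _ => isT).
  case: (C 0 nt0 a0) => [[_ v1 x3]|[_ [w [_ _ ne]]]|[_ ne]|h].
  + by have := crossing_neq (quad_crossing real0 a0 v1 x3); rewrite -e.
  + by case: ne.
  + by case: ne.
  by apply: (sum_ge (L := [:: 0])); rewrite /= ?d0 // big_seq1.
- have : i \in L by rewrite E' inE.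
  rewrite LP => /and3P[i0 id' nti].
  have e2 : ce (dt i) = ce (si^-1%g r0).
    by apply: last_run => // k ik _; rewrite inE neq_ltn ik orbT.
  have e1 : ce (dt 0) = ce (si^-1%g (dt i)).
    by apply: mid_run => // k _ ki; rewrite inE neq_ltn ki.
  have ai : nextc (si^-1%g (dt i)) by case: (i) i0 => // i' _; exact: aS.
  have S2 m : m <= share (dt 0) + share (dt i) -> m <= \sum_(y in porbit si r0) share y.
    move=> h; apply: (sum_ge (L := [:: 0; i])); rewrite /= ?inE ?andbT.
    * by rewrite eq_sym -lt0n.
    * by rewrite d0.
    by rewrite big_cons big_seq1.
  have H1 := C 0 nt0 a0; have H2 := C i nti ai.
  case: H1 => [[h1 v1 x1]|[h1 [w [iw iw' _]]]|[h1 _]|h1].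
  + have q1 := quad_crossing real0 a0 v1 x1.
    case: H2 => [[h2 v2 x2]|[h2 [w [iw iw' _]]]|[h2 _]|h2]; [|exfalso|apply: S2; exact: leq_trans (leq_add h1 h2)|apply: S2; exact: leq_trans (leq_add h1 h2)].
      (* Two quadrilaterals: both have as a corner the unique crossing of the same two edges. Along
         the edge followed by the run from 0 to [i], one quadrilateral places it before all
         crossings of the run and the other after them. *)
      exfalso; have [m1 g1 g2 [g3 g4 g5 g6 g7]] := quad1P real0 a0 v1 x1.
      have [m2 k1 k2 [k3 k4 k5 k6 k7]] := quad1P (rl_dt i) ai v2 x2.
      have rE : rk (phi (phi (dt i))) = rk (al (phi r0)).
        by apply: cross_rk => //; rewrite ?g6 ?g7 ?k1 ?k2 ?e2 // -e1.
      have [i' E2] : exists i', i = i'.+1 by case: (i) i0 => // i' _; exists i'.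
      subst i; rewrite siV_dt in k3 k4; have [//|k k0 ki|_ f1 f2] := @run 0 i'.
        apply: notL => //; first by apply: leq_ltn_trans ki (ltnW id').
        by rewrite inE neq_ltn ltnS ki.
      move: f2; rewrite f1 k4 -[dt 0]/r0 subn0.
      case f : (fw (phi (phi (dt i'.+1)))).
        have := pm_al_rk pm f; rewrite -k3.
        have f' : fw (phi r0) by rewrite -[r0]/(dt 0) f1 k4.
        have := pm_al_rk pm f'; rewrite -rE => a b c.
        by have := leq_trans (leq_addr i' _) c; rewrite leqNgt (ltn_trans a b).
      have f' : fw (al (phi r0)) by rewrite (pm_al_fw pm) -[r0]/(dt 0) f1 k4 f.
      have f'' : fw (al (phi (phi (dt i'.+1)))) by rewrite (pm_al_fw pm) f.
      have := pm_al_rk pm f'; have := pm_al_rk pm f''; rewrite !alK -k3 -rE => a b c.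
      by have := leq_trans (leq_addr i' _) c; rewrite leqNgt (ltn_trans a b).
    have q : crossing (ce (dt i)) (ce (si^-1%g (dt i))) by rewrite e2 -e1.
    exact: crossing_adj iw iw' q.
  + case: H2 => [[h2 v2 x2]|[h2 _]|[h2 _]|h2]; [exfalso|..]; try by apply: S2; exact: leq_trans (leq_add h1 h2).
    have q2 := quad_crossing (rl_dt i) ai v2 x2.
    have q : crossing (ce (dt 0)) (ce (si^-1%g r0)) by rewrite e1 -e2.
    exact: crossing_adj iw iw' q.
  + have h2 := ge12 i; rewrite !inE eqxx orbT in h2.
    by apply: S2; exact: leq_trans (leq_add h1 (h2 isT)).
  by apply: S2; exact: leq_trans (leq_trans h1 (leq_addr _ _)).
- have /= := sL; rewrite andbT => ij.
  have : i \in L by rewrite E' inE eqxx.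
  rewrite LP => /and3P[i0 id' nti].
  have : j \in L by rewrite E' !inE eqxx orbT.
  rewrite LP => /and3P[j0 jd ntj].
  have e1 : ce (dt 0) = ce (si^-1%g (dt i)).
    by apply: mid_run => // k _ ki; rewrite !inE negb_or !neq_ltn ki (ltn_trans ki ij).
  have e2 : ce (dt i) = ce (si^-1%g (dt j)).
    by apply: mid_run => // k ik kj; rewrite !inE negb_or !neq_ltn ik kj orbT.
  have e3 : ce (dt j) = ce (si^-1%g r0).
    by apply: last_run => // k jk _; rewrite !inE negb_or !neq_ltn jk (ltn_trans ij jk) !orbT.
  have S3 m : m <= share (dt 0) + (share (dt i) + share (dt j)) ->
      m <= \sum_(y in porbit si r0) share y.
    move=> h; apply: (sum_ge (L := [:: 0; i; j])); rewrite /= ?inE ?andbT.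
    * by rewrite negb_or ![0 == _]eq_sym -!lt0n i0 j0 neq_ltn ij.
    * by rewrite d0 id'.
    by rewrite !big_cons big_nil addn0.
  have g0 := ge12 0; have gi := ge12 i; have gj := ge12 j.
  rewrite !inE !eqxx ?orbT in g0 gi gj; move: (g0 isT) (gi isT) (gj isT) => {}g0 {}gi {}gj.
  have ai : nextc (si^-1%g (dt i)) by case: (i) i0 => // i' _; exact: aS.
  have aj : nextc (si^-1%g (dt j)) by case: (j) j0 => // j' _; exact: aS.
  case: (C 0 nt0 a0) => [[h1 v1 x1]|[h1 _]|[h1 _]|h1]; try by apply: S3; exact: leq_trans (leq_add h1 (leq_add gi gj)).
  case: (C i nti ai) => [[h2 v2 x2]|[h2 _]|[h2 _]|h2]; try by apply: S3; exact: leq_trans (leq_add g0 (leq_add h2 gj)).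
  case: (C j ntj aj) => [[h3 v3 x3]|[h3 _]|[h3 _]|h3]; try by apply: S3; exact: leq_trans (leq_add g0 (leq_add gi h3)).
  (* Only three quadrilaterals remain, with a total of 36; their first crossing edges would cross
     pairwise. *)
  have q1 := quad_crossing real0 a0 v1 x1.
  have q2 := quad_crossing (rl_dt i) ai v2 x2.
  have q3 := quad_crossing (rl_dt j) aj v3 x3.
  exfalso; apply: (@crossing_triple (ce (dt 0)) (ce (dt i)) (ce (dt j))).
  + by rewrite e1.
  + by rewrite e2.
  by rewrite e3; exact: crossing_sym.
have U : uniq (0 :: L).
  rewrite cons_uniq; apply/andP; split; first by rewrite LP.
  by rewrite filter_uniq ?iota_uniq.
apply: (sum_ge (L := 0 :: L)) => //.
  by apply/allP => u; rewrite inE LP => /orP[/eqP->|/and3P[]].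
rewrite E'; apply: leq_trans (_ : \sum_(u <- [:: 0, i, j, k & L']) 12 <= _).
  by rewrite big_const_seq count_predT iter_addn_0 /=; lia.
rewrite [leqLHS]big_seq_cond [leqRHS]big_seq_cond; apply: leq_sum => u /andP[hu _].
exact: ge12.
Qed.

Let nextc_end k : ~~ nextc (dt k) -> exists w, endv (al (dt k)) = Some w.
Proof. by rewrite /nextc negbK rl_phi => /rlP. Qed.

Let ge12 k : 0 < k -> nextc (dt k) -> nextc (dt k.-1) -> ~~ tri1 (dt k) -> 12 <= share (dt k).
Proof.
case: k => // k _ c1 c0 nt; rewrite /= -siV_dt in c0.
by case: (corner11 (rl_dt k.+1) c1 c0 nt) => [[h _ _]|[h _]|[h _]|h]; exact: leq_trans h.
Qed.

Let sum_ge2 i j : i < dg -> j < dg -> i != j ->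
  share (dt i) + share (dt j) <= \sum_(y in porbit si r0) share y.
Proof.
move=> id' jd ij; apply: (sum_ge (L := [:: i; j])); rewrite /= ?inE ?ij ?id' ?jd //.
by rewrite big_cons big_seq1.
Qed.

Let sum_ge3 i j k : i < dg -> j < dg -> k < dg -> i != j -> i != k -> j != k ->
  share (dt i) + share (dt j) + share (dt k) <= \sum_(y in porbit si r0) share y.
Proof.
move=> id' jd kd ij ik jk; apply: (sum_ge (L := [:: i; j; k])).
- by rewrite /= !inE negb_or ij ik jk.
- by rewrite /= id' jd kd.
by rewrite !big_cons big_nil addn0 addnA.
Qed.

Let sum_ge4 i j k l : i < dg -> j < dg -> k < dg -> l < dg -> uniq [:: i; j; k; l] ->
  share (dt i) + share (dt j) + share (dt k) + share (dt l) <=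
    \sum_(y in porbit si r0) share y.
Proof.
move=> id' jd kd ld u; apply: (sum_ge (L := [:: i; j; k; l])) => //.
  by rewrite /= id' jd kd ld.
by rewrite !big_cons big_nil addn0 !addnA.
Qed.

(** The two corners beside the uncrossed edge give at least 18. What [corner_out] and [corner_in]
    record about its far end [w] shows that the first crossing edge changes on the way round
    whenever more is needed, so a further corner contributes. *)
Lemma vertex_one_uncrossed : ~~ nextc r0 -> (forall k, 0 < k -> k < dg -> nextc (dt k)) ->
  42 <= \sum_(y in porbit si r0) share y.
Proof.
move=> n0 cr; have d0 : 0 < dg by apply: ltn_trans dg_gt2.
have d1 : 1 < dg by apply: ltn_trans dg_gt2.
have [w wE] := nextc_end (k := 0) n0.
have cl : nextc (dt dg.-1) by apply: cr; case: dg dg_gt2 => // [[|[|m]]].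
have c1 : nextc (dt 1) by exact: cr.
have a0 : nextc (si^-1%g r0) by rewrite siV_dt0.
have a1 : ~~ nextc (si^-1%g (dt 1)) by rewrite siV_dt.
have H0 := corner_out real0 n0 a0 wE; rewrite siV_dt0 /= in H0.
have H1 := corner_in (w := w) (rl_dt 1) c1 a1; rewrite siV_dt in H1; have {}H1 := H1 wE.
pose L := [seq k <- iota 2 (dg - 2) | ~~ tri1 (dt k)].
have LP k : (k \in L) = [&& 1 < k, k < dg & ~~ tri1 (dt k)].
  by rewrite mem_filter mem_iota subnKC // andbC -andbA.
have uL : uniq L by rewrite filter_uniq ?iota_uniq.
have s01 := sum_ge2 d0 d1 isT.
have L12 k : k \in L -> 12 <= share (dt k) /\
    share (dt 0) + share (dt 1) + share (dt k) <= \sum_(y in porbit si r0) share y.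
  rewrite LP => /and3P[k1 kd nt]; split.
    case: k k1 kd nt => [|[|k]] // k1 kd nt; apply: ge12 => //; first exact: cr.
    by apply: cr => //; exact: ltnW.
  by apply: sum_ge3 => //; rewrite neq_ltn ?k1 // ltnW.
have L0 : L = [::] -> ce (dt 1) = ce (dt dg.-1).
  move=> LE; have [|k k1 kd|-> //] := @run 1 dg.-1; first by rewrite -ltnS prednK.
  have kd' : k < dg by rewrite -[dg]prednK.
  by have := LP k; rewrite LE k1 kd' /= => /esym/negbFE.
rewrite -[r0]/(dt 0) in H0.
case: H0 => [[h0 i0 x0]|[h0 [e0 [ei0 ex0]]]|[h0 ni0]|h0];
case: H1 => [[h1 i1 x1]|[h1 [e1 [ei1 ex1]]]|[h1 ni1]|h1]; try by apply: leq_trans s01; exact: leq_trans (leq_add h0 h1).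
(* With 9 on both sides, the two first crossing edges end at [w], next to the uncrossed edge on
   either side. They differ because [w] has degree at least 3, and they do not cross because they
   are adjacent; so the rest contains two more corners, or one that gives at least 24. *)
- case LE : L L0 L12 uL => [|k [|k' L']] L0 L12 uL.
  + have rw : rl (si^-1%g (al r0)) by rewrite rl_siV /rl wE.
    have [_ []] := si_edg_neq rw; rewrite permKV x0 x1; exact/esym/L0.
  + have kL : k \in [:: k] by rewrite inE.
    have [hk s3] := L12 k kL; have := LP k; rewrite LE kL => /esym/and3P[k1 kd nt].
    have ck : nextc (dt k) by apply: cr => //; exact: ltnW.
    have notL j : 1 < j -> j < dg -> j != k -> tri1 (dt j).
      move=> j1 jd jk; have := LP j; rewrite LE inE (negPf jk) j1 jd /=.
      by move=> /esym/negbFE.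
    have e2 : ce (dt k) = ce (dt dg.-1).
      have [|j kj jd|-> //] := @run k dg.-1; first by rewrite -ltnS prednK.
      have jd' : j < dg by rewrite -[dg]prednK.
      by apply: notL => //; [exact: ltn_trans kj|rewrite neq_ltn kj orbT].
    case: k k1 kd nt ck notL e2 hk s3 kL LE L12 L0 uL => // k k1 kd nt ck notL e2 hk s3 _ _ _ _ _.
    have ck' : nextc (si^-1%g (dt k.+1)) by rewrite siV_dt; apply: cr => //; exact: ltnW.
    have e1 : ce (dt 1) = ce (dt k).
      have [//|j j1 jk|-> //] := @run 1 k.
      by apply: notL => //; [apply: leq_ltn_trans jk (ltnW kd)|rewrite neq_ltn ltnS jk].
    have [[_ v1 x3]|[{}hk _]|[{}hk _]|{}hk] := corner11 (rl_dt k.+1) ck ck' nt; last 3 first.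
    * by apply: leq_trans s3; exact: leq_trans (leq_add (leq_add h0 h1) hk).
    * by apply: leq_trans s3; exact: leq_trans (leq_add (leq_add h0 h1) hk).
    * by apply: leq_trans s3; exact: leq_trans (leq_add (leq_add h0 h1) hk).
    have q := quad_crossing (rl_dt k.+1) ck' v1 x3; rewrite siV_dt -e1 e2 in q.
    by case: (crossing_adj i1 i0 q).
  have kL : k \in [:: k, k' & L'] by rewrite inE eqxx.
  have kL' : k' \in [:: k, k' & L'] by rewrite !inE eqxx orbT.
  have [hk _] := L12 k kL; have [hk' _] := L12 k' kL'.
  have := LP k; rewrite LE kL => /esym/and3P[k1 kd _].
  have := LP k'; rewrite LE kL' => /esym/and3P[k1' kd' _].
  move: uL; rewrite /= !inE !negb_or => /andP[/andP[kk _] _].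
  have u4 : uniq [:: 0; 1; k; k'].
    by rewrite /= !inE !negb_or kk ![_ != k]neq_ltn ![_ != k']neq_ltn (ltnW k1) (ltnW k1') k1 k1'.
  apply: leq_trans (sum_ge4 d0 d1 kd kd' u4).
  exact: leq_trans (leq_add (leq_add (leq_add h0 h1) hk) hk').
- case LE : L L0 L12 => [|k L'] L0 L12.
    by rewrite -L0 // in i0; case: (crossing_adj ei1 i0 ex1).
  by have [hk s3] := L12 k (mem_head _ _); apply: leq_trans s3; exact: leq_trans (leq_add (leq_add h0 h1) hk).
- case LE : L L0 L12 => [|k L'] L0 L12; first by case: ni1; rewrite L0.
  by have [hk s3] := L12 k (mem_head _ _); apply: leq_trans s3; exact: leq_trans (leq_add (leq_add h0 h1) hk).
- case LE : L L0 L12 => [|k L'] L0 L12.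
    by rewrite -L0 // in ex0; case: (crossing_adj ei0 i1 ex0).
  by have [hk s3] := L12 k (mem_head _ _); apply: leq_trans s3; exact: leq_trans (leq_add (leq_add h0 h1) hk).
case LE : L L0 L12 => [|k L'] L0 L12; first by case: ni0; rewrite -L0.
by have [hk s3] := L12 k (mem_head _ _); apply: leq_trans s3; exact: leq_trans (leq_add (leq_add h0 h1) hk).
Qed.

(** The minimum [9 + 14 + 9] needs a triangle of three vertices in the middle. If all other corners
    were 1-triangles, a single edge would end at both far ends [w0] and [w1], parallel to the third
    side of that triangle; any other corner adds 12. *)
Lemma vertex_adjacent_uncrossed : ~~ nextc r0 -> ~~ nextc (dt 1) ->
  (forall k, 1 < k -> k < dg -> nextc (dt k)) ->
  42 <= \sum_(y in porbit si r0) share y.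
Proof.
move=> n0 n1 cr; have d0 : 0 < dg by apply: ltn_trans dg_gt2.
have d1 : 1 < dg by apply: ltn_trans dg_gt2.
have [w0 wE0] := nextc_end (k := 0) n0; have [w1 wE1] := nextc_end n1.
have cl : nextc (dt dg.-1) by apply: cr; case: dg dg_gt2 => // [[|[|m]]].
have c2 : nextc (dt 2) by exact: cr.
have a0 : nextc (si^-1%g r0) by rewrite siV_dt0.
have a1 : ~~ nextc (si^-1%g (dt 1)) by rewrite siV_dt.
have a2 : ~~ nextc (si^-1%g (dt 2)) by rewrite siV_dt.
have H0 := corner_out real0 n0 a0 wE0; rewrite siV_dt0 /= in H0.
have H2 := corner_in (w := w1) (rl_dt 2) c2 a2; rewrite siV_dt in H2; have {}H2 := H2 wE1.
have [g1 H1] := corner00 (rl_dt 1) n1 a1.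
have s012 := sum_ge3 d0 d1 dg_gt2 isT isT isT.
rewrite -[r0]/(dt 0) in H0.
have m0 : 9 <= share (dt 0) by case: H0 => [[h _ _]|[h _]|[h _]|h]; exact: leq_trans h.
have m2 : 9 <= share (dt 2) by case: H2 => [[h _ _]|[h _]|[h _]|h]; exact: leq_trans h.
case: H1 => [h1|[t1 t2 t3]]; first by apply: leq_trans s012; exact: leq_trans (leq_add (leq_add m0 h1) m2).
case: H0 => [[h0 i0 x0]|[h0 _]|[h0 _]|h0]; try by apply: leq_trans s012; exact: leq_trans (leq_add (leq_add h0 g1) m2).
case: H2 => [[h2 i2 x2]|[h2 _]|[h2 _]|h2]; try by apply: leq_trans s012; exact: leq_trans (leq_add (leq_add h0 g1) h2).
have [/hasP[k]|/hasPn nt] := boolP (has (fun k => ~~ tri1 (dt k)) (iota 3 (dg - 3))).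
  rewrite mem_iota subnKC // => /andP[k3 kd] ntk.
  have hk : 12 <= share (dt k).
    case: k k3 kd ntk => [|[|[|k]]] // k3 kd ntk; apply: ge12 => //; first exact: cr.
    by apply: cr => //; exact: ltnW.
  apply: leq_trans (sum_ge4 d0 d1 dg_gt2 kd _); first by exact: leq_trans (leq_add (leq_add (leq_add h0 g1) h2) hk).
  by rewrite /= !inE !negb_or !neq_ltn k3 (ltnW k3) (ltnW (ltnW k3)).
have ee : ce (dt 2) = ce (dt dg.-1).
  have [|k k2 kd|-> //] := @run 2 dg.-1; first by rewrite -ltnS prednK.
  have kd' : k < dg by rewrite -[dg]prednK.
  have := nt k; rewrite mem_iota subnKC // kd' k2 => /(_ isT); by rewrite negbK.
have p2 : phi (phi (dt 1)) = al r0.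
  have -> : phi (phi (dt 1)) = phi^-1%g (dt 1) by rewrite -[in RHS]t1 permK.
  by rewrite phiV siV_dt.
have q1 : endv (phi (dt 1)) = Some w1 by rewrite end_phi.
have q0 : endv (phi (phi (dt 1))) = Some w0 by rewrite p2.
exfalso; apply: (incident2 q1 q0); apply: (@parallel (ce (dt 2)) (edg (phi (dt 1)))) => //.
- by rewrite ee.
- exact: incident_dart.
- exact: incident_head.
have rw : rl (si^-1%g (al (dt 1))) by rewrite rl_siV /rl wE1.
by have [_] := si_edg_neq rw; rewrite permKV x2 phiE => /nesym.
Qed.

(** The four corners beside the uncrossed edges give 9 each, and one larger value suffices, as does
    one further corner. Otherwise two distinct edges both end at [w] and [z], so [w = z], and then
    the two uncrossed edges are themselves parallel. *)
Lemma vertex_apart_uncrossed i : ~~ nextc r0 -> ~~ nextc (dt i) -> 1 < i -> i.+1 < dg ->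
  (forall k, 0 < k -> k < dg -> k != i -> nextc (dt k)) ->
  42 <= \sum_(y in porbit si r0) share y.
Proof.
move=> n0 ni i1 id' cr; have d0 : 0 < dg by apply: ltn_trans dg_gt2.
have d1 : 1 < dg by apply: ltn_trans dg_gt2.
have idg : i < dg by exact: ltnW.
have i0 : 0 < i by exact: ltnW.
have [w wE] := nextc_end (k := 0) n0; have [z zE] := nextc_end ni.
have cl : nextc (dt dg.-1) by apply: cr; (clear -i1 id'; lia).
have c1 : nextc (dt 1) by apply: cr => //; (clear -i1 id'; lia).
have ci : nextc (dt i.-1) by apply: cr; (clear -i1 id'; lia).
have ci1 : nextc (dt i.+1) by apply: cr; (clear -i1 id'; lia).
have ei : i = i.-1.+1 by rewrite prednK.
have a0 : nextc (si^-1%g r0) by rewrite siV_dt0.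
have a1 : ~~ nextc (si^-1%g (dt 1)) by rewrite siV_dt.
have ai : nextc (si^-1%g (dt i)) by rewrite ei siV_dt.
have ai1 : ~~ nextc (si^-1%g (dt i.+1)) by rewrite siV_dt.
have H0 := corner_out real0 n0 a0 wE; rewrite siV_dt0 /= -[r0]/(dt 0) in H0.
have H1 := corner_in (w := w) (rl_dt 1) c1 a1; rewrite siV_dt in H1; have {}H1 := H1 wE.
have sVi : si^-1%g (dt i) = dt i.-1 by rewrite [in LHS]ei siV_dt.
have Hi := corner_out (rl_dt i) ni ai zE; rewrite sVi /= in Hi.
have Hj := corner_in (w := z) (rl_dt i.+1) ci1 ai1; rewrite siV_dt in Hj; have {}Hj := Hj zE.
have U : uniq [:: 0; 1; i; i.+1] by rewrite /= !inE !negb_or !neq_ltn ?i1 ?i0 ?ltnS ?i0 ?leqnn ?orbT.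
have s4 := sum_ge4 d0 d1 idg id' U.
have m1 : 9 <= share (dt 1) by case: H1 => [[h _ _]|[h _]|[h _]|h]; exact: leq_trans h.
have mi : 9 <= share (dt i) by case: Hi => [[h _ _]|[h _]|[h _]|h]; exact: leq_trans h.
have mj : 9 <= share (dt i.+1) by case: Hj => [[h _ _]|[h _]|[h _]|h]; exact: leq_trans h.
case: H0 => [[h0 j0 x0]|[h0 _]|[h0 _]|h0]; try by apply: leq_trans s4; exact: leq_trans (leq_add (leq_add (leq_add h0 m1) mi) mj).
case: H1 => [[h1 j1 x1]|[h1 _]|[h1 _]|h1]; try by apply: leq_trans s4; exact: leq_trans (leq_add (leq_add (leq_add h0 h1) mi) mj).
case: Hi => [[hi ji xi]|[hi _]|[hi _]|hi]; try by apply: leq_trans s4; exact: leq_trans (leq_add (leq_add (leq_add h0 h1) hi) mj).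
case: Hj => [[hj jj xj]|[hj _]|[hj _]|hj]; try by apply: leq_trans s4; exact: leq_trans (leq_add (leq_add (leq_add h0 h1) hi) hj).
have [/hasP[k]|/hasPn nt] := boolP (has (fun k => [&& k \notin [:: 0; 1; i; i.+1] & ~~ tri1 (dt k)]) (iota 0 dg)).
  rewrite mem_iota add0n => /andP[_ kd] /andP[kn ntk].
  have := kn; rewrite !inE !negb_or => /and4P[k0 k1 ki kj].
  have hk : 12 <= share (dt k).
    by apply: ge12 => //; [(clear -k0 k1 ki kj kd; lia)|apply: cr => //; (clear -k0 k1 ki kj kd; lia)|apply: cr; (clear -k0 k1 ki kj kd; lia)].
  apply: (sum_ge (L := [:: k; 0; 1; i; i.+1])).
  - by rewrite cons_uniq kn U.
  - by rewrite /= kd d0 d1 idg id'.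
  rewrite !big_cons big_nil addn0.
  exact: leq_trans (leq_add hk (leq_add h0 (leq_add h1 (leq_add hi hj)))).
have tr k : k < dg -> k \notin [:: 0; 1; i; i.+1] -> tri1 (dt k).
  by move=> kd kn; have := nt k; rewrite mem_iota kd kn /= negbK; apply.
have g1 : ce (dt 1) = ce (dt i.-1).
  have [|k k1 ki|-> //] := @run 1 i.-1; first (clear -i1 id'; lia).
  by apply: tr; rewrite ?inE ?negb_or; (clear -k1 ki i1 id'; lia).
have g2 : ce (dt i.+1) = ce (dt dg.-1).
  have [|k k1 ki|-> //] := @run i.+1 dg.-1; first (clear -i1 id'; lia).
  by apply: tr; rewrite ?inE ?negb_or; (clear -k1 ki i1 id'; lia).
have ne : ce (dt 1) <> ce (dt dg.-1).
  have rw : rl (si^-1%g (al r0)) by rewrite rl_siV /rl wE.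
  by have [_] := si_edg_neq rw; rewrite permKV x0 x1 => /nesym.
have wz : w = z.
  apply: (@parallel (ce (dt 1)) (ce (dt dg.-1))) => //; first by rewrite g1.
  by rewrite -g2.
have [v vE] := rlP _ real0; have [v' vE'] := rlP _ (rl_dt i).
have vv : v' = v.
  have h k : endv (dt k) = endv r0 by elim: k => //= k IH; rewrite si_end.
  by move: vE'; rewrite h vE => -[].
have q0 : endv (phi r0) = Some w by rewrite end_phi.
have q1 : endv (phi (dt i)) = Some w by rewrite end_phi wz.
exfalso; apply: (incident2 vE q0); apply: (@parallel (edg r0) (edg (dt i))).
- exact: incident_dart.
- exact: incident_head.
- by apply: incident_dart; rewrite vE' vv.
- exact: incident_head.
rewrite vv in vE'; move=> /(pm_end_unique pm vE vE') E'.
by have i0' := dt_inj d0 idg E'; rewrite -i0' in i1.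
Qed.

(** A full turn of 1-triangles would return to the same dart with a strictly changed rank. *)
Lemma vertex_not_all_tri1 : exists k, ~~ tri1 (dt k).
Proof.
have [/existsP[k nt]|] := boolP [exists k : 'I_dg.+1, ~~ tri1 (dt k)]; first by exists k.
rewrite negb_exists => /forallP all1.
have [//|k _ kd|_ _] := @run 0 dg.
  have kd' : k < dg.+1 by [].
  by have := all1 (Ordinal kd'); rewrite negbK.
have d0 : 0 < dg by apply: ltn_trans dg_gt2.
by rewrite dt_dg -[dt 0]/r0 subn0; case: ifP => _; rewrite -[leqRHS]addn0 leq_add2l leqNgt d0.
Qed.
End Vertex.

Lemma vertex_share r : rl r -> 42 <= \sum_(y in porbit si r) share y.
Proof.
move=> rr; pose U := [set y in porbit si r | ~~ nextc y].
have sU : \sum_(y in porbit si r) ~~ nextc y = #|U|.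
  rewrite -sum1_card big_mkcond [RHS]big_mkcond; apply: eq_bigr => y _; rewrite inE.
  by case: (_ \in _); case: (nextc _).
have rl_orb y : y \in porbit si r -> rl y.
  by rewrite porbit_traject => /trajectP[k _ ->]; elim: k => //= k IH; rewrite rl_si.
have orb_iter x k : x \in porbit si r -> iter k si x \in porbit si r.
  move=> xr; elim: k => //= k IH; apply: porbit_trans IH _; exact: porbit_step.
have eq_orb y : y \in porbit si r -> porbit si r = porbit si y.
  by move=> yr; apply/eqP; rewrite eq_porbit_mem porbit_sym.
have iter_inj x i j : x \in porbit si r -> i < #|porbit si x| -> j < #|porbit si x| ->
    iter i si x = iter j si x -> i = j.
  move=> _ ih jh E'; have V' := uniq_traject_porbit si x.
  apply/eqP; rewrite -(nth_uniq x _ _ V') ?size_traject //.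
  by rewrite !nth_traject //; apply/eqP.
have crossed y : y \in porbit si r -> y \notin U -> nextc y.
  by move=> yr; rewrite inE yr negbK.
case Uc : #|U| => [|[|[|n]]].
- have [k nt] := vertex_not_all_tri1 rr.
  have kr := orb_iter r k (porbit_id _ _); rewrite (eq_orb _ kr).
  apply: vertex_all_crossed => // [|j]; first exact: rl_orb.
  apply: crossed; first exact: orb_iter.
  by rewrite (cards0_eq Uc) inE.
- have /cards1P[x Ux] : #|U| == 1 by rewrite Uc.
  have : x \in U by rewrite Ux inE.
  rewrite inE => /andP[xr nx]; rewrite (eq_orb _ xr).
  apply: vertex_one_uncrossed => // [|k k0 kd]; first exact: rl_orb.
  apply: crossed; first exact: orb_iter.
  rewrite Ux inE; apply/eqP => E'; have := iter_inj x k 0 xr kd (leq_trans k0 (ltnW kd)) E'.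
  by move=> k00; rewrite k00 in k0.
- have /cards2P[x [y [xy Uxy]]] : #|U| == 2 by rewrite Uc.
  have : x \in U by rewrite Uxy !inE eqxx.
  rewrite inE => /andP[xr nx].
  have : y \in U by rewrite Uxy !inE eqxx orbT.
  rewrite inE => /andP[yr ny].
  have : y \in porbit si x by rewrite -eq_orb.
  rewrite porbit_traject => /trajectP[i id' yE].
  have i0 : 0 < i by rewrite lt0n; apply/eqP => i0; rewrite yE i0 eqxx in xy.
  have xi k : k < #|porbit si x| -> 0 < k -> k != i -> nextc (iter k si x).
    move=> kd k0 ki; apply: crossed; first exact: orb_iter.
    rewrite Uxy !inE negb_or; apply/andP; split; apply/eqP => E'.
      by have := iter_inj x k 0 xr kd (leq_trans k0 (ltnW kd)) E' => k00; rewrite k00 in k0.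
    by rewrite yE in E'; rewrite (iter_inj x k i xr kd id' E') eqxx in ki.
  have [i1|i1] := eqVneq i 1.
    rewrite (eq_orb _ xr); apply: vertex_adjacent_uncrossed => //.
    + exact: rl_orb.
    + by rewrite yE i1 in ny.
    by move=> k k1 kd; apply: xi => //; [exact: ltnW|rewrite i1 gtn_eqF].
  (* The second uncrossed edge comes just before [x] in cyclic order: start at [y] instead. *)
  have [il|il] := eqVneq i.+1 #|porbit si x|.
    have yx : si y = x by rewrite yE -iterS il; exact: iter_porbit.
    rewrite (eq_orb _ yr); apply: vertex_adjacent_uncrossed => //=.
    + exact: rl_orb.
    + by rewrite yx.
    move=> k k1 kd; apply: crossed; first exact: orb_iter.
    rewrite Uxy !inE negb_or; apply/andP; split; apply/eqP => E'.
      rewrite -yx in E'; have := iter_inj y k 1 yr kd (ltn_trans k1 kd) E' => k11.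
      by rewrite k11 in k1.
    have k0 : 0 < k by exact: ltnW.
    by have := iter_inj y k 0 yr kd (ltn_trans k0 kd) E' => k11; rewrite k11 in k0.
  rewrite (eq_orb _ xr); apply: (@vertex_apart_uncrossed _ _ i) => //.
  + exact: rl_orb.
  + by rewrite -yE.
  + by rewrite ltn_neqAle eq_sym i1.
  + by rewrite ltn_neqAle il.
  by move=> k k0 kd; exact: xi.
by apply: vertex_uncrossed3 => //; rewrite sU Uc.
Qed.

(** * Summation over faces and vertices *)

Let reals := [set d | rl d].

Lemma sum_porbits (s : {perm D}) (g : D -> nat) :
  \sum_d g d = \sum_(O in porbits s) \sum_(y in O) g y.
Proof.
rewrite (eq_bigl (fun d => d \in [set: D])) => [|d]; last by rewrite inE.
rewrite (partition_big_imset (porbit s)) /=.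
have -> : [set porbit s x | x in [set: D]] = porbits s.
  by apply/setP => O; apply/imsetP/imsetP => -[x _ ->]; exists x.
apply: eq_bigr => O /imsetP[x _ ->]; apply: eq_bigl => y.
by rewrite inE eq_porbit_mem porbit_sym.
Qed.

Lemma vertex_porbit r : rl r -> porbit si r = [set d | endv d == endv r].
Proof.
case/rlP=> v rv; apply/setP => d; rewrite inE; apply/idP/eqP => [|dr].
  rewrite porbit_traject => /trajectP[k _ ->].
  by elim: k => //= k IH; rewrite si_end.
by apply: (pm_vertex pm rv); rewrite dr.
Qed.

Lemma crossing_porbit d : ~~ rl d -> 4 <= \sum_(y in porbit si d) ~~ rl y.
Proof.
move=> nd; have dN := rlN nd.
have rO k : ~~ rl (iter k si d) by elim: k => //= k IH; rewrite rl_si.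
have n1 : si d != d.
  by apply/eqP => h; have := pm_si_edg pm dN; rewrite h => /esym; exact: (pm_xed_neq pm dN).
have n2 : si (si d) != d.
  by apply/eqP => h; have := pm_si_fw pm dN; rewrite h; case: (fw d).
have n3 : si (si (si d)) != d.
  by apply/eqP => h; have := pm_si4 pm dN; rewrite h => /eqP; rewrite (negPf n1).
have U : uniq (traject si d 4).
  by rewrite /= !inE !negb_or !(inj_eq perm_inj) ![d == _]eq_sym n1 n2 n3.
apply: leq_trans (_ : #|porbit si d| <= _).
  rewrite -[4](size_traject si d) -(card_uniqP U); apply/subset_leq_card/subsetP => y.
  case/trajectP=> k _ ->; elim: k => [|k IH]; first exact: porbit_id.
  exact: porbit_trans IH (porbit_step _ _).
rewrite -sum1_card; apply: leq_sum => y; rewrite porbit_traject => /trajectP[k _ ->].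
by rewrite rO.
Qed.

Lemma vertices_charge : 42 * #|[set endv d | d in reals]| <= \sum_(d in reals) share d.
Proof.
rewrite (partition_big_imset endv) /= mulnC -sum_nat_const; apply: leq_sum => o /imsetP[r rr ->].
rewrite inE in rr; apply: leq_trans (vertex_share rr) _.
rewrite (eq_bigl (fun i => (i \in reals) && (endv i == endv r))) // => d.
rewrite vertex_porbit // !inE; case: eqP => [dr|]; rewrite ?andbF ?andbT //.
by rewrite /rl dr -/(rl r) rr.
Qed.

(** Multiplied by 4 to avoid a division: each crossing has four darts. *)
Lemma card_si_orbits :
  4 * ncyc si <= 4 * #|[set endv d | d in reals]| + \sum_d ~~ rl d.
Proof.
have le : #|[set porbit si d | d in reals]| <= #|[set endv d | d in reals]|.
  have -> : [set porbit si d | d in reals] =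
      [set [set d | endv d == o] | o in [set endv d | d in reals]].
    rewrite -imset_comp; apply: eq_in_imset => d; rewrite inE; exact: vertex_porbit.
  exact: leq_imset_card.
rewrite (sum_porbits si); apply: leq_trans (leq_add (leq_mul (leqnn 4) le) (leqnn _)).
rewrite /ncyc mulnC [4 * _]mulnC -!sum_nat_const.
rewrite (bigID [in [set porbit si d | d in reals]]) /=.
apply: leq_add.
  rewrite [leqRHS]big_mkcond [leqLHS]big_mkcond; apply: leq_sum => O _.
  by case: (O \in _); rewrite ?andbF //; case: ifP.
rewrite [leqLHS]big_mkcond [leqRHS]big_mkcond; apply: leq_sum => O _ /=.
case: ifP => [/andP[/imsetP[d _ ->] nO]|_]; last by case: ifP.
rewrite imset_f //; apply: crossing_porbit; apply: contra nO => rd.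
by apply: imset_f; rewrite inE.
Qed.

(** Euler's inequality bounds the number of faces from below. The darts at crossings cancel because
    4 is subtracted per face; 240 is [2 * 120], and 78 is the 120 per vertex from Euler's inequality
    minus the 42 collected there. *)
Lemma charge_bound : 0 < #|D| -> 6 * #|reals| + 240 <= 78 * #|[set endv d | d in reals]|.
Proof.
move=> /card_gt0P[d0 _]; have V1 := vertices_charge; have S1 := card_si_orbits.
have Rs : \sum_d rl d = #|reals|.
  by rewrite -sum1_card [RHS]big_mkcond; apply: eq_bigr => d _; rewrite inE; case: rl.
have RX : \sum_d rl d + \sum_d ~~ rl d = #|D|.
  by rewrite -big_split -sum1_card /=; apply: eq_bigr => d _; case: rl.
have A1 : (ncyc al).*2 = #|D|.
  by apply: ncyc_invol => // d; apply/eqP; exact: al_neq.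
have C1 : 0 < ncc al si by apply/card_gt0P; exists (comp (link al si) d0); exact: imset_f.
have P1 := pm_planar pm; rewrite /planar -/phi in P1.
have F1 : 120 * ncyc phi + \sum_d cost d <= \sum_d gain d.
  rewrite !(sum_porbits phi) mulnC -sum_nat_const -big_split /=.
  by apply: leq_sum => O /imsetP[d _ ->]; exact: face_charge.
have G1 : \sum_d gain d = 60 * \sum_d rl d + 30 * \sum_d ~~ rl d + 6 * #|[set r | tri1 r]|.
  rewrite -[in RHS]sum1_card [X in 6 * X]big_mkcond !big_distrr -!big_split /=.
  by apply: eq_bigr => d _; rewrite /gain inE; case: rl; case: tri1.
have K1 : \sum_d cost d = 6 * #|paying| + 6 * \sum_d rl d + \sum_(d in reals) share d.
  rewrite -[in RHS]sum1_card [X in 6 * X]big_mkcond [X in _ + X]big_mkcond /=.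
  rewrite !big_distrr -!big_split /=.
  by apply: eq_bigr => d _; rewrite /cost [d \in reals]inE -addnA; case: rl; case: (d \in paying).
rewrite card_paying in K1; move: F1 P1; rewrite G1 K1 -Rs; move: (\sum_(d in reals) share d) V1.
move: RX A1 S1 C1; move: (ncc al si) (ncyc phi) (ncyc al) (ncyc si) #|D| (\sum_d rl d)
 (\sum_d ~~ rl d) #|[set endv d | d in reals]| #|[set r | tri1 r]|; lia.
Qed.
End Charge.

(** * The bound for minimum degree three *)

Section Proper.
Variables (D E V : finType) (X : darts D E V) (A : {set D}) (al si : {perm D}).
Hypothesis emb : embedded X A al si.
Hypothesis si_opp : forall d, d \in A -> end_at X d = None -> si (si d) = opp X d.
Hypothesis deg3 : forall d v, end_at X d = Some v -> 2 < #|[set d' | end_at X d' == Some v]|.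

Let T := {d : D | d \in A}.

Let alA (t : T) : al (val t) \in A.
Proof. by have [] := emb_al emb (valP t). Qed.

Let siA (t : T) : si (val t) \in A.
Proof. exact: emb_si emb _ (valP t). Qed.

Let al1 (t : T) : T := exist _ (al (val t)) (alA t).
Let si1 (t : T) : T := exist _ (si (val t)) (siA t).

Let al1_inj : injective al1.
Proof. by move=> x y /(congr1 val) /perm_inj /val_inj. Qed.

Let si1_inj : injective si1.
Proof. by move=> x y /(congr1 val) /perm_inj /val_inj. Qed.

Let alT := perm al1_inj.
Let siT := perm si1_inj.

Let alT_val t : val (alT t) = al (val t).
Proof. by rewrite permE. Qed.

Let siT_val t : val (siT t) = si (val t).
Proof. by rewrite permE. Qed.

Let outside z : z \notin codom (val : T -> D) -> z \notin A.
Proof. by apply: contra => zA; apply/codomP; exists (exist _ z zA). Qed.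

Let si_cross d : d \in A -> end_at X d = None ->
  [/\ edge_of X (si d) = cross_edge X d, cross_edge X (si d) = edge_of X d &
    end_at X (si d) = None].
Proof.
move=> dA dN; have [d' [dN' e1 e2 po]] := emb_cross emb dA dN.
have n0 : opp X d <> d by move=> h; have := opp_forth dN; rewrite h; case: (forth _ _).
have n1 : si d <> d by move=> h; have := si_opp dA dN; rewrite !h => /esym.
have n2 : si d <> opp X d by rewrite -si_opp // => /perm_inj /esym.
have := porbit_step si d; rewrite po !inE -!orbA => /or4P[] /eqP // ->; first by rewrite e1 e2.
by rewrite opp_edge // opp_cross // opp_end // e1 e2.
Qed.

Lemma proper_restriction : exists al' si' : {perm T}, proper_map al' si'
  (fun t => edge_of X (val t)) (fun t => end_at X (val t)) (fun t => cross_edge X (val t))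
  (fun t => rank X (val t)) (fun t => forth X (val t)).
Proof.
exists alT, siT; split=> /=.
- apply: (planar_restrict (k := val : T -> D) val_inj) (emb_planar emb).
  + by move=> z /outside zA; have [] := emb_fix emb zA.
  + by move=> z /outside zA; have [] := emb_fix emb zA.
  + by move=> x; rewrite -alT_val.
  + by move=> x; rewrite -siT_val.
- by move=> d; apply: val_inj; rewrite !alT_val; have [] := emb_al emb (valP d).
- by move=> d; rewrite alT_val; have [] := emb_al emb (valP d).
- by move=> d; rewrite alT_val; have [] := emb_al emb (valP d).
- by move=> d; rewrite alT_val; have [] := emb_al emb (valP d).
- move=> d; rewrite siT_val; case vE : (end_at X (val d)) => [v|]; first by have := emb_si_end emb vE.
  by have [] := si_cross (valP d) vE.
- move=> d d' v vE vE'; have := emb_vertex emb vE vE'.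
  by rewrite (porbit_restrict val_inj _ _ (fun x => esym (siT_val x))).
- move=> d v vE; have := deg3 vE.
  have le : #|[set d' | end_at X d' == Some v]| <= #|porbit si (val d)|.
    apply/subset_leq_card/subsetP => d'; rewrite inE => /eqP dv; by have := emb_vertex emb vE dv.
  move=> /leq_trans /(_ le) {}le.
  have n2 : si (si (val d)) != val d.
    apply/eqP => h; have sub : porbit si (val d) \subset [set val d; si (val d)].
      apply/subsetP => y; rewrite porbit_traject => /trajectP[k _ ->] {y}.
      elim: k => [|k IH]; first by rewrite !inE eqxx.
      by move: IH; rewrite !inE iterS => /orP[/eqP->|/eqP->]; rewrite ?h eqxx ?orbT.
    by have := subset_leq_card sub; rewrite cards2 leqNgt (leq_ltn_trans _ le) //; case: eqP.
  rewrite -!val_eqE /= !siT_val; split=> //.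
  by apply: contraNneq n2 => h; rewrite !h.
- by move=> d dN; rewrite siT_val; have [] := si_cross (valP d) dN.
- by move=> d dN; rewrite siT_val; have [] := si_cross (valP d) dN.
- by move=> d dN; rewrite !siT_val si_opp ?opp_rank //; exact: valP.
- by move=> d dN; rewrite !siT_val si_opp ?opp_forth //; exact: valP.
- move=> d dN; have h := si_opp (valP d) dN.
  have oA : opp X (val d) \in A by rewrite -h -!siT_val; exact: valP.
  by apply: val_inj; rewrite !siT_val h (si_opp oA (opp_end dN)) oppK.
- by move=> d dN; apply/eqP; exact: cross_neq.
- move=> d d' dN dN' e1 e2; have [h|h] := cross_unique dN dN' e1 e2.
    by left; exact: val_inj.
  by right; apply: val_inj; rewrite !siT_val si_opp //; exact: valP.
- by move=> d d' v h h' e1; apply: val_inj; exact: (end_unique h h' e1).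
- by move=> d1 d2 d1' d2' v v'; exact: no_parallel.
- by move=> d1 d2 d v; exact: adj_no_cross.
by move=> d d' d''; exact: no_triple.
Qed.

Lemma embedded_bound d0 v0 : end_at X d0 = Some v0 ->
  6 * #|[set d | isSome (end_at X d)]| + 240 <=
    78 * #|[set end_at X d | d in [set d | isSome (end_at X d)]]|.
Proof.
move=> h0; have [al' [si' pm]] := proper_restriction.
have T0 : 0 < #|{: T}| by apply/card_gt0P; exists (exist _ d0 (emb_end emb h0)).
have := charge_bound pm T0.
have -> : [set d | isSome (end_at X d)] = [set val t | t in [set t : T | isSome (end_at X (val t))]].
  apply/setP => d; rewrite inE; apply/idP/imsetP => [|[t]]; last by rewrite inE => h ->.
  case vE : (end_at X d) => [v|] // _; exists (exist _ d (emb_end emb vE)) => //.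
  by rewrite inE /= vE.
by rewrite (card_imset _ val_inj) -imset_comp.
Qed.
End Proper.

(** Each edge has two darts at vertices, which turns the 6 of [charge_bound] into 12. The vertex set
    is a subset [S] of ['I_n] because vertices will be removed by isolating them. *)
Lemma drawing_bound (n : nat) (e : rel 'I_n) (S : {set 'I_n}) :
  symmetric e -> irreflexive e -> simple_quasiplanar e ->
  (forall x y, e x y -> x \in S) -> (forall v, v \in S -> 2 < #|[set w | e v w]|) ->
  0 < #|S| -> 12 * num_edges e + 240 <= 78 * #|S|.
Proof.
move=> es ei [pos [arc [drawing [simple quasi]]]] eS degS /card_gt0P[v0 v0S].
have [al0 [si0 /remove_touches[A [al [si [emb si_opp]]]]]] := drawing_embedded drawing simple quasi.
have edge_at (v w : 'I_n) : e v w -> exists d : hdart e arc, vt d = Some v /\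
    w = (if (val (eo d)).1 == v then (val (eo d)).2 else (val (eo d)).1).
  move=> vw; have vNw : v != w by apply: contraTneq vw => ->; rewrite ei.
  have [lt|lt|/val_inj vw'] := ltngtP v w; last by rewrite vw' eqxx in vNw.
    have xe : is_edge e (v, w) by rewrite /is_edge /= lt.
    have [d [_ [h1 h2 _ _]]] := end_dart arc (exist _ (v, w) xe).
    by exists d; rewrite h1 h2 /= eqxx.
  have xe : is_edge e (w, v) by rewrite /is_edge /= lt es.
  have [_ [d [_ _ h1 h2]]] := end_dart arc (exist _ (w, v) xe).
  by exists d; rewrite h1 h2 /= eq_sym (negPf vNw).
have inS (d : hdart e arc) v : vt d = Some v -> v \in S.
  have := valP (eo d); rewrite /is_edge => /andP[_ exy] /vt_in[->|->]; first exact: eS exy.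
  by rewrite es in exy; exact: eS exy.
have deg3 (d : hdart e arc) v : vt d = Some v -> 2 < #|[set d' : hdart e arc | vt d' == Some v]|.
  move=> /inS/degS /leq_trans; apply.
  pose g (d' : hdart e arc) := if (val (eo d')).1 == v then (val (eo d')).2 else (val (eo d')).1.
  apply: leq_trans (leq_imset_card g _); apply/subset_leq_card/subsetP => w.
  rewrite inE => /edge_at[d' [h1 h2]]; apply/imsetP; exists d' => //.
  by rewrite inE h1.
have [d0 d0v] : exists d : hdart e arc, vt d = Some v0.
  have /card_gt0P[w] : 0 < #|[set w | e v0 w]| by apply: ltn_trans (degS _ v0S).
  by rewrite inE => /edge_at[d [h _]]; exists d.
have := embedded_bound emb si_opp deg3 d0v => /=.
set Rs := [set d | _]; set Vs := [set vt d | d in Rs].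
have VS : #|Vs| <= #|S|.
  rewrite -[leqRHS](card_imset _ (@Some_inj _)); apply/subset_leq_card/subsetP => o /imsetP[d].
  by rewrite inE; case h : (vt d) => [v|] // _ ->; rewrite imset_f // (inS _ _ h).
have [f1 f1P] := fin_all_exists (end_dart arc (e := e)); have [f2 f2P] := fin_all_exists f1P.
pose h (p : {x | is_edge e x} * bool) := if p.2 then f1 p.1 else f2 p.1.
have h_inj : injective h.
  move=> [x b] [y c]; rewrite /h /= => E.
  have [x1 x2 x3 x4] := f2P x; have [y1 y2 y3 y4] := f2P y; have := edge_lt x.
  have xy : x = y by move: (congr1 (@eo _ _ _) E); case: b c {E} => [] []; rewrite ?x2 ?x4 ?y2 ?y4.
  subst y; case: b c E => [] [] // E; first by move: x1; rewrite E x3 => -[->]; rewrite ltnn.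
  by move: x3; rewrite E x1 => -[->]; rewrite ltnn.
have ER : 2 * num_edges e <= #|Rs|.
  have -> : 2 * num_edges e = #|{: {x | is_edge e x} * bool}|.
    by rewrite card_prod card_bool card_sig mulnC /num_edges cardsE.
  rewrite -(card_imset predT h_inj); apply/subset_leq_card/subsetP => d /imsetP[[x b] _ ->].
  by rewrite inE /h /=; have [h1 _ h3 _] := f2P x; case: b; rewrite ?h1 ?h3.
move: ER VS; move: (num_edges e) #|Rs| #|Vs| #|S|; clear; lia.
Qed.

(** * Induction on the number of vertices *)

Lemma sub_quasiplanar (n : nat) (e e' : rel 'I_n) :
  subrel e' e -> simple_quasiplanar e -> simple_quasiplanar e'.
Proof.
move=> sub [pos [arc [[d1 [d2 [d3 [d4 [d5 [d6 d7]]]]]] [simple quasi]]]].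
have sb x : is_edge e' x -> is_edge e x by case/andP=> lt /sub xy; apply/andP.
exists pos, arc; split; last split.
- split=> //; split=> //; split; first by move=> x /sb; exact: d3.
  split; first by move=> x w t /sb; exact: d4.
  split; first by move=> x y /sb hx /sb; exact: d5.
  split; first by move=> x y t s /sb hx /sb; exact: d6.
  by move=> x y z t s r /sb hx /sb hy /sb; exact: d7.
- by move=> x y t1 s1 t2 s2 /sb hx /sb; exact: simple.
by move=> x y z /sb hx /sb hy /sb; exact: quasi.
Qed.

Lemma num_edges_choose (n : nat) (e : rel 'I_n) (S : {set 'I_n}) : symmetric e ->
  (forall x y, e x y -> x \in S) -> num_edges e <= 'C(#|S|, 2).
Proof.
move=> es eS; rewrite -cards_draws /num_edges.
rewrite -(@card_in_imset _ _ (fun x : 'I_n * 'I_n => [set x.1; x.2])).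
  apply/subset_leq_card/subsetP => B /imsetP[x]; rewrite inE => /andP[lt xy] ->.
  rewrite inE cards2 neq_ltn lt /= andbT; apply/subsetP => z; rewrite !inE.
  by move=> /orP[/eqP->|/eqP->]; [exact: eS xy|move: xy; rewrite es; exact: eS].
move=> [x1 x2] [y1 y2]; rewrite !inE /is_edge /= => /andP[lx _] /andP[ly _] E.
have : x1 \in [set y1; y2] by rewrite -E !inE eqxx.
have : x2 \in [set y1; y2] by rewrite -E !inE eqxx orbT.
rewrite !inE => /orP[] /eqP h2 /orP[] /eqP h1; subst x1 x2; rewrite ?ltnn // in lx.
by have := ltn_trans lx ly; rewrite ltnn.
Qed.

Lemma num_edges_remove (n : nat) (e : rel 'I_n) (v : 'I_n) : symmetric e ->
  num_edges e <= num_edges (fun x y => [&& e x y, x != v & y != v]) + #|[set w | e v w]|.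
Proof.
move=> es; pose g (w : 'I_n) := if v < w then (v, w) else (w, v).
apply: leq_trans (leq_add (leqnn _) (leq_imset_card g _)).
apply: leq_trans (leq_card_setU _ _); apply/subset_leq_card/subsetP => -[x y].
rewrite !inE /is_edge /= => /andP[lt xy]; rewrite lt xy /=.
have [xv|xv] /= := eqVneq x v.
  by apply/imsetP; exists y; rewrite ?inE -?xv // /g -xv lt.
have [yv|//] := eqVneq y v.
apply/imsetP; exists x; first by rewrite inE es -yv.
by rewrite /g -yv ltnNge ltnW.
Qed.

(** For [#|S| = 4] the bound is tight: at most 6 edges, and [2 * 6 + 40 = 13 * 4]. Removing a vertex
    of degree at most 2 lowers the left side by at most 4 and the right side by 13. *)
Lemma supported_bound (n : nat) (e : rel 'I_n) (S : {set 'I_n}) :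
  symmetric e -> irreflexive e -> simple_quasiplanar e ->
  (forall x y, e x y -> x \in S) -> 4 <= #|S| -> 2 * num_edges e + 40 <= 13 * #|S|.
Proof.
move cS : #|S| => m; elim: m => // m IH in e S cS *; move=> es ei qe eS.
rewrite leq_eqVlt => /orP[/eqP m3|m4].
  by have := num_edges_choose es eS; rewrite cS -m3 [X in _ <= X](_ : _ = 6) //; lia.
have [/existsP[v /andP[vS dv]]|] := boolP [exists v, (v \in S) && (#|[set w | e v w]| <= 2)].
  have cS' : #|S :\ v| = m by have := cardsD1 v S; rewrite vS cS add1n => -[].
  pose e' x y := [&& e x y, x != v & y != v].
  have le : num_edges e <= num_edges e' + #|[set w | e v w]| := num_edges_remove v es.
  suff : 2 * num_edges e' + 40 <= 13 * m.
    by move: le dv; move: (num_edges e) (num_edges e') #|[set w | e v w]|; clear; lia.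
  apply: (IH e' _ cS') => //.
  - by move=> x y; rewrite /e' es [(x != v) && _]andbC.
  - by move=> x; rewrite /e' ei.
  - by apply: sub_quasiplanar qe => x y /andP[].
  by move=> x y /and3P[/eS xS xv _]; rewrite !inE xv.
rewrite negb_exists => /forallP h.
have := drawing_bound es ei qe eS; rewrite cS => b.
suff : 12 * num_edges e + 240 <= 78 * m.+1 by clear; lia.
by apply: b => // v vS; have := h v; rewrite vS -ltnNge.
Qed.

Theorem theorem26 (n : nat) (e : rel 'I_n) :
  (4 <= n)%N -> symmetric e -> irreflexive e -> simple_quasiplanar e ->
  (INR (num_edges e) <= 13 / 2 * INR n - 20)%R.
Proof.
move=> n4 es ei qe.
have := @supported_bound n e [set: 'I_n] es ei qe (fun x y _ => in_setT x).
rewrite cardsT card_ord => /(_ n4) /leP/le_INR.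
rewrite plus_INR !mult_INR (INR_IZR_INZ 2) (INR_IZR_INZ 40) (INR_IZR_INZ 13) /=; lra.
Qed.
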